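(* Let $N\ge 1$, $0<\gamma<\min\{2,N\}$, let $u_0\ge 0$ be a measurable function on $\mathbb{R}^N$, and let $f\in S_q$ with $q\in[1,\infty)$. Let $F(u)=\int_u^\infty \frac{d\tau}{f(\tau)}$. Suppose that one of the following holds: (i) $r>N/(2-\gamma)$, $q<1+r$ and $F(u_0)^{-r}\in L^1_{\rm ul}(\mathbb{R}^N)$. (ii) $r>N/(2-\gamma)$, $q=1+r$, $F(u_0)^{-r}\in L^1_{\rm ul}(\mathbb{R}^N)$ and $f'(\xi)F(\xi)\le q$ for all sufficiently large $\xi>0$. (iii) $r=N/(2-\gamma)$, $q<1+r$ and $F(u_0)^{-r}\in \mathcal{L}^1_{\rm ul}(\mathbb{R}^N)$. Then there exists $T>0$ such that the Cauchy problem $$\partial_t u-\Delta u=|x|^{-\gamma}f(u)\ \ (x\in\mathbb{R}^N,\ t\in(0,T)),\qquad u(x,0)=u_0(x)\ \ (x\in\mathbb{R}^N)$$ has a local-in-time nonnegative solution $u$ in $\mathbb{R}^N\times(0,T)$. Moreover, in all cases, there exists a constant $C>0$ depending on $N$ and $u_0$ such that $$\|F(u(t))^{-r}\|_{L^1_{\rm ul}(\mathbb{R}^N)}\le C\quad\text{for } 0<t<T.$$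
   Context: Uniformly local spaces: $B(y,\rho)=\{x\in\mathbb{R}^N: |x-y|<\rho\}$; $L^1_{\rm ul}(\mathbb{R}^N)$ is the set of $u\in L^1_{\rm loc}(\mathbb{R}^N)$ with $\|u\|_{L^1_{\rm ul}(\mathbb{R}^N)}:=\sup_{y\in\mathbb{R}^N}\int_{B(y,1)}|u(x)|\,dx<\infty$. $\mathcal{L}^1_{\rm ul}(\mathbb{R}^N)$ is the closure in $L^1_{\rm ul}(\mathbb{R}^N)$, with respect to this norm, of the space $BUC(\mathbb{R}^N)$ of bounded uniformly continuous functions. Class $S_q$: for $q\in\mathbb{R}$, $S_q$ is the set of $f\in C([0,\infty))$ such that $f\in C^1((0,\infty))$, $f(u)>0$, $f'(u)\ge 0$ and $F(u):=\int_u^\infty \frac{d\tau}{f(\tau)}<\infty$ for all $u>0$, and the limit $\lim_{\xi\to\infty}f'(\xi)F(\xi)$ exists and equals $q$. One allows $F(0)=\int_0^\infty \frac{d\tau}{f(\tau)}\in(0,\infty]$, with $F(0)^{-r}=0$ if $F(0)=\infty$. Heat semigroup: $[e^{t\Delta}\phi](x)=\int_{\mathbb{R}^N}G(x-y,t)\phi(y)\,dy$ with $G(x,t)=(4\pi t)^{-N/2}\exp(-|x|^2/(4t))$. Solution: a nonnegative measurable function $u$ is a local-in-time solution of the Cauchy problem in $\mathbb{R}^N\times(0,T)$ (where $T>0$) if $u\in L^\infty((0,T),L^1_{\rm ul}(\mathbb{R}^N))\cap L^\infty_{\rm loc}((0,T),L^\infty(\mathbb{R}^N))$ and $$u(x,t)=[e^{t\Delta}u_0](x)+\int_0^t[e^{(t-s)\Delta}|\cdot|^{-\gamma}f(u(\cdot,s))](x)\,ds$$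 for a.a. $x\in\mathbb{R}^N$, $0<t<T$. *)

(* Defs.v *)
From HB Require Import structures.
From mathcomp Require Import all_boot all_order all_algebra.
From mathcomp Require Import all_classical all_reals all_analysis.

Set Implicit Arguments.
Unset Strict Implicit.
Unset Printing Implicit Defensive.

Import Order.TTheory GRing.Theory Num.Theory.
Import numFieldNormedType.Exports.

Local Open Scope classical_set_scope.
Local Open Scope ring_scope.

Section rV_measurable.
Context {R : realType}.
Variable n : nat.

Let coor (i : 'I_n) (v : 'rV[R]_n) : measurableTypeR R := v ord0 i.

Let rV_set0 : g_sigma_preimage coor set0.
Proof. exact: sigma_algebra0. Qed.

Let rV_setC A : g_sigma_preimage coor A -> g_sigma_preimage coor (~` A).
Proof. exact: sigma_algebraC. Qed.

Let rV_bigcup (F : (set 'rV[R]_n)^nat) :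
  (forall i, g_sigma_preimage coor (F i)) ->
  g_sigma_preimage coor (\bigcup_i F i).
Proof. exact: sigma_algebra_bigcup. Qed.

(* The sigma-algebra generated by the coordinates, i.e. the Borel one. *)
HB.instance Definition _ :=
  @isMeasurable.Build (measure_tuple_display default_measure_display)
    'rV[R]_n (g_sigma_preimage coor) rV_set0 rV_setC rV_bigcup.

Lemma measurable_coor (i : 'I_n) :
  measurable_fun [set: 'rV[R]_n] (coor i).
Proof.
move=> _ Y mY; rewrite setTI; apply: sub_sigma_algebra => /=.
rewrite -bigcup_seq/=; exists i => /=; first by rewrite mem_index_enum.
by exists Y => //; rewrite setTI.
Qed.

Lemma measurable_fun_coorP d (T : measurableType d) (f : T -> 'rV[R]_n) :
  (forall i, measurable_fun [set: T]
     (fun x => f x ord0 i : measurableTypeR R)) ->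
  measurable_fun [set: T] f.
Proof.
move=> mf.
suff h : g_sigma_preimage (fun i => coor i \o f) `<=` measurable.
  move=> _ A mA; rewrite setTI; apply: h.
  by rewrite g_sigma_preimage_comp; exists A => //; rewrite setTI.
apply: smallest_sub; first exact: sigma_algebra_measurable.
rewrite -bigcup_seq; apply: bigcup_sub => i _ A [B mB <-]; exact: mf.
Qed.

End rV_measurable.

Section Rn.
Context {R : realType}.

Definition cons_rV n (p : measurableTypeR R * 'rV[R]_n) : 'rV[R]_n.+1 :=
  \row_i if unlift ord0 i is Some j then p.2 ord0 j else p.1.

Definition uncons_rV n (v : 'rV[R]_n.+1) : measurableTypeR R * 'rV[R]_n :=
  (v ord0 ord0, \row_j v ord0 (lift ord0 j)).

Lemma cons_rVK n : cancel (@cons_rV n) (@uncons_rV n).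
Proof.
move=> [a v]; rewrite /uncons_rV /cons_rV /= mxE unlift_none; congr pair.
by apply/rowP => j; rewrite !mxE liftK.
Qed.

Lemma measurable_cons_rV n : measurable_fun setT (@cons_rV n).
Proof.
apply: measurable_fun_coorP => i.
case: (unliftP ord0 i) => [j|] ->.
  rewrite (_ : (fun _ => _) = (fun v : 'rV[R]_n => v ord0 j) \o snd).
    by apply: measurableT_comp => //; exact: measurable_coor.
  by apply/funext => x /=; rewrite mxE liftK.
rewrite (_ : (fun _ => _) = fst) //.
by apply/funext => x /=; rewrite mxE unlift_none.
Qed.

HB.instance Definition _ n :=
  isMeasurableFun.Build _ _ _ _ (@cons_rV n) (@measurable_cons_rV n).

Lemma measurable_uncons_rV n : measurable_fun setT (@uncons_rV n).
Proof.
apply/measurable_fun_pairP; split; first exact: measurable_coor.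
apply: measurable_fun_coorP => i.
rewrite (_ : (fun _ => _) = (fun v : 'rV[R]_n.+1 => v ord0 (lift ord0 i))).
  exact: measurable_coor.
by apply/funext => v /=; rewrite mxE.
Qed.


Section step.
Variables (n : nat) (m : {sigma_finite_measure set 'rV[R]_n -> \bar R}).

Definition borel_lebesgue_step : set 'rV[R]_n.+1 -> \bar R :=
  pushforward (@lebesgue_measure R \x m)%E (@cons_rV n).

Let step0 : borel_lebesgue_step set0 = 0%E.
Proof. exact: measure0. Qed.

Let step_ge0 A : (0 <= borel_lebesgue_step A)%E.
Proof. exact: measure_ge0. Qed.

Let step_sigma_additive : semi_sigma_additive borel_lebesgue_step.
Proof. exact: measure_semi_sigma_additive. Qed.

HB.instance Definition _ := isMeasure.Build _ _ _ borel_lebesgue_step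
  step0 step_ge0 step_sigma_additive.

Let step_sigma_finite : sigma_finite setT borel_lebesgue_step.
Proof.
have /sigma_finiteP[F [TF ndF Foo]] := sigma_finiteT (@lebesgue_measure R).
have /sigma_finiteP[G [TG ndG Goo]] := sigma_finiteT m.
exists (fun k => @uncons_rV n @^-1` (F k `*` G k)).
  rewrite -preimage_bigcup (_ : \bigcup_k _ = setT) ?preimage_setT //.
  rewrite -subTset => -[x y] _.
  have [i _ Fi] : (\bigcup_k F k) x by rewrite -TF.
  have [j _ Gj] : (\bigcup_k G k) y by rewrite -TG.
  exists (maxn i j) => //; split.
  - by move: x Fi; exact/subsetPset/ndF/leq_maxl.
  - by move: y Gj; exact/subsetPset/ndG/leq_maxr.
move=> k; have [mF Fk] := Foo k; have [mG Gk] := Goo k; split.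
  rewrite -[X in measurable X]setTI; apply: measurable_uncons_rV => //.
  exact: measurableX.
rewrite /borel_lebesgue_step /pushforward -comp_preimage.
rewrite (_ : _ \o _ = id); last by apply/funext => p; exact: cons_rVK.
by rewrite preimage_id product_measure1E// lte_mul_pinfty// ge0_fin_numE.
Qed.

HB.instance Definition _ := Measure_isSigmaFinite.Build _ _ _
  borel_lebesgue_step step_sigma_finite.

End step.

(* Lebesgue measure on the Borel sets of R^n, as the n-fold product of the
   one-dimensional one. *)
Fixpoint borel_lebesgue n : {sigma_finite_measure set 'rV[R]_n -> \bar R} :=
  if n is n'.+1 then borel_lebesgue_step (borel_lebesgue n')
  else \d_(0 : 'rV[R]_0).

End Rn.


Section completion.
Context d (T : measurableType d) {R : realType}.
Variable mu : {measure set T -> \bar R}.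

(* Measurability for the completion of mu; with mu a Borel version of Lebesgue
   measure this is Lebesgue measurability. *)
Definition completed_measurable_fun (D : set T) (g : T -> R) : Prop :=
  @measurable_fun _ _ (caratheodory_type (mu^*)%mu) (measurableTypeR R) D g.

End completion.

Section spaces.
Context {R : realType}.
Variable N : nat.

(* Lebesgue measure on R^N, on the Lebesgue measurable sets. *)
Definition leb := @completed_measure_extension _ _ _ (@borel_lebesgue R N).

HB.instance Definition _ := Measure.on leb.

(* The norm that the library puts on 'rV is the maximum norm; it has the same
   compact sets and uniformly continuous functions as this one. *)
Definition enorm (x : 'rV[R]_N) : R := Num.sqrt (\sum_i x ord0 i ^+ 2).

Definition eball (y : 'rV[R]_N) (rho : R) : set 'rV[R]_N :=
  [set x | enorm (x - y) < rho].

Definition L1loc (w : 'rV[R]_N -> R) : Prop :=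
  completed_measurable_fun (borel_lebesgue N) setT w /\
  forall K : set 'rV[R]_N, compact K ->
    (\int[leb]_(x in K) `|w x|%:E < +oo)%E.

Definition L1ul_norm (w : 'rV[R]_N -> R) : \bar R :=
  ereal_sup [set (\int[leb]_(x in eball y 1) `|w x|%:E)%E | y in setT].

Definition L1ul (w : 'rV[R]_N -> R) : Prop :=
  L1loc w /\ (L1ul_norm w < +oo)%E.

Definition BUC (g : 'rV[R]_N -> R) : Prop :=
  (exists M : R, forall x, `|g x| <= M) /\ unif_continuous g.

Definition calL1ul (w : 'rV[R]_N -> R) : Prop :=
  L1ul w /\
  forall eps : R, 0 < eps ->
    exists2 g, BUC g & (L1ul_norm (fun x => w x - g x)%R < eps%:E)%E.

Definition heat_kernel (x : 'rV[R]_N) (t : R) : R :=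
  (4 * pi * t) `^ (- (N%:R / 2)) * expR (- (enorm x ^+ 2 / (4 * t))).

Definition heat (t : R) (phi : 'rV[R]_N -> R) (x : 'rV[R]_N) : \bar R :=
  (\int[leb]_y (heat_kernel (x - y) t * phi y)%:E)%E.

End spaces.

Arguments leb {R} N.

Section nonlinearity.
Context {R : realType}.
Variable f : R -> R.

Definition tailF (u : R) : \bar R :=
  (\int[lebesgue_measure]_(tau in `]u, +oo[) (f tau)^-1%:E)%E.

(* F(u)^{-r} for r > 0, with (+oo)^{-r} = 0 (the library's poweR has
   (+oo) `^ (- r) = +oo). *)
Definition tailF_pow (r u : R) : R :=
  if tailF u == +oo%E then 0 else fine (tailF u) `^ (- r).

Definition class_S (q : R) : Prop :=
  [/\ {within `[0, +oo[, continuous f},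
      forall u, 0 < u -> derivable f u 1 /\ {for u, continuous f^`()%classic},
      forall u, 0 < u -> [/\ 0 < f u, 0 <= f^`()%classic u & (tailF u < +oo)%E] &
      f^`()%classic xi * fine (tailF xi) @[xi --> +oo] --> q].

End nonlinearity.

Section solution.
Context {R : realType}.
Variables (N : nat) (gamma : R) (f : R -> R) (u0 : 'rV[R]_N -> R).

(* powR gives enorm 0 `^ (- gamma) = 0; the point 0 is a null set. *)
Definition source (u : 'rV[R]_N -> R -> R) (s : R) (y : 'rV[R]_N) : R :=
  enorm y `^ (- gamma) * f (u y s).

(* The equation is required for every t in (0, T), at almost every x. *)
Definition local_solution (T : R) (u : 'rV[R]_N -> R -> R) : Prop :=
  [/\ completed_measurable_fun (borel_lebesgue N \x lebesgue_measure)%E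
        ([set: 'rV[R]_N] `*` `]0, T[) (fun p => u p.1 p.2),
      forall x t, 0 < t < T -> 0 <= u x t,
      exists M : R, {ae @completed_lebesgue_measure R, forall t : R, 0 < t < T ->
        L1ul (u^~ t) /\ (L1ul_norm (u^~ t) <= M%:E)%E},
      forall a b : R, 0 < a -> a <= b -> b < T ->
        exists M : R, {ae @completed_lebesgue_measure R, forall t : R, a <= t <= b ->
          (Lnorm (leb N) +oo (fun x => (u x t)%:E) <= M%:E)%E} &
      forall t, 0 < t < T -> {ae leb N, forall x,
        (u x t)%:E = (heat t u0 x +
          \int[completed_lebesgue_measure]_(s in `]0%R, t[)
            heat (t - s) (source u s) x)%E}].

End solution.

(* Main.v *)
(* Put [Phi u = F(u)^(-r)].  Fix [theta <= 1] and [xi > 0] with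
   [f' F <= 1 + theta r] on [[xi, +oo[], where [theta < 1] when [q < 1 + r].  Then
   [f F^(1 + theta r)] is nonincreasing, which bounds [f B] by
   [f A (1 + (Phi B / Phi A)^(theta + 1 / r))], and [Phi] is convex.  Let [W] be
   the heat flow of [Phi (max xi u0)] and define [ubar] by [Phi ubar = 2 W].  This
   is a supersolution for small [T]: the tangent of [Phi] at [ubar] gives
   [e^(t Delta) u0 <= ubar - W / Phi'(ubar)], so the source term only has to be at
   most [W / Phi'(ubar)].  The identity
   [G(x - y, t - s) G(y - z, s) = G(x - z, t) G(y - m, s (t - s) / t)], for [m] on the
   segment from [z] to [x], gives
   [e^((t - s) Delta) (|.|^(-gamma) W(s)) <= C (s (t - s) / t)^(-gamma / 2) W(t)];
   together with [W(s) <= A s^(-N / 2)] it bounds the source by a multiple of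
   [A^(1 / r) T^(1 - gamma / 2 - N / (2 r))] times the allowed amount.  In cases (i)
   and (ii) the exponent of [T] is positive; in case (iii) it vanishes, but
   approximating [F(u0)^(-r)] by bounded functions makes [A] small.  Monotone
   iteration from [0] below [ubar] yields the solution, and
   [F(u)^(-r) <= Phi ubar = 2 W] gives the uniform bound. *)
From HB Require Import structures.
Require Import Defs.
From mathcomp Require Import all_boot all_order all_algebra.
From mathcomp Require Import all_classical all_reals all_analysis.
From mathcomp Require Import measurable_realfun ess_sup_inf.
From mathcomp Require Import ring lra.

Set Implicit Arguments.
Unset Strict Implicit.
Unset Printing Implicit Defensive.

Import Order.TTheory GRing.Theory Num.Theory.
Import numFieldNormedType.Exports.

Local Open Scope classical_set_scope.
Local Open Scope ring_scope.

(** * Completed Lebesgue measure and changes of variables *)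

(** Three choices shape the estimates. Since [f_growth] involves the ratio of heat flows to the
    power [th + r^-1], the source estimate behaves like [s^(-b)] at [s = 0], with
    [b = N / (2 r) + (gamma / 2) th]. At the critical value of [r] one has
    [N / (2 r) = 1 - gamma / 2], so that [th = 1] would give [b = 1] and a divergent time integral;
    this is why [th < 1] is extracted from [q < 1 + r]. In case (ii) [th = 1] is forced, and the
    strict inequality for [r] makes room instead. The factor 2 in [Phi ubar = 2 W] leaves one copy
    of [W] for the datum and one for the source. The datum is only Lebesgue measurable, so it is
    integrated against the completed measure. Its heat flow is Borel in [(t, x)], hence the
    iteration stays among Borel functions, and completed measures return only when the result is
    compared with the definition of a solution. *)

Section completion_transfer.
Context d (T : measurableType d) {R : realType}.
Variable mu : {measure set T -> \bar R}.
Notation cT := (caratheodory_type (mu^*)%mu).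

Lemma measurable_completed (A : set T) :
  measurable A -> measurable (A : set cT).
Proof. by move=> mA; apply: sub_caratheodory; exact: sub_sigma_algebra. Qed.

Lemma measurable_fun_completedT d' (U : measurableType d') (g : T -> U) :
  measurable_fun setT g -> measurable_fun (setT : set cT) (g : cT -> U).
Proof.
by move=> mg _ Y mY; apply: measurable_completed; exact: mg.
Qed.

(** The identity from the completed sigma-algebra to the original one is measurable, and the
    pushforward of the completed measure along it agrees with [mu] on measurable sets. *)
Lemma ge0_integral_completed (D : set T) (g : T -> \bar R) :
  measurable D -> measurable_fun D g -> (forall x, D x -> (0 <= g x)%E) ->
  (\int[@completed_measure_extension _ _ _ mu]_(x in D) g x
   = \int[mu]_(x in D) g x)%E.
Proof.
move=> mD mg g0.
have mid : measurable_fun (setT : set cT) (id : cT -> T).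
  exact: measurable_fun_completedT.
transitivity (\int[pushforward (@completed_measure_extension _ _ _ mu) (id : cT -> T)]_(x in D) g x)%E.
  rewrite ge0_integral_pushforward//.
  by move=> y /set_mem; exact: g0.
apply: eq_measure_integral => A mA _; rewrite /pushforward/=.
exact: measurable_mu_extE.
Qed.

End completion_transfer.

Section leb_sigma_finite.
Context {R : realType} (N : nat).

Lemma leb_sigma_finiteT : sigma_finite setT (@leb R N).
Proof.
exact: (completed_measure_extension_sigma_finite
  (sigma_finiteT (borel_lebesgue N))).
Qed.

HB.instance Definition _ :=
  Measure_isSigmaFinite.Build _ _ _ (@leb R N) leb_sigma_finiteT.
End leb_sigma_finite.

Section tonelli.
Context d1 d2 (T1 : measurableType d1) (T2 : measurableType d2) {R : realType}.
Variable m2 : {sigma_finite_measure set T2 -> \bar R}.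
Local Open Scope ereal_scope.

Lemma measurable_fun_integral_param (h : T1 -> T2 -> \bar R) :
  measurable_fun setT (fun p => h p.1 p.2) -> (forall x y, 0 <= h x y) ->
  measurable_fun setT (fun x => \int[m2]_y h x y).
Proof.
move=> mh h0.
exact: (@measurable_fun_fubini_tonelli_F _ _ _ _ _ m2 (fun p => h p.1 p.2)).
Qed.

Lemma tonelli (m1 : {sigma_finite_measure set T1 -> \bar R})
    (h : T1 -> T2 -> \bar R) :
  measurable_fun setT (fun p => h p.1 p.2) -> (forall x y, 0 <= h x y) ->
  \int[m1]_x \int[m2]_y h x y = \int[m2]_y \int[m1]_x h x y.
Proof.
move=> mh h0.
by apply: (@fubini_tonelli _ _ _ _ _ m1 m2 (fun p => h p.1 p.2)) => // -[x y]; exact: h0.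
Qed.

End tonelli.

Section borel_lebesgue_theory.
Context {R : realType}.

Lemma ge0_integral_borel_lebesgueS n (g : 'rV[R]_n.+1 -> \bar R) :
  measurable_fun setT g -> (forall x, (0 <= g x)%E) ->
  (\int[borel_lebesgue n.+1]_x g x =
   \int[lebesgue_measure]_a \int[borel_lebesgue n]_v g (cons_rV (a, v)))%E.
Proof.
move=> mg g0.
rewrite /= (ge0_integral_pushforward (@measurable_cons_rV R n))//.
have mh : measurable_fun setT (g \o @cons_rV R n).
  by apply: measurableT_comp => //; exact: (@measurable_cons_rV R n).
by rewrite fubini_tonelli1 => [//|//|x]; exact: g0.
Qed.

Lemma ge0_integral_borel_lebesgue0 (g : 'rV[R]_0 -> \bar R) :
  measurable_fun setT g -> (forall x, (0 <= g x)%E) ->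
  (\int[borel_lebesgue 0]_x g x = g 0%R)%E.
Proof. by move=> mg g0; rewrite /= integral_dirac// diracT mul1e. Qed.

Lemma measurable_fun_coor d (T : measurableType d) n (f : T -> 'rV[R]_n) i :
  measurable_fun setT f -> measurable_fun setT (fun x => f x ord0 i : R).
Proof. by move=> mf; exact: (measurableT_comp (@measurable_coor R n i) mf). Qed.

Lemma measurable_fun_rVD d (T : measurableType d) n (f g : T -> 'rV[R]_n) :
  measurable_fun setT f -> measurable_fun setT g ->
  measurable_fun setT (fun x => f x + g x).
Proof.
move=> mf mg; apply: measurable_fun_coorP => i.
rewrite (_ : (fun _ => _) = (fun x => f x ord0 i + g x ord0 i)); last first.
  by apply/funext => x; rewrite mxE.
by apply: measurable_funD; exact: measurable_fun_coor.
Qed.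

Lemma measurable_fun_rVZ d (T : measurableType d) n (c : T -> R) (f : T -> 'rV[R]_n) :
  measurable_fun setT c -> measurable_fun setT f ->
  measurable_fun setT (fun x => c x *: f x).
Proof.
move=> mc mf; apply: measurable_fun_coorP => i.
rewrite (_ : (fun _ => _) = (fun x => c x * f x ord0 i)); last first.
  by apply/funext => x; rewrite mxE.
by apply: measurable_funM => //; exact: measurable_fun_coor.
Qed.

Lemma measurable_fun_rVB d (T : measurableType d) n (f g : T -> 'rV[R]_n) :
  measurable_fun setT f -> measurable_fun setT g ->
  measurable_fun setT (fun x => f x - g x).
Proof.
move=> mf mg; apply: measurable_fun_rVD => //.
under eq_fun do rewrite -scaleN1r.
exact: measurable_fun_rVZ.
Qed.

Lemma measurable_enorm n : measurable_fun setT (@enorm R n).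
Proof.
rewrite (_ : @enorm R n = Num.sqrt \o (fun x : 'rV[R]_n => \sum_i x ord0 i ^+ 2))//.
apply: (@measurableT_comp _ _ _ _ R R).
  apply: nondecreasing_measurable => // x y.
  exact: ler_wsqrtr.
apply: measurable_sum => i; apply: measurable_funX.
exact: measurable_fun_coor.
Qed.

Lemma measurable_eball n (y : 'rV[R]_n) rho : measurable (eball y rho).
Proof.
rewrite (_ : eball y rho = (fun x => enorm (x - y)) @^-1` `]-oo, rho[).
  rewrite -[X in measurable X]setTI.
  apply: (measurableT_comp (@measurable_enorm n)) => //.
  exact: measurable_fun_rVB.
by apply/seteqP; split => x /=; rewrite in_itv.
Qed.

(** The pushforward of Lebesgue measure under a translation has the right value on half-open
    intervals, which determines it. *)
Lemma ge0_integral_lebesgue_shift (g : R -> \bar R) (a : R) :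
  measurable_fun setT g -> (forall x, (0 <= g x)%E) ->
  (\int[lebesgue_measure]_x g (x + a)%R = \int[lebesgue_measure]_x g x)%E.
Proof.
move=> mg g0.
have ma : measurable_fun setT ((fun x => x + a) : measurableTypeR R -> measurableTypeR R).
  by apply: measurable_funD.
rewrite -[LHS](@ge0_integral_pushforward _ _ _ _ _ _ ma (@lebesgue_measure R) setT)//.
apply: eq_measure_integral => A mA _.
apply/esym/lebesgue_measure_unique => // _ [[x y] /= xy] <-.
rewrite /pushforward (_ : _ @^-1` _ = `]x - a, y - a]%classic); last first.
  by apply/seteqP; split => z /=; rewrite !in_itv/= ltrBlDr lerBrDr.
rewrite !lebesgue_measure_itv/= !lte_fin ltrD2r -!EFinD.
by case: ifPn => // _; congr EFin; ring.
Qed.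

Lemma ge0_integral_borel_lebesgue_shift n (g : 'rV[R]_n -> \bar R) (a : 'rV[R]_n) :
  measurable_fun setT g -> (forall x, (0 <= g x)%E) ->
  (\int[borel_lebesgue n]_x g (x + a)%R = \int[borel_lebesgue n]_x g x)%E.
Proof.
elim: n g a => [|n IH] g a mg g0.
  rewrite !ge0_integral_borel_lebesgue0//.
    by congr g; apply/rowP => -[].
  by apply: measurableT_comp => //; exact: measurable_fun_rVD.
have mcons : measurable_fun setT (g \o @cons_rV R n).
  by apply: measurableT_comp => //; exact: (@measurable_cons_rV R n).
pose a' : 'rV[R]_n := \row_j a ord0 (lift ord0 j).
rewrite !ge0_integral_borel_lebesgueS//; last first.
  by apply: measurableT_comp => //; exact: measurable_fun_rVD.
rewrite -[RHS](ge0_integral_lebesgue_shift (a ord0 ord0)); last 2 first.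
- exact: (measurable_fun_integral_param (borel_lebesgue n) (h := fun a v => g (cons_rV (a, v)))).
- by move=> x; apply: integral_ge0 => v _; exact: g0.
apply: eq_integral => x _.
rewrite -(IH (fun v => g (cons_rV (x + a ord0 ord0, v))) a')//; last first.
  by apply: measurableT_comp mcons _.
apply: eq_integral => v _; congr g.
apply/rowP => i; rewrite !mxE; case: (unliftP ord0 i) => [j|] -> /=.
  by rewrite [RHS]mxE /a' mxE !ord1.
by rewrite !ord1.
Qed.

End borel_lebesgue_theory.

(** * Gaussian integrals *)

Section one_dim.
Context {R : realType}.
Notation mu := (@lebesgue_measure R).

Lemma FTC2_is_derive (f F : R -> R) (a b : R) : a < b ->
  (forall x : R, a <= x <= b -> is_derive x 1 F (f x)) ->
  (forall x : R, a <= x <= b -> {for x, continuous f}) ->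
  (\int[mu]_(x in `[a, b]) (f x)%:E = (F b - F a)%:E)%E.
Proof.
move=> ab dF cf.
have cF x : a <= x <= b -> {for x, continuous F}.
  move=> xab; have dFx := dF _ xab.
  by apply: differentiable_continuous; apply/derivable1_diffP; exact: ex_derive.
rewrite (@continuous_FTC2 _ f F)//.
- apply: continuous_in_subspaceT => x; rewrite inE/= in_itv/=; exact: cf.
- split.
  + move=> x; rewrite in_itv/= => /andP[ax xb].
    by have dFx : is_derive x 1 F (f x) by [apply: dF; rewrite !ltW]; exact: ex_derive.
  + by apply: cvg_at_right_filter; apply: cF; rewrite lexx ltW.
  + by apply: cvg_at_left_filter; apply: cF; rewrite lexx ltW.
- move=> x; rewrite in_itv/= => /andP[ax xb].
  have dFx : is_derive x 1 F (f x) by apply: dF; rewrite !ltW.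
  by rewrite derive1E derive_val.
Qed.

Lemma ge0_integral_lebesgue_opp (g : R -> \bar R) :
  measurable_fun setT g -> (forall x, (0 <= g x)%E) ->
  (\int[mu]_x g (- x)%R = \int[mu]_x g x)%E.
Proof.
move=> mg g0.
have ma : measurable_fun setT (-%R : measurableTypeR R -> measurableTypeR R).
  exact: (measurable_funN (@measurable_id _ _ setT)).
rewrite -[LHS](@ge0_integral_pushforward _ _ _ _ _ _ ma mu setT)//.
by apply: eq_measure_integral => A mA _; exact: lebesgue_measureN.
Qed.

Lemma ge0_integral_lebesgue_reflect (g : R -> \bar R) (a : R) :
  measurable_fun setT g -> (forall x, (0 <= g x)%E) ->
  (\int[mu]_x g (a - x)%R = \int[mu]_x g x)%E.
Proof.
move=> mg g0.
rewrite -[RHS](ge0_integral_lebesgue_shift a)//.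
rewrite -[RHS]ge0_integral_lebesgue_opp//.
  by apply: eq_integral => x _; rewrite addrC.
apply: measurableT_comp => //; exact: measurable_funD.
Qed.

(** The integrand may blow up at [0], so the fundamental theorem of calculus is applied on
    [[t / (n + 1), t]] and the bound passes to the limit by monotone convergence. *)
Lemma integral_powRN (b t : R) : b < 1 -> 0 < t ->
  (\int[mu]_(s in `]0%R, t[) (s `^ (- b))%:E <= (t `^ (1 - b) / (1 - b))%:E)%E.
Proof.
move=> b1 t0.
have b1' : 0 < 1 - b by rewrite subr_gt0.
pose F n := `[t / n.+1%:R, t]%classic : set R.
have mf D : measurable_fun D (fun s : R => (s `^ (- b))%:E).
  apply/measurable_EFinP; apply: measurable_funTS; exact: measurable_powR.
apply: (@le_trans _ _ (\int[mu]_(s in \bigcup_n F n) (s `^ (- b))%:E)%E).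
  apply: ge0_subset_integral => //.
  - by apply: bigcup_measurable => n _; exact: measurable_itv.
  - exact: mf.
  - by move=> x _; rewrite lee_fin powR_ge0.
  move=> x /=; rewrite in_itv/= => /andP[x0 xt].
  have [n nx] : exists n : nat, t / x < n.+1%:R.
    exists (Num.trunc (t / x)); exact: truncnS_gt.
  exists n => //; rewrite /F /= in_itv/= (ltW xt) andbT.
  by rewrite ler_pdivrMr// mulrC -ler_pdivrMr// ltW.
have cv : (\int[mu]_(s in F i) (s `^ (- b))%:E)%E @[i --> \oo] -->
    (\int[mu]_(s in \bigcup_n F n) (s `^ (- b))%:E)%E.
  apply: ge0_nondecreasing_set_cvg_integral.
  - apply/nondecreasing_seqP => n; rewrite subsetEset; apply: subset_itvr.
    by rewrite bnd_simp ler_pM2l// lef_pV2 ?posrE// ler_nat.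
  - by move=> i; exact: measurable_itv.
  - by move=> i; exact: mf.
  - by move=> i x _; rewrite lee_fin powR_ge0.
rewrite -(cvg_lim _ cv)//; apply: lime_le; first exact: cvgP cv.
(* For index [0] the interval is the single point [t], to which [FTC2_is_derive] does not apply. *)
apply: nearW => -[|n].
  by rewrite /F divr1 set_itv1 integral_set1 lee_fin divr_ge0 ?powR_ge0// ltW.
have tn0 : 0 < t / n.+2%:R by rewrite divr_gt0.
have itv_gt0 x : t / n.+2%:R <= x <= t -> 0 < x.
  by move=> /andP[x0 _]; exact: lt_le_trans tn0 x0.
rewrite /F (_ : (\int[mu]_(s in _) _)%E =
    ((1 - b)^-1 * t `^ (1 - b) - (1 - b)^-1 * (t / n.+2%:R) `^ (1 - b))%:E).
  by rewrite lee_fin -mulrBr mulrC ler_pM2r ?invr_gt0// gerBl powR_ge0.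
apply: (@FTC2_is_derive _ (fun s => (1 - b)^-1 * s `^ (1 - b))).
- by rewrite ltr_pdivrMr// ltr_pMr// ltr1n.
- move=> x /itv_gt0 x0.
  have dp := is_derive1_powR (1 - b) x0.
  have dz := is_deriveZ (1 - b)^-1 dp.
  have -> : x `^ (- b) = (1 - b)^-1 *: ((1 - b) * x `^ (1 - b - 1)).
    rewrite /GRing.scale/= mulrA mulVf ?mul1r ?gt_eqF//; congr (_ `^ _); ring.
  exact: dz.
- move=> x /itv_gt0 x0.
  apply: differentiable_continuous; apply/derivable1_diffP.
  by apply: derivable_powR; rewrite in_itv/= andbT.
Qed.

End one_dim.

Section prod_integral.
Context {R : realType}.
Local Open Scope ereal_scope.

Lemma emeasurable_prod d (T : measurableType d) n (g : 'I_n -> T -> \bar R) :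
  (forall i, measurable_fun setT (g i)) ->
  measurable_fun setT (fun x => \big[*%E/1]_(i < n) g i x).
Proof.
elim: n g => [|n IH] g mg.
  rewrite (_ : (fun _ => _) = cst 1); first exact: measurable_cst.
  by apply/funext => x; rewrite big_ord0.
rewrite (_ : (fun _ => _) = fun x => g ord0 x *
    \big[*%E/1]_(i < n) g (lift ord0 i) x); last first.
  by apply/funext => x; rewrite big_ord_recl.
by apply: emeasurable_funM => //; exact: IH.
Qed.

Lemma prode_ge0 n (g : 'I_n -> \bar R) :
  (forall i, 0 <= g i) -> 0 <= \big[*%E/1]_(i < n) g i.
Proof. by move=> g0; elim/big_ind : _ => //; exact: mule_ge0. Qed.

Lemma ge0_integral_borel_lebesgue_prod n (g : 'I_n -> R -> \bar R) :
  (forall i, measurable_fun setT (g i)) -> (forall i x, 0 <= g i x) ->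
  \int[borel_lebesgue n]_x \big[*%E/1]_(i < n) g i (x ord0 i) =
  \big[*%E/1]_(i < n) \int[lebesgue_measure]_y g i y.
Proof.
elim: n g => [|n IH] g mg g0.
  rewrite ge0_integral_borel_lebesgue0//.
  - by rewrite !big_ord0.
  - by apply: emeasurable_prod => -[].
  - by move=> x; rewrite big_ord0.
have mgi i : measurable_fun setT (fun x : 'rV[R]_n => g (lift ord0 i) (x ord0 i)).
  by apply: measurableT_comp => //; exact: (@measurable_coor R n i).
rewrite ge0_integral_borel_lebesgueS//; last 2 first.
- apply: emeasurable_prod => i.
  by apply: measurableT_comp => //; exact: (@measurable_coor R n.+1 i).
- by move=> x; exact: prode_ge0.
rewrite big_ord_recl -IH//.
rewrite -ge0_integralZr//; last 2 first.
- exact: (mg ord0).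
- by apply: integral_ge0 => x _; exact: prode_ge0.
apply: eq_integral => a _.
rewrite -ge0_integralZl//; last 2 first.
- exact: emeasurable_prod.
- by move=> x _; exact: prode_ge0.
apply: eq_integral => v _.
rewrite big_ord_recl; congr (g _ _ * _).
  by rewrite mxE unlift_none.
by apply: eq_bigr => i _; rewrite mxE liftK.
Qed.

Lemma prod_EFin n (g : 'I_n -> R) :
  \big[*%E/1]_(i < n) (g i)%:E = (\prod_(i < n) g i)%R%:E.
Proof. by elim/big_rec2 : _ => // i y x _ ->; rewrite EFinM. Qed.

End prod_integral.

Section heat_kernel_theory.
Context {R : realType}.

Lemma enorm_ge0 n (x : 'rV[R]_n) : 0 <= enorm x.
Proof. exact: sqrtr_ge0. Qed.

Lemma sqr_enorm n (x : 'rV[R]_n) : enorm x ^+ 2 = \sum_i x ord0 i ^+ 2.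
Proof. by rewrite sqr_sqrtr// sumr_ge0// => i _; rewrite sqr_ge0. Qed.

Lemma enormN n (x : 'rV[R]_n) : enorm (- x) = enorm x.
Proof. by congr Num.sqrt; apply: eq_bigr => i _; rewrite mxE sqrrN. Qed.

Lemma heat_kernelN n (x : 'rV[R]_n) t : heat_kernel (- x) t = heat_kernel x t.
Proof. by rewrite /heat_kernel enormN. Qed.

Lemma heat_kernel_sym n (x y : 'rV[R]_n) t :
  heat_kernel (x - y) t = heat_kernel (y - x) t.
Proof. by rewrite -heat_kernelN opprB. Qed.

(** The one-dimensional heat kernel. [heat_kernel] is a product of these over the coordinates, which
    brings the Gaussian computations down to one variable. *)
Definition gauss1 (t y : R) := (Num.sqrt (4 * pi * t))^-1 * expR (- (y ^+ 2 / (4 * t))).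

Lemma gauss1_ge0 t y : 0 <= gauss1 t y.
Proof. by rewrite mulr_ge0 ?expR_ge0// invr_ge0 sqrtr_ge0. Qed.

Lemma measurable_gauss1 t : measurable_fun setT (gauss1 t).
Proof.
apply: measurable_funM => //; apply: measurableT_comp => //.
apply: measurable_funN; apply: measurable_funM => //; exact: measurable_funX.
Qed.

Lemma fourpi_gt0 (t : R) : 0 < t -> 0 < 4 * pi * t.
Proof. by move=> t0; rewrite !mulr_gt0// pi_gt0. Qed.

Lemma heat_kernel_ge0 n (x : 'rV[R]_n) t : 0 <= heat_kernel x t.
Proof. by rewrite mulr_ge0 ?powR_ge0 ?expR_ge0. Qed.

Lemma heat_kernel_prod n (x : 'rV[R]_n) t : 0 < t ->
  heat_kernel x t = \prod_(i < n) gauss1 t (x ord0 i).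
Proof.
move=> t0; rewrite big_split/= -expR_sum prodr_const cardT size_enum_ord.
rewrite /heat_kernel; congr (_ * expR _).
  rewrite powRN (mulrC n%:R) powRrM powR12_sqrt; last exact/ltW/fourpi_gt0.
  by rewrite powR_mulrn ?sqrtr_ge0// exprVn.
by rewrite sqr_enorm mulr_suml sumrN.
Qed.

(** This is the normal density with mean [m] and variance [2 t]. *)
Lemma integral_gauss1 t m : 0 < t ->
  (\int[lebesgue_measure]_y (gauss1 t (y - m))%:E = 1)%E.
Proof.
move=> t0; rewrite -(@integral_normal_pdf R m (Num.sqrt (2 * t))).
have s0 : Num.sqrt (2 * t) != 0 by rewrite gt_eqF// sqrtr_gt0 mulr_gt0.
apply: eq_integral => y _; rewrite normal_pdfE//.
rewrite /normal_peak /normal_fun /gauss1 sqr_sqrtr; last by rewrite ltW// mulr_gt0.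
congr (_ * expR _)%:E.
  by congr (Num.sqrt _)^-1; rewrite -mulr_natl; ring.
by rewrite mulNr; congr (- (_ / _)); rewrite -mulr_natl; ring.
Qed.

Lemma measurable_heat_kernel n t : measurable_fun setT (fun x : 'rV[R]_n => heat_kernel x t).
Proof.
apply: measurable_funM => //; apply: measurableT_comp => //.
apply: measurable_funN; apply: measurable_funM => //; apply: measurable_funX.
exact: measurable_enorm.
Qed.

Lemma integral_heat_kernel n (m : 'rV[R]_n) t : 0 < t ->
  (\int[borel_lebesgue n]_y (heat_kernel (y - m) t)%:E = 1)%E.
Proof.
move=> t0.
under eq_integral do rewrite heat_kernel_prod// -prod_EFin.
under eq_integral do under eq_bigr do rewrite mxE mxE.
rewrite (@ge0_integral_borel_lebesgue_prod _ _ (fun i y => (gauss1 t (y - m ord0 i))%:E)).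
- by rewrite big1// => i _; exact: integral_gauss1.
- move=> i; apply/measurable_EFinP; apply: measurableT_comp; first exact: measurable_gauss1.
  exact: measurable_funB.
- by move=> i x; rewrite lee_fin gauss1_ge0.
Qed.

End heat_kernel_theory.

(** * The singular weight integrated against a Gaussian *)

Section singular_weight.
Context {R : realType}.

(** For [b != 0], [powR] would give the value [0] at [y = 0], and a product of such factors over the
    coordinates would vanish on the coordinate hyperplanes instead of dominating the weight
    there. *)
Definition inv_abs_pow (b y : R) : \bar R :=
  if y == 0 then +oo%E else (`|y| `^ (- b))%:E.

Lemma inv_abs_pow_ge0 b y : (0 <= inv_abs_pow b y)%E.
Proof. by rewrite /inv_abs_pow; case: ifP => // _; rewrite lee_fin powR_ge0. Qed.

Lemma measurable_inv_abs_pow b : measurable_fun setT (inv_abs_pow b).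
Proof.
apply: measurable_fun_ifT => //.
- by apply: measurable_fun_eqr => //; exact: measurable_cst.
- apply/measurable_EFinP.
  apply: (@measurableT_comp _ _ _ _ R R (@powR R ^~ (- b)) setT (fun x : R => `|x|)).
    exact: measurable_powR.
  exact: normr_measurable.
Qed.

Lemma gauss1_gt0 (t y : R) : 0 < t -> 0 < gauss1 t y.
Proof. by move=> t0; rewrite mulr_gt0 ?expR_gt0// invr_gt0 sqrtr_gt0 fourpi_gt0. Qed.

Lemma gauss1_le (t y : R) : 0 < t -> gauss1 t y <= (Num.sqrt t)^-1.
Proof.
move=> t0; rewrite -[leRHS]mulr1 ler_pM ?expR_ge0 ?invr_ge0 ?sqrtr_ge0//.
  rewrite lef_pV2 ?posrE ?sqrtr_gt0 ?fourpi_gt0//; apply: ler_wsqrtr.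
  rewrite ler_peMl ?(ltW t0)//; have := @pi_ge2 R; lra.
by rewrite expR_le1 oppr_le0 divr_ge0 ?sqr_ge0// mulr_ge0 ?(ltW t0).
Qed.

Lemma powRN_antitone (b x y : R) : 0 <= b -> 0 < x -> x <= y -> y `^ (- b) <= x `^ (- b).
Proof.
move=> b0 x0 xy; have y0 := lt_le_trans x0 xy.
rewrite !powRN lef_pV2 ?posrE ?powR_gt0//.
by apply: ge0_ler_powR; rewrite ?nnegrE// ltW.
Qed.

(** Split at [|y| = sqrt t]. Inside, the Gaussian is at most [t^(-1/2)] and the weight integrates to
    at most [2 t^((1 - b) / 2) / (1 - b)]; outside, the weight is at most [t^(-b / 2)] and the
    Gaussian has mass 1. The majorant [h] is the sum of the two bounds, and the result is uniform in
    the centre [m]. *)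
Lemma integral_gauss1_inv_abs_pow (b t m : R) : 0 <= b -> b < 1 -> 0 < t ->
  (\int[lebesgue_measure]_y ((gauss1 t (y - m))%:E * inv_abs_pow b y)
   <= ((2 / (1 - b) + 1) * t `^ (- (b / 2)))%:E)%E.
Proof.
move=> b0 b1 t0.
have st0 : 0 < Num.sqrt t by rewrite sqrtr_gt0.
have mg : measurable_fun setT (fun y : R => gauss1 t (y - m)).
  by apply: (measurableT_comp (measurable_gauss1 _)); exact: measurable_funB.
pose k (y : R) : R := y `^ (- b) * \1_`]0, Num.sqrt t[ y.
have k0 y : 0 <= k y by rewrite mulr_ge0 ?powR_ge0.
have mk : measurable_fun setT k.
  by apply: measurable_funM => //; exact: measurable_powR.
have mkN : measurable_fun setT (fun y : R => k (- y)).
  by apply: (measurableT_comp mk); exact: oppr_measurable.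
have stb : t `^ (- (b / 2)) = Num.sqrt t `^ (- b).
  by rewrite -powR12_sqrt ?(ltW t0)// -powRrM; congr (_ `^ _); ring.
pose h y := (Num.sqrt t)^-1 * (k y + k (- y)) + t `^ (- (b / 2)) * gauss1 t (y - m).
have mh : measurable_fun setT h.
  apply: measurable_funD; first by apply: measurable_funM => //; exact: measurable_funD.
  exact: measurable_funM.
have h0 y : 0 <= h y.
  by rewrite addr_ge0// mulr_ge0 ?powR_ge0 ?gauss1_ge0 ?invr_ge0 ?sqrtr_ge0 ?addr_ge0.
have ki : (\int[lebesgue_measure]_y (k y)%:E <= (Num.sqrt t `^ (1 - b) / (1 - b))%:E)%E.
  apply: le_trans (integral_powRN b1 st0).
  rewrite [leRHS]integral_mkcond le_eqVlt; apply/orP; left; apply/eqP.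
  apply: eq_integral => y _.
  by rewrite /k patchE indicE; case: ifPn => _; rewrite ?mulr1 ?mulr0.
(* The point where the weight is [+oo] is removed, because the majorant [h] is finite. *)
have -> : (\int[lebesgue_measure]_y ((gauss1 t (y - m))%:E * inv_abs_pow b y) =
    \int[lebesgue_measure]_(y in setT `\ (0%R : R)) ((gauss1 t (y - m))%:E * inv_abs_pow b y))%E.
  rewrite integral_setD1//.
  - exact: measurableD.
  - apply: measurable_funTS; apply: emeasurable_funM; first exact/measurable_EFinP.
    exact: measurable_inv_abs_pow.
apply: (@le_trans _ _ (\int[lebesgue_measure]_(y in setT `\ (0%R : R)) (h y)%:E)%E).
  apply: ge0_le_integral => //.
  - exact: measurableD.
  - by move=> y _; rewrite mule_ge0 ?inv_abs_pow_ge0// lee_fin gauss1_ge0.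
  - apply: measurable_funTS; apply: emeasurable_funM; first exact/measurable_EFinP.
    exact: measurable_inv_abs_pow.
  - by apply: measurable_funTS; exact/measurable_EFinP.
  move=> y [_ /= /eqP y0]; rewrite /inv_abs_pow (negbTE y0) -EFinM lee_fin.
  have ay0 : 0 < `|y| by rewrite normr_gt0.
  have [yt|ty] := ltP `|y| (Num.sqrt t); last first.
    rewrite ler_wpDl ?mulr_ge0 ?invr_ge0 ?sqrtr_ge0 ?addr_ge0//.
    by rewrite mulrC ler_wpM2r ?gauss1_ge0// stb powRN_antitone.
  rewrite ler_wpDr ?mulr_ge0 ?powR_ge0 ?gauss1_ge0//.
  rewrite ler_pM ?gauss1_ge0 ?powR_ge0 ?gauss1_le//.
  have [y_gt0|y_le0] := ltP 0 y.
    rewrite ler_wpDr// /k indicE mem_set ?mulr1 ?gtr0_norm//=.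
    by rewrite in_itv/= y_gt0/= -(gtr0_norm y_gt0).
  rewrite ler_wpDl// /k indicE mem_set ?mulr1 ?ler0_norm//=.
  by rewrite in_itv/= -(ler0_norm y_le0) ay0.
apply: (@le_trans _ _ (\int[lebesgue_measure]_y (h y)%:E)%E).
  apply: ge0_subset_integral => //.
  - exact: measurableD.
  - exact/measurable_EFinP.
  - by move=> y _; rewrite lee_fin.
rewrite /h; under eq_integral do rewrite EFinD 2!EFinM EFinD.
rewrite ge0_integralD//; last 4 first.
- by move=> y _; rewrite -EFinD -EFinM lee_fin mulr_ge0 ?invr_ge0 ?sqrtr_ge0 ?addr_ge0.
- apply: emeasurable_funM => //; apply: emeasurable_funD; exact/measurable_EFinP.
- by move=> y _; rewrite -EFinM lee_fin mulr_ge0 ?powR_ge0 ?gauss1_ge0.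
- by apply: emeasurable_funM => //; exact/measurable_EFinP.
rewrite ge0_integralZl_EFin//; last 2 first.
- by move=> y _; rewrite -EFinD lee_fin addr_ge0.
- apply: emeasurable_funD; exact/measurable_EFinP.
rewrite ge0_integralZl_EFin ?powR_ge0//; last 2 first.
- by move=> y _; rewrite lee_fin gauss1_ge0.
- exact/measurable_EFinP.
rewrite integral_gauss1// mule1 ge0_integralD//; last 4 first.
- by move=> y _; rewrite lee_fin.
- exact/measurable_EFinP.
- by move=> y _; rewrite lee_fin.
- exact/measurable_EFinP.
rewrite (@ge0_integral_lebesgue_opp _ (EFin \o k))//; last exact/measurable_EFinP.
rewrite mulrDl mul1r EFinD leeD2r//.
apply: (@le_trans _ _ (((Num.sqrt t)^-1)%:E *
  ((Num.sqrt t `^ (1 - b) / (1 - b))%:E + (Num.sqrt t `^ (1 - b) / (1 - b))%:E))%E).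
  by rewrite lee_wpmul2l ?lee_fin ?invr_ge0 ?sqrtr_ge0// leeD.
rewrite -EFinD -EFinM lee_fin stb powRB; last by rewrite gt_eqF// implybT.
rewrite powRr1 ?(ltW st0)// -powRN.
rewrite le_eqVlt; apply/orP; left; apply/eqP.
have : Num.sqrt t != 0 by rewrite gt_eqF.
have : 1 - b != 0 by rewrite gt_eqF// subr_gt0.
by move=> ? ?; field; apply/andP.
Qed.

Lemma lee_prod n (a : 'I_n -> R) (b : 'I_n -> \bar R) :
  (forall i, 0 <= a i) -> (forall i, ((a i)%:E <= b i)%E) ->
  ((\prod_(i < n) a i)%:E <= \big[*%E/1]_(i < n) b i)%E.
Proof.
move=> a0 ab; rewrite -prod_EFin.
suff : (0 <= \big[*%E/1]_(i < n) (a i)%:E <= \big[*%E/1]_(i < n) b i)%E by case/andP.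
apply: (big_ind2 (fun x y => 0 <= x <= y)%E); first by rewrite lee01 lexx.
- move=> x1 x2 y1 y2 /andP[x10 x12] /andP[y10 y12].
  by rewrite mule_ge0//= lee_pmul.
- by move=> i _; rewrite lee_fin a0 ab.
Qed.

Lemma coor_le_enorm n (x : 'rV[R]_n) i : `|x ord0 i| <= enorm x.
Proof.
rewrite -sqrtr_sqr; apply: ler_wsqrtr.
by rewrite (bigD1 i)//= ler_wpDr// sumr_ge0// => j _; rewrite sqr_ge0.
Qed.

Lemma measurable_heat_kernel_weight n g t (m : 'rV[R]_n) :
  measurable_fun setT (fun y : 'rV[R]_n => heat_kernel (y - m) t * enorm y `^ (- g)).
Proof.
apply: measurable_funM.
  apply: (measurableT_comp (measurable_heat_kernel t)).
  exact: measurable_fun_rVB.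
apply: (measurableT_comp (measurable_powR _)); exact: measurable_enorm.
Qed.

(* [|y|^(-g) <= \prod_i |y_i|^(-g/n)] reduces the bound to one dimension; the
   value [+oo] of [inv_abs_pow] at [0] makes this hold everywhere. *)
Lemma integral_heat_kernel_weight n (g t : R) (m : 'rV[R]_n) :
  (0 < n)%N -> 0 <= g -> g < n%:R -> 0 < t ->
  (\int[borel_lebesgue n]_y (heat_kernel (y - m) t * enorm y `^ (- g))%:E
   <= ((2 / (1 - g / n%:R) + 1) ^+ n * t `^ (- (g / 2)))%:E)%E.
Proof.
move=> n0 g0 gn t0.
have n0' : 0 < n%:R :> R by rewrite ltr0n.
set b := g / n%:R.
have b0 : 0 <= b by rewrite divr_ge0// ltW.
have b1 : b < 1 by rewrite ltr_pdivrMr// mul1r.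
apply: (@le_trans _ _ (\int[borel_lebesgue n]_y \big[*%E/1]_(i < n)
    ((gauss1 t (y ord0 i - m ord0 i))%:E * inv_abs_pow b (y ord0 i)))%E).
  apply: ge0_le_integral => //.
  - by move=> y _; rewrite lee_fin mulr_ge0 ?powR_ge0 ?heat_kernel_ge0.
  - by apply/measurable_EFinP; exact: measurable_heat_kernel_weight.
  - apply: emeasurable_prod => i; apply: emeasurable_funM.
      apply/measurable_EFinP; apply: (measurableT_comp (measurable_gauss1 _)).
      by apply: measurable_funB => //; exact: (@measurable_coor R n i).
    apply: (measurableT_comp (measurable_inv_abs_pow _)).
    exact: (@measurable_coor R n i).
  move=> y _.
  have -> : heat_kernel (y - m) t * enorm y `^ (- g) =
      \prod_(i < n) (gauss1 t (y ord0 i - m ord0 i) * enorm y `^ (- b)).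
    rewrite big_split/= prodr_const cardT size_enum_ord heat_kernel_prod//.
    congr (_ * _); first by apply: eq_bigr => i _; rewrite !mxE.
    rewrite -powR_mulrn ?powR_ge0// -powRrM; congr (_ `^ _).
    by rewrite /b mulNr divfK// gt_eqF.
  apply: lee_prod => i; first by rewrite mulr_ge0 ?gauss1_ge0 ?powR_ge0.
  rewrite /inv_abs_pow; case: ifPn => [_|yi0].
    by rewrite gt0_muley ?leey// lte_fin gauss1_gt0.
  rewrite -EFinM lee_fin ler_wpM2l ?gauss1_ge0//.
  by rewrite powRN_antitone ?normr_gt0 ?coor_le_enorm.
rewrite (@ge0_integral_borel_lebesgue_prod _ _ (fun i y =>
  (gauss1 t (y - m ord0 i))%:E * inv_abs_pow b y)%E); last 2 first.
- move=> i; apply: emeasurable_funM; last exact: measurable_inv_abs_pow.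
  apply/measurable_EFinP; apply: (measurableT_comp (measurable_gauss1 _)).
  exact: measurable_funB.
- by move=> i x; rewrite mule_ge0 ?inv_abs_pow_ge0// lee_fin gauss1_ge0.
have -> : (2 / (1 - b) + 1) ^+ n * t `^ (- (g / 2)) =
    \prod_(i < n) ((2 / (1 - b) + 1) * t `^ (- (b / 2))).
  rewrite prodr_const cardT size_enum_ord exprMn; congr (_ * _).
  rewrite -powR_mulrn ?powR_ge0// -powRrM; congr (_ `^ _).
  by rewrite /b; field; rewrite gt_eqF.
rewrite -prod_EFin.
suff H i : (0 <= \int[lebesgue_measure]_y ((gauss1 t (y - m ord0 i))%:E * inv_abs_pow b y)
    <= ((2 / (1 - b) + 1) * t `^ (- (b / 2)))%:E)%E.
  apply: (@proj2 (0 <= \big[*%E/1]_(i < n) (\int[lebesgue_measure]_y ((gauss1 t (y - m ord0 i))%:E * inv_abs_pow b y)))%E).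
  apply/andP; apply: (big_ind2 (fun x y => 0 <= x <= y)%E); first by rewrite lee01 lexx.
  + move=> x1 x2 y1 y2 /andP[x10 x12] /andP[y10 y12].
    by rewrite mule_ge0//= lee_pmul.
  + by move=> j _; exact: H.
apply/andP; split; last exact: integral_gauss1_inv_abs_pow.
apply: integral_ge0 => y _.
by rewrite mule_ge0 ?inv_abs_pow_ge0// lee_fin gauss1_ge0.
Qed.

End singular_weight.

(** * The heat kernel *)

Section heat_kernel_identities.
Context {R : realType}.

(** The Brownian bridge: given the positions [z] at time [0] and [x] at time [t], the position at
    time [s] is Gaussian around [z + s / t * (x - z)]. Algebraically, this completes the square in
    [y]. *)
Lemma gauss1_bridge (s t x y z : R) : 0 < s -> s < t ->
  gauss1 (t - s) (x - y) * gauss1 s (y - z) =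
  gauss1 t (x - z) * gauss1 (s * (t - s) / t) (y - (z + s / t * (x - z))).
Proof.
move=> s0 st; have t0 := lt_trans s0 st; have ts0 : 0 < t - s by rewrite subr_gt0.
have sg0 : 0 < s * (t - s) / t by rewrite divr_gt0// mulr_gt0.
rewrite /gauss1 [LHS]mulrACA [RHS]mulrACA -!invfM -!expRD -!sqrtrM ?ltW ?fourpi_gt0//.
have tn : t != 0 by rewrite gt_eqF.
have sn : s != 0 by rewrite gt_eqF.
have tsn : t - s != 0 by rewrite gt_eqF.
congr (_^-1 * expR _); first by congr Num.sqrt; field.
by field; rewrite sn tsn tn.
Qed.

Lemma heat_kernel_bridge n (s t : R) (x y z : 'rV[R]_n) : 0 < s -> s < t ->
  heat_kernel (x - y) (t - s) * heat_kernel (y - z) s =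
  heat_kernel (x - z) t *
  heat_kernel (y - (z + (s / t) *: (x - z))) (s * (t - s) / t).
Proof.
move=> s0 st; have t0 := lt_trans s0 st; have ts0 : 0 < t - s by rewrite subr_gt0.
rewrite !heat_kernel_prod//; last by rewrite divr_gt0// mulr_gt0.
rewrite -!big_split/=; apply: eq_bigr => i _; rewrite !mxE.
exact: gauss1_bridge.
Qed.

Lemma measurable_invr : measurable_fun setT (fun x : R => x^-1).
Proof.
rewrite (_ : (fun _ => _) = (fun x : R => if 0 < x then x `^ (-1) else
    - ((- x) `^ (-1)))); last first.
  apply/funext => x; case: ltP => x0; first by rewrite powR_inv1// ltW.
  by rewrite powR_inv1 ?oppr_ge0// invrN opprK.
apply: measurable_fun_ifT.
- exact: measurable_fun_ltr.
- exact: measurable_powR.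
- apply: measurable_funN.
  by apply: (@measurableT_comp _ _ _ _ R R (@powR R ^~ (-1)) setT (fun x : R => - x));
    [exact: measurable_powR|exact: oppr_measurable].
Qed.

Lemma measurable_fun_heat_kernel d (T : measurableType d) n (f : T -> 'rV[R]_n)
    (g : T -> R) :
  measurable_fun setT f -> measurable_fun setT g ->
  measurable_fun setT (fun x => heat_kernel (f x) (g x)).
Proof.
move=> mf mg; apply: measurable_funM.
  apply: (@measurableT_comp _ _ _ _ R R (@powR R ^~ (- (n%:R / 2))) setT).
    exact: measurable_powR.
  exact: measurable_funM.
apply: (@measurableT_comp _ _ _ _ R R expR setT); first exact: measurable_expR.
apply: measurable_funN; apply: measurable_funM.
  by apply: measurable_funX; exact: (measurableT_comp (@measurable_enorm R n)).
apply: (@measurableT_comp _ _ _ _ R R (@GRing.inv R) setT).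
  exact: measurable_invr.
exact: measurable_funM.
Qed.

Lemma measurable_fun_enorm_powR d (T : measurableType d) n (f : T -> 'rV[R]_n) (a : R) :
  measurable_fun setT f -> measurable_fun setT (fun x => enorm (f x) `^ a).
Proof.
move=> mf.
apply: (@measurableT_comp _ _ _ _ R R (@powR R ^~ a) setT).
  exact: measurable_powR.
exact: (measurableT_comp (@measurable_enorm R n)).
Qed.

(** The indicator of the open unit ball, as a function of one vector: [chi (x - y)] is then jointly
    measurable in centre and point, as Tonelli requires. *)
Definition chi n (v : 'rV[R]_n) : R := \1_`]-oo, 1[ (enorm v).

Lemma chi_ge0 n (v : 'rV[R]_n) : 0 <= chi v.
Proof. by rewrite /chi indicE. Qed.

Lemma chiE n (v : 'rV[R]_n) : chi v = (enorm v < 1 : bool)%R%:R.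
Proof. by rewrite /chi indicE mem_setE in_itv. Qed.

Lemma chi_eball n (y x : 'rV[R]_n) : chi (x - y) = \1_(eball y 1) x.
Proof.
rewrite chiE indicE; congr (nat_of_bool _)%:R.
apply/idP/idP => [h|/set_mem//]; exact: mem_set.
Qed.

Lemma measurable_fun_chi d (T : measurableType d) n (f : T -> 'rV[R]_n) :
  measurable_fun setT f -> measurable_fun setT (fun x => chi (f x)).
Proof.
move=> mf; apply: (@measurableT_comp _ _ _ _ R R (\1_`]-oo, (1:R)[) setT).
  exact: measurable_indic.
exact: (measurableT_comp (@measurable_enorm R n)).
Qed.

End heat_kernel_identities.

(** * Volume of the unit ball, and the heat kernel dominated by ball integrals *)

Section chi_volume.
Context {R : realType}.
Local Open Scope ereal_scope.

Lemma integral_box n (a : R) : (0 < a)%R ->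
  \int[borel_lebesgue n]_x \big[*%E/1]_(i < n) (\1_`[(- a)%R, a] (x ord0 i : R))%:E
  = ((2 * a) ^+ n)%:E.
Proof.
move=> a0.
rewrite (@ge0_integral_borel_lebesgue_prod R n (fun _ y => (\1_`[(- a)%R, a] y)%:E)).
- under eq_bigr do rewrite integral_indic// setIT.
  rewrite (eq_bigr (fun=> (2 * a)%:E)); last first.
    move=> i _; rewrite [LHS]lebesgue_measure_itv/= lte_fin gtrN// -EFinB.
    by congr EFin; ring.
  rewrite prod_EFin prodr_const cardT size_enum_ord; by [].
- by move=> i; apply/measurable_EFinP; exact: measurable_indic.
- by move=> i x; rewrite lee_fin.
Qed.

(** The cube of half-side [1 / (2 n)] lies in the unit ball. The bound is crude but enters constants
    only. *)
Lemma integral_chi n : (0 < n)%N ->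
  ((2 / (2 * n%:R)) ^+ n)%:E <= \int[borel_lebesgue n]_v (chi v : R)%:E.
Proof.
move=> n0; have n0' : (0 < n%:R :> R)%R by rewrite ltr0n.
have a0 : (0 < (2 * n%:R)^-1 :> R)%R by rewrite invr_gt0 mulr_gt0.
rewrite -(integral_box n a0); apply: ge0_le_integral => //.
- by move=> x _; apply: prode_ge0 => i; rewrite lee_fin.
- apply: emeasurable_prod => i; apply/measurable_EFinP.
  apply: (@measurableT_comp _ _ _ _ R R (\1_`[(- (2 * n%:R)^-1)%R, ((2 * n%:R)^-1)%R] : R -> R) setT).
    exact: measurable_indic.
  exact: (@measurable_coor R n i).
- by apply/measurable_EFinP; exact: measurable_fun_chi.
move=> x _; rewrite prod_EFin lee_fin chiE.
have [/forallP xa|] := boolP [forall i, (- (2 * n%:R)^-1 <= x ord0 i <= (2 * n%:R)^-1)%R].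
  rewrite big1; last by move=> i _; rewrite indicE mem_set//= in_itv/= xa.
  suff -> : (enorm x < 1)%R by [].
  rewrite -(ltr_pXn2r (n:=2))// ?nnegrE ?enorm_ge0// expr1n sqr_enorm.
  (* Since [(2 n)^-1 <= 1], it also bounds the square of each coordinate, and the sum is [1 / 2]. *)
  apply: (@le_lt_trans _ _ (\sum_(i < n) (2 * n%:R)^-1 : R)%R).
    apply: ler_sum => i _; have /andP[h1 h2] := xa i.
    have hn : (1 <= n%:R :> R)%R by rewrite ler1n.
    have h3 : ((2 * n%:R)^-1 <= 1 :> R)%R by rewrite invf_le1 ?mulr_gt0//; lra.
    by have := a0; nra.
  rewrite sumr_const cardT size_enum_ord -[X in (X < _)%R]mulr_natl.
  have -> : (n%:R * (2 * n%:R)^-1 = 2^-1 :> R)%R by field; rewrite gt_eqF.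
  by rewrite invf_lt1// ltr1n.
move=> /forallPn[i xi]; rewrite (bigD1 i)//= indicE memNset ?mul0r ?ler0n//.
by rewrite /= in_itv/=; exact/negP.
Qed.

Lemma integral_chi_shift n (z : 'rV[R]_n) :
  \int[borel_lebesgue n]_w (chi (w - z) : R)%:E = \int[borel_lebesgue n]_v (chi v : R)%:E.
Proof.
rewrite (@ge0_integral_borel_lebesgue_shift R n (fun v => (chi v)%:E) (- z)%R)//.
- by apply/measurable_EFinP; exact: measurable_fun_chi.
- by move=> x; rewrite lee_fin chi_ge0.
Qed.

(** If [|w - z| < 1] then [|w|^2 <= 2 |z|^2 + 2], so [exp (-|z|^2 / (4 t))] is at most
    [e^(1/4) exp (-|w|^2 / 8)] for [t <= 1]; integrate over the unit ball around [z]. The factor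
    [n^n] undoes the volume bound [n^(-n)] of [integral_chi], and [2^(n/2) t^(-n/2)] adjusts the
    normalisation from time [2] to time [t]. This domination replaces a covering of space by unit
    balls. *)
Lemma heat_kernel_le_chi n (z : 'rV[R]_n) (t : R) : (0 < n)%N -> (0 < t <= 1)%R ->
  (heat_kernel z t)%:E <=
  (expR 4^-1 * n%:R ^+ n * 2 `^ (n%:R / 2) * t `^ (- (n%:R / 2)))%:E *
   \int[borel_lebesgue n]_w (chi (w - z) * heat_kernel w 2)%:E.
Proof.
move=> n0 /andP[t0 t1].
have n0' : (0 < n%:R :> R)%R by rewrite ltr0n.
set K := (X in X%:E * _); set c := (n%:R ^+ n)%R : R.
have c0 : (0 < c)%R by rewrite exprn_gt0.
have K0 : (0 <= K)%R by rewrite !mulr_ge0 ?expR_ge0 ?powR_ge0// exprn_ge0// ltW.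
have mchi : measurable_fun setT (fun w : 'rV[R]_n => chi (w - z)).
  by apply: measurable_fun_chi; exact: measurable_fun_rVB.
rewrite -ge0_integralZl//; last 2 first.
- apply/measurable_EFinP; apply: measurable_funM => //; exact: measurable_heat_kernel.
- by move=> w _; rewrite lee_fin mulr_ge0 ?chi_ge0 ?heat_kernel_ge0.
apply: (@le_trans _ _ (\int[borel_lebesgue n]_w ((c * heat_kernel z t)%:E * (chi (w - z))%:E))).
  rewrite ge0_integralZl//; last 3 first.
  - exact/measurable_EFinP.
  - by move=> w _; rewrite lee_fin chi_ge0.
  - by rewrite lee_fin mulr_ge0 ?heat_kernel_ge0// ltW.
  rewrite integral_chi_shift.
  have := integral_chi n0; rewrite (_ : (2 / (2 * n%:R)) ^+ n = c^-1 :> R)%R; last first.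
    by rewrite invfM mulrA divff// mul1r exprVn.
  move=> h; rewrite -[leLHS]mule1.
  apply: (@le_trans _ _ ((c * heat_kernel z t)%:E * (c^-1)%:E)).
    by rewrite mule1 -EFinM mulrAC mulfV ?gt_eqF// mul1r.
  by apply: lee_wpmul2l => //; rewrite lee_fin mulr_ge0 ?heat_kernel_ge0// ltW.
apply: ge0_le_integral => //.
- move=> w _; rewrite -EFinM lee_fin mulr_ge0 ?chi_ge0// mulr_ge0 ?heat_kernel_ge0//.
  exact: ltW.
- apply/measurable_EFinP; exact: measurable_funM.
- apply/measurable_EFinP; apply: measurable_funM => //.
  by apply: measurable_funM => //; exact: measurable_heat_kernel.
move=> w _; rewrite -!EFinM lee_fin chiE.
have [wz|_] := boolP (enorm (w - z) < 1)%R; last by rewrite !(mul0r, mulr0).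
rewrite mulr1 mul1r /K /heat_kernel.
have -> : ((4 * pi * t) `^ (- (n%:R / 2)) = 2 `^ (n%:R / 2) * (4 * pi * 2) `^ (- (n%:R / 2)) * t `^ (- (n%:R / 2)) :> R)%R.
  have pi0 : (0 < pi :> R)%R := pi_gt0 R.
  have q0 : (0 <= 4 * pi :> R)%R by rewrite mulr_ge0// ltW.
  rewrite (@powRM _ _ t) ?(ltW t0)// (@powRM _ _ 2)//; congr (_ * _)%R.
  by rewrite (powRN 2) mulrCA mulfV ?mulr1// gt_eqF// powR_gt0.
have H : (expR (- (enorm z ^+ 2 / (4 * t))) <= expR 4^-1 * expR (- (enorm w ^+ 2 / (4 * 2))))%R.
  rewrite -expRD ler_expR.
  have h1 : (enorm w ^+ 2 <= 2 * enorm z ^+ 2 + 2 * enorm (w - z) ^+ 2)%R.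
    rewrite !sqr_enorm !mulr_sumr -big_split/=; apply: ler_sum => i _; rewrite !mxE.
    by rewrite -subr_ge0 (_ : (_ - _ = (w ord0 i - 2 * z ord0 i) ^+ 2)%R) ?sqr_ge0//; ring.
  have h2 : (enorm (w - z) ^+ 2 < 1)%R by rewrite expr_lt1 ?enorm_ge0.
  have h3 : (enorm z ^+ 2 / 4 <= enorm z ^+ 2 / (4 * t))%R.
    by rewrite ler_wpM2l ?sqr_ge0// lef_pV2 ?posrE ?mulr_gt0// ler_piMr.
  lra.
set A := (2 `^ _)%R; set B := (_ `^ _)%R; set D := (t `^ _)%R.
rewrite (_ : (expR 4^-1 * c * A * D * _ = c * (A * B * D) * (expR 4^-1 * expR (- (enorm w ^+ 2 / (4 * 2)))))%R); last by ring.
rewrite mulrA ler_wpM2l//.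
by rewrite !mulr_ge0 ?powR_ge0// ltW.
Qed.

End chi_volume.

(** * The heat semigroup on uniformly local data *)

Lemma measurable_fun_swap_args d1 d2 d3 (T1 : measurableType d1)
    (T2 : measurableType d2) (T3 : measurableType d3) (h : T1 -> T2 -> T3) :
  measurable_fun setT (fun p : T1 * T2 => h p.1 p.2) ->
  measurable_fun setT (fun p : T2 * T1 => h p.2 p.1).
Proof.
move=> mh.
have ms : measurable_fun setT (fun p : T2 * T1 => (p.2, p.1)).
  by apply: measurable_fun_pair; [exact: measurable_snd|exact: measurable_fst].
exact: (measurableT_comp mh ms).
Qed.

Section heat_estimates.
Context {R : realType} (n : nat).
Variable phi : 'rV[R]_n -> R.
Hypothesis mphi : completed_measurable_fun (borel_lebesgue n) setT phi.
Hypothesis phi0 : forall x, 0 <= phi x.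
Notation Y := (caratheodory_type ((borel_lebesgue n : set 'rV[R]_n -> \bar R)^*)%mu).
Local Open Scope ereal_scope.

Lemma measurable_completed_phi d (T : measurableType d) :
  measurable_fun setT (fun p : T * Y => phi p.2).
Proof. exact: (measurableT_comp mphi measurable_snd). Qed.

Lemma measurable_completed_pos d (T : measurableType d) :
  measurable_fun setT (fun p : T * Y => (p.2 : 'rV[R]_n)).
Proof.
have mid : measurable_fun (setT : set Y) (id : Y -> 'rV[R]_n).
  exact: measurable_fun_completedT.
exact: (measurableT_comp mid measurable_snd).
Qed.

Lemma measurable_heat_integrand d (T : measurableType d)
    (f : T -> 'rV[R]_n) (g : T -> R) :
  measurable_fun setT f -> measurable_fun setT g ->
  measurable_fun setT (fun p : T * Y =>
    (heat_kernel (f p.1 - (p.2 : 'rV[R]_n)) (g p.1) * phi p.2)%:E).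
Proof.
move=> mf mg; apply/measurable_EFinP; apply: measurable_funM.
  apply: measurable_fun_heat_kernel.
    apply: measurable_fun_rVB; last exact: measurable_completed_pos.
    exact: (measurableT_comp mf measurable_fst).
  exact: (measurableT_comp mg measurable_fst).
exact: measurable_completed_phi.
Qed.

Lemma ge0_leb_integralZl (c : \bar R) (g : 'rV[R]_n -> \bar R) :
  measurable_fun (setT : set Y) g -> (forall y, 0 <= g y) -> 0 <= c ->
  \int[leb n]_y (c * g y) = c * \int[leb n]_y g y.
Proof. by move=> mg g0 c0; rewrite ge0_integralZl. Qed.

Lemma measurable_heat_integrand1 (t : R) (x : 'rV[R]_n) :
  measurable_fun (setT : set Y)
    (fun y : Y => (heat_kernel (x - (y : 'rV[R]_n)) t * phi y)%:E).
Proof.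
apply/measurable_EFinP; apply: measurable_funM; last exact: mphi.
apply: measurable_fun_completedT.
by apply: measurable_fun_heat_kernel => //; exact: measurable_fun_rVB.
Qed.

Lemma ge0_leb_integralZl_phi (c : R) (g : 'rV[R]_n -> R) :
  measurable_fun setT g -> (forall y, (0 <= g y)%R) -> (0 <= c)%R ->
  \int[leb n]_y ((c * g y) * phi y)%:E = c%:E * \int[leb n]_y (g y * phi y)%:E.
Proof.
move=> mg g0 c0; rewrite -ge0_leb_integralZl.
- by apply: eq_integral => y _; rewrite -EFinM mulrA.
- apply/measurable_EFinP; apply: measurable_funM; last exact: mphi.
  exact: measurable_fun_completedT.
- by move=> y; rewrite lee_fin mulr_ge0.
- by [].
Qed.

Lemma measurable_kernel_sub (x : 'rV[R]_n) (t : R) :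
  measurable_fun setT (fun y : 'rV[R]_n => heat_kernel (x - y) t).
Proof. by apply: measurable_fun_heat_kernel => //; exact: measurable_fun_rVB. Qed.

Lemma measurable_chi_sub (x : 'rV[R]_n) :
  measurable_fun setT (fun y : 'rV[R]_n => chi (y - x)).
Proof. by apply: measurable_fun_chi => //; exact: measurable_fun_rVB. Qed.

Lemma heat_ge0 t x : 0 <= heat t phi x.
Proof.
by apply: integral_ge0 => y _; rewrite lee_fin mulr_ge0 ?heat_kernel_ge0.
Qed.

(** Only the integration variable lives in the completed space [Y], so the heat flow of a merely
    Lebesgue measurable function is measurable in its parameters for their own, typically Borel,
    sigma-algebra. *)
Lemma measurable_fun_heat d (T : measurableType d)
    (f : T -> 'rV[R]_n) (g : T -> R) :
  measurable_fun setT f -> measurable_fun setT g ->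
  measurable_fun setT (fun x => heat (g x) phi (f x)).
Proof.
move=> mf mg.
apply: (measurable_fun_integral_param (leb n)
  (h := fun x (y : Y) => (heat_kernel (f x - (y : 'rV[R]_n)) (g x) * phi y)%:E)).
  exact: measurable_heat_integrand.
by move=> x y; rewrite lee_fin mulr_ge0 ?heat_kernel_ge0.
Qed.

Lemma tonelli_leb d (T : measurableType d) (m : {sigma_finite_measure set T -> \bar R})
    (h : T -> 'rV[R]_n -> R) :
  measurable_fun setT (fun p : T * Y => h p.1 p.2) ->
  (forall x y, (0 <= h x y)%R) ->
  \int[m]_x \int[leb n]_y (h x y * phi y)%:E =
  \int[leb n]_y ((\int[m]_x (h x y)%:E) * (phi y)%:E).
Proof.
move=> mh h0.
rewrite (@tonelli _ _ _ _ _ (leb n) m (fun x (y : Y) => (h x y * phi y)%:E)).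
- apply: eq_integral => y _.
  under eq_integral do rewrite EFinM.
  rewrite ge0_integralZr//.
  + apply/measurable_EFinP.
    exact: (measurableT_comp mh (pair2_measurable y)).
  + by move=> x _; rewrite lee_fin.
  + by rewrite lee_fin.
- apply/measurable_EFinP; apply: measurable_funM; first exact: mh.
  exact: measurable_completed_phi.
- by move=> x y; rewrite lee_fin mulr_ge0.
Qed.

Lemma le_integral_leb (g h : 'rV[R]_n -> \bar R) :
  measurable_fun (setT : set Y) g -> measurable_fun (setT : set Y) h ->
  (forall y, 0 <= g y) -> (forall y, g y <= h y) ->
  \int[leb n]_y g y <= \int[leb n]_y h y.
Proof. by move=> mg mh g0 gh; apply: ge0_le_integral. Qed.

(* [heat_kernel_bridge] takes [G(x - z, t)] out of the integral in [y] and leaves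
   the weight against a heat kernel at time [s (t - s) / t]. *)
Lemma heat_weight_le (g s t : R) (x : 'rV[R]_n) :
  (0 < n)%N -> (0 <= g)%R -> (g < n%:R)%R -> (0 < s)%R -> (s < t)%R ->
  \int[borel_lebesgue n]_y
    ((heat_kernel (x - y) (t - s) * enorm y `^ (- g))%:E * heat s phi y)
  <= ((2 / (1 - g / n%:R) + 1) ^+ n * (s * (t - s) / t) `^ (- (g / 2)))%:E
     * heat t phi x.
Proof.
move=> n0 g0 gn s0 st; have t0 := lt_trans s0 st.
have ts0 : (0 < t - s)%R by rewrite subr_gt0.
have sg0 : (0 < s * (t - s) / t)%R by rewrite divr_gt0// mulr_gt0.
set C := (X in X%:E * _).
have C0 : (0 <= C)%R.
  rewrite mulr_ge0 ?powR_ge0// exprn_ge0// addr_ge0// divr_ge0// subr_ge0.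
  by rewrite ler_pdivrMr ?ltr0n// mul1r ltW.
pose h (y z : 'rV[R]_n) : R := (heat_kernel (x - y) (t - s) * enorm y `^ (- g) *
  heat_kernel (y - z) s)%R.
have h0 y z : (0 <= h y z)%R by rewrite !mulr_ge0 ?heat_kernel_ge0 ?powR_ge0.
have mh : measurable_fun setT (fun p : 'rV[R]_n * Y => h p.1 p.2).
  apply: measurable_funM; last first.
    apply: measurable_fun_heat_kernel => //.
    by apply: measurable_fun_rVB => //; exact: measurable_completed_pos.
  apply: measurable_funM; last exact: measurable_fun_enorm_powR.
  by apply: measurable_fun_heat_kernel => //; exact: measurable_fun_rVB.
have -> : \int[borel_lebesgue n]_y
    ((heat_kernel (x - y) (t - s) * enorm y `^ (- g))%:E * heat s phi y) =
    \int[borel_lebesgue n]_y \int[leb n]_z (h y z * phi z)%:E.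
  apply: eq_integral => y _; rewrite /heat /h ge0_leb_integralZl_phi//.
  - exact: measurable_kernel_sub.
  - by move=> z; rewrite heat_kernel_ge0.
  - by rewrite mulr_ge0 ?heat_kernel_ge0 ?powR_ge0.
rewrite (tonelli_leb _ mh h0) /heat -ge0_leb_integralZl; last 3 first.
- exact: measurable_heat_integrand1.
- by move=> z; rewrite lee_fin mulr_ge0 ?heat_kernel_ge0.
- by rewrite lee_fin.
have mI : measurable_fun (setT : set Y) (fun z => \int[borel_lebesgue n]_y (h y z)%:E).
  apply: (measurable_fun_integral_param (borel_lebesgue n)
    (h := fun (z : Y) y => (h y z)%:E)).
    by apply/measurable_EFinP; exact: (measurable_fun_swap_args mh).
  by move=> z y; rewrite lee_fin.
apply: le_integral_leb.
- by apply: emeasurable_funM; [exact: mI|apply/measurable_EFinP; exact: mphi].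
- by apply: emeasurable_funM; [exact: measurable_cst|exact: measurable_heat_integrand1].
- by move=> z; rewrite mule_ge0 ?lee_fin// integral_ge0// => y _; rewrite lee_fin.
move=> z; rewrite (EFinM (heat_kernel _ _)) muleA; apply: lee_wpmul2r; first by rewrite lee_fin.
have -> : \int[borel_lebesgue n]_y (h y z)%:E = (heat_kernel (x - z) t)%:E *
    \int[borel_lebesgue n]_y (heat_kernel (y - (z + (s / t) *: (x - z))) (s * (t - s) / t)
      * enorm y `^ (- g))%:E.
  rewrite -ge0_integralZl//.
  - apply: eq_integral => y _; rewrite -EFinM /h mulrAC heat_kernel_bridge//.
    by move: (heat_kernel _ _) (heat_kernel _ _) (enorm y `^ _)%R => a b e; rewrite mulrA.
  - by apply/measurable_EFinP; exact: measurable_heat_kernel_weight.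
  - by move=> y _; rewrite lee_fin mulr_ge0 ?heat_kernel_ge0 ?powR_ge0.
  - by rewrite lee_fin heat_kernel_ge0.
rewrite muleC; apply: lee_wpmul2r; first by rewrite lee_fin heat_kernel_ge0.
exact: integral_heat_kernel_weight.
Qed.

Lemma integral_chi_le_L1ul (c : 'rV[R]_n) :
  \int[leb n]_z (chi (z - c) * phi z)%:E <= L1ul_norm phi.
Proof.
apply: ereal_sup_ubound; exists c => //.
rewrite integral_mkcond; apply: eq_integral => z _.
rewrite patchE chi_eball indicE; case: ifPn => _; last by rewrite mul0r.
by rewrite mul1r ger0_norm.
Qed.

(** The heat flow does not increase the uniformly local norm. After Tonelli and the substitution
    [x -> x + z], the left side is an average, with weight [heat_kernel x t] of mass 1, of integrals
    of [phi] over the unit balls centred at [y - x]. *)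
Lemma heat_ball_le (t : R) (y : 'rV[R]_n) : (0 < t)%R ->
  \int[borel_lebesgue n]_x ((chi (x - y))%:E * heat t phi x) <= L1ul_norm phi.
Proof.
move=> t0.
have mchi d (T : measurableType d) (f g : T -> 'rV[R]_n) :
    measurable_fun setT f -> measurable_fun setT g ->
    measurable_fun setT (fun p => chi (f p - g p)).
  by move=> mf mg; apply: measurable_fun_chi; exact: measurable_fun_rVB.
pose h (x z : 'rV[R]_n) : R := (chi (x - y) * heat_kernel (x - z) t)%R.
have h0 x z : (0 <= h x z)%R by rewrite mulr_ge0 ?chi_ge0 ?heat_kernel_ge0.
have mh : measurable_fun setT (fun p : 'rV[R]_n * Y => h p.1 p.2).
  apply: measurable_funM; first exact: mchi.
  apply: measurable_fun_heat_kernel => //.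
  by apply: measurable_fun_rVB => //; exact: measurable_completed_pos.
have -> : \int[borel_lebesgue n]_x ((chi (x - y))%:E * heat t phi x) =
    \int[borel_lebesgue n]_x \int[leb n]_z (h x z * phi z)%:E.
  apply: eq_integral => x _; rewrite /heat /h ge0_leb_integralZl_phi//.
  - exact: measurable_kernel_sub.
  - by move=> z; rewrite heat_kernel_ge0.
rewrite (tonelli_leb _ mh h0).
pose k (x z : 'rV[R]_n) : R := (heat_kernel x t * chi (z - (y - x)))%R.
have k0 x z : (0 <= k x z)%R by rewrite mulr_ge0 ?chi_ge0 ?heat_kernel_ge0.
have mk : measurable_fun setT (fun p : 'rV[R]_n * Y => k p.1 p.2).
  apply: measurable_funM; first exact: measurable_fun_heat_kernel.
  apply: mchi; first exact: measurable_completed_pos.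
  exact: measurable_fun_rVB.
have -> : \int[leb n]_z ((\int[borel_lebesgue n]_x (h x z)%:E) * (phi z)%:E) =
    \int[leb n]_z ((\int[borel_lebesgue n]_x (k x z)%:E) * (phi z)%:E).
  apply: eq_integral => z _; congr (_ * _).
  rewrite -(@ge0_integral_borel_lebesgue_shift R n (fun x => (h x z)%:E) z).
  - apply: eq_integral => x _; rewrite /h /k addrK mulrC; congr (_ * chi _)%:E.
    by apply/rowP => i; rewrite !mxE; ring.
  - apply/measurable_EFinP; apply: measurable_funM.
      by apply: mchi => //; exact: measurable_cst.
    by apply: measurable_fun_heat_kernel => //; exact: measurable_fun_rVB.
  - by move=> x; rewrite lee_fin.
rewrite -(tonelli_leb _ mk k0).
rewrite -[leRHS]mule1 -(integral_heat_kernel (0 : 'rV[R]_n)%R t0) -ge0_integralZl//; last 3 first.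
- by apply/measurable_EFinP; apply: measurable_fun_heat_kernel => //; exact: measurable_fun_rVB.
- by move=> x _; rewrite lee_fin heat_kernel_ge0.
- apply: le_trans (integral_chi_le_L1ul 0%R).
  by apply: integral_ge0 => z _; rewrite lee_fin mulr_ge0 ?chi_ge0.
apply: ge0_le_integral => //.
- by move=> x _; apply: integral_ge0 => z _; rewrite lee_fin mulr_ge0.
- apply: (measurable_fun_integral_param (leb n) (h := fun x (z : Y) => (k x z * phi z)%:E)).
    apply/measurable_EFinP; apply: measurable_funM; [exact: mk|exact: measurable_completed_phi].
  by move=> x z; rewrite lee_fin mulr_ge0.
- apply: emeasurable_funM => //; apply/measurable_EFinP.
  by apply: measurable_fun_heat_kernel => //; exact: measurable_fun_rVB.
move=> x _; rewrite subr0 muleC.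
apply: (@le_trans _ _ ((heat_kernel x t)%:E * \int[leb n]_z (chi (z - (y - x)) * phi z)%:E)).
  rewrite -ge0_leb_integralZl_phi ?heat_kernel_ge0//.
  exact: measurable_chi_sub.
by apply: lee_wpmul2l; [rewrite lee_fin heat_kernel_ge0|exact: integral_chi_le_L1ul].
Qed.

(** The smoothing estimate from uniformly local [L^1] to bounded functions. Integrating
    [heat_kernel_le_chi] against [phi] leaves integrals of [phi] over unit balls, averaged by the
    kernel at time [2]. *)
Lemma heat_sup_le (t : R) (x : 'rV[R]_n) : (0 < n)%N -> (0 < t <= 1)%R ->
  heat t phi x <= (expR 4^-1 * n%:R ^+ n * 2 `^ (n%:R / 2) * t `^ (- (n%:R / 2)))%:E
    * L1ul_norm phi.
Proof.
move=> n0 t01.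
set K := (X in X%:E * _).
have K0 : (0 <= K)%R by rewrite !mulr_ge0 ?expR_ge0 ?powR_ge0// exprn_ge0.
pose k (w z : 'rV[R]_n) : R := (chi (w - (x - z)) * heat_kernel w 2)%R.
have k0 w z : (0 <= k w z)%R by rewrite mulr_ge0 ?chi_ge0 ?heat_kernel_ge0.
have mk : measurable_fun setT (fun p : 'rV[R]_n * Y => k p.1 p.2).
  apply: measurable_funM; last exact: measurable_fun_heat_kernel.
  apply: measurable_fun_chi; apply: measurable_fun_rVB => //.
  by apply: measurable_fun_rVB => //; exact: measurable_completed_pos.
have mI : measurable_fun (setT : set Y) (fun z => \int[borel_lebesgue n]_w (k w z)%:E).
  apply: (measurable_fun_integral_param (borel_lebesgue n)
    (h := fun (z : Y) y => (k y z)%:E)).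
    by apply/measurable_EFinP; exact: (measurable_fun_swap_args mk).
  by move=> z y; rewrite lee_fin.
have I0 z : 0 <= \int[borel_lebesgue n]_w (k w z)%:E.
  by apply: integral_ge0 => w _; rewrite lee_fin.
apply: (@le_trans _ _ (\int[leb n]_z (K%:E *
    ((\int[borel_lebesgue n]_w (k w z)%:E) * (phi z)%:E)))).
  apply: le_integral_leb.
  - exact: measurable_heat_integrand1.
  - apply: emeasurable_funM; first exact: measurable_cst.
    by apply: emeasurable_funM; [exact: mI|apply/measurable_EFinP; exact: mphi].
  - by move=> z; rewrite lee_fin mulr_ge0 ?heat_kernel_ge0.
  move=> z; rewrite EFinM muleA lee_wpmul2r ?lee_fin//.
  exact: heat_kernel_le_chi.
rewrite ge0_leb_integralZl; last 3 first.
- by apply: emeasurable_funM; [exact: mI|apply/measurable_EFinP; exact: mphi].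
- by move=> z; rewrite mule_ge0 ?lee_fin.
- by rewrite lee_fin.
apply: lee_wpmul2l => //; rewrite -(tonelli_leb _ mk k0).
have t20 : (0 < 2 :> R)%R by [].
rewrite -[leRHS]mule1 -(integral_heat_kernel (0 : 'rV[R]_n)%R t20) -ge0_integralZl//; last 3 first.
- by apply/measurable_EFinP; apply: measurable_fun_heat_kernel => //; exact: measurable_fun_rVB.
- by move=> w _; rewrite lee_fin heat_kernel_ge0.
- apply: le_trans (integral_chi_le_L1ul 0%R).
  by apply: integral_ge0 => z _; rewrite lee_fin mulr_ge0 ?chi_ge0.
apply: ge0_le_integral => //.
- by move=> w _; apply: integral_ge0 => z _; rewrite lee_fin mulr_ge0.
- apply: (measurable_fun_integral_param (leb n) (h := fun x (z : Y) => (k x z * phi z)%:E)).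
    apply/measurable_EFinP; apply: measurable_funM; [exact: mk|exact: measurable_completed_phi].
  by move=> w z; rewrite lee_fin mulr_ge0.
- apply: emeasurable_funM => //; apply/measurable_EFinP.
  by apply: measurable_fun_heat_kernel => //; exact: measurable_fun_rVB.
move=> w _; rewrite subr0 muleC.
apply: (@le_trans _ _ ((heat_kernel w 2)%:E * \int[leb n]_z (chi (z - (x - w)) * phi z)%:E)).
  rewrite -ge0_leb_integralZl_phi ?heat_kernel_ge0//.
  - rewrite le_eqVlt; apply/orP; left; apply/eqP; apply: eq_integral => z _.
    rewrite /k (mulrC (chi _)); congr (_ * chi _ * _)%:E.
    by apply/rowP => i; rewrite !mxE; ring.
  - exact: measurable_chi_sub.
by apply: lee_wpmul2l; [rewrite lee_fin heat_kernel_ge0|exact: integral_chi_le_L1ul].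
Qed.

End heat_estimates.

(** * The nonlinearity *)

(** A real-valued [F], faithful wherever [tailF] is finite, in particular for [u > 0]. The lock
    keeps the integral from being unfolded. *)
HB.lock Definition Ftail (R : realType) (f : R -> R) (u : R) : R := fine (tailF f u).

(** Agrees with [tailF_pow] for [u > 0], but has no case distinction, so the chain rule applies
    directly. *)
HB.lock Definition Phi (R : realType) (f : R -> R) (r u : R) : R := Ftail f u `^ (- r).

Section nonlinearity.
Context {R : realType} (f : R -> R) (q : R).
Hypothesis hf : class_S f q.
Notation mu := (@lebesgue_measure R).

Local Notation Ftail := (Ftail f).
Local Notation Phi := (Phi f).

Lemma class_S_gt0 (u : R) : 0 < u -> 0 < f u.
Proof. by case: hf => _ _ h _ /h[]. Qed.

Lemma class_S_derivable (u : R) : 0 < u -> derivable f u 1.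
Proof. by case: hf => _ h _ _ /h[]. Qed.

Lemma class_S_derive_ge0 (u : R) : 0 < u -> 0 <= f^`()%classic u.
Proof. by case: hf => _ _ h _ /h[]. Qed.

Lemma class_S_continuous (u : R) : 0 < u -> {for u, continuous f}.
Proof.
by move=> u0; apply: differentiable_continuous; apply/derivable1_diffP; exact: class_S_derivable.
Qed.

Lemma class_S_ndecr (x y : R) : 0 <= x -> x <= y -> f x <= f y.
Proof.
move=> x0 xy; case: hf => cf _ _ _.
apply: (@ger0_derive1_ndecry _ f 0) => // z; rewrite in_itv/= andbT => z0.
  exact: class_S_derivable.
exact: class_S_derive_ge0.
Qed.

(** Positivity is given only for [x > 0]; at [0] the sign comes from right continuity. *)
Lemma class_S_ge0 (x : R) : 0 <= x -> 0 <= f x.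
Proof.
rewrite le_eqVlt => /predU1P[<-|x0]; last exact/ltW/class_S_gt0.
case: hf => /continuous_within_itvcyP[_ cf0] _ _ _.
rewrite leNgt; apply/negP => f0.
have : \forall x \near 0^'+, f x < 0 by exact: (cvgr_lt _ cf0).
move=> /(filterI (nbhs_right_gt 0))/filter_ex[y /= [y0]].
by rewrite ltNge (ltW (class_S_gt0 y0)).
Qed.

Lemma continuous_invf (u : R) : 0 < u -> {for u, continuous (fun x => (f x)^-1)}.
Proof.
move=> u0; apply: cvgV; first by rewrite gt_eqF// class_S_gt0.
exact: class_S_continuous.
Qed.

Lemma measurable_invf (a : R) : 0 <= a -> measurable_fun `]a, +oo[ (fun x => (f x)^-1%:E).
Proof.
move=> a0; apply/measurable_EFinP; apply: open_continuous_measurable_fun.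
  exact: interval_open.
move=> x /set_mem /=; rewrite in_itv/= andbT => ax.
exact/continuous_invf/(le_lt_trans a0).
Qed.

Lemma invf_ge0 (a x : R) : 0 <= a -> `]a, +oo[%classic x -> (0 <= ((f x)^-1)%:E)%E.
Proof.
move=> a0 /=; rewrite in_itv/= andbT => ax.
by rewrite lee_fin invr_ge0 ltW// class_S_gt0// (le_lt_trans a0).
Qed.

Lemma tailF_ge0 (u : R) : 0 <= u -> (0 <= tailF f u)%E.
Proof. by move=> u0; apply: integral_ge0 => x; exact: invf_ge0. Qed.

Lemma le_tailF (u v : R) : 0 <= u -> u <= v -> (tailF f v <= tailF f u)%E.
Proof.
move=> u0 uv; apply: ge0_subset_integral => //.
- exact: measurable_invf.
- by move=> x; exact: invf_ge0.
- by apply: subset_itvr; rewrite bnd_simp.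
Qed.

Lemma tailF_fin (u : R) : 0 < u -> tailF f u = (Ftail u)%:E.
Proof.
move=> u0; rewrite Ftail.unlock fineK// ge0_fin_numE ?tailF_ge0 ?ltW//.
by case: hf => _ _ h _; have [] := h _ u0.
Qed.

Lemma Ftail_sub (a b : R) : 0 < a -> a < b ->
  (\int[mu]_(x in `[a, b]) (f x)^-1%:E = (Ftail a - Ftail b)%:E)%E.
Proof.
move=> a0 ab.
have ge0 x : `]a, +oo[%classic x -> (0 <= ((f x)^-1)%:E)%E.
  by apply: invf_ge0; exact: ltW.
have mf : measurable_fun `]a, +oo[ (fun x => (f x)^-1%:E) by apply: measurable_invf; exact: ltW.
have s1 : `]a, b] `<=` `]a, +oo[ by apply: subset_itvl; rewrite bnd_simp.
have s2 : `]b, +oo[ `<=` `]a, +oo[ by apply: subset_itvr; rewrite bnd_simp ltW.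
have : (tailF f a = \int[mu]_(x in `]a, b]) (f x)^-1%:E + tailF f b)%E.
  have E : `]a, +oo[%classic = `]a, b]%classic `|` `]b, +oo[%classic :> set R.
    apply/seteqP; split => x /=; rewrite !in_itv/= !andbT.
      by move=> ax; have [xb|bx] := leP x b; [left; rewrite ax|right].
    by move=> [/andP[]//|]; exact: lt_trans.
  rewrite /tailF E ge0_integral_setU//.
  - by rewrite -E.
  - by move=> x [/s1|/s2]; exact: ge0.
  - apply/disj_setPS => x /= []; rewrite !in_itv/= => /andP[_ h1] /andP[h2 _].
    by move: (lt_le_trans h2 h1); rewrite ltxx.
rewrite integral_itv_obnd_cbnd; last by apply: measurable_funS mf.
rewrite (tailF_fin a0) (tailF_fin (lt_trans a0 ab)).
case: (\int[mu]_(x in `[a, b]) _)%E => [r| |]//.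
by rewrite -EFinD => -[->]; rewrite addrK.
Qed.

(** Near [u] the tail integral equals [Ftail a] minus an integral over [[a, x]], to which the
    fundamental theorem of calculus applies; [a = u / 2] stays away from [0], where [1 / f] may be
    singular. *)
Lemma is_derive_Ftail (u : R) : 0 < u -> is_derive u 1 Ftail (- (f u)^-1).
Proof.
move=> u0.
pose a := u / 2; pose b := u + 1.
have a0 : 0 < a by rewrite divr_gt0.
have au : a < u by rewrite ltr_pdivrMr// ltr_pMr// ltr1n.
have ub : u < b by rewrite ltrDl.
pose G x := (\int[mu]_(t in `[a, x]) (f t)^-1)%R.
have ci : mu.-integrable `[a, b] (EFin \o (fun x => (f x)^-1)).
  apply: continuous_compact_integrable; first exact: segment_compact.
  apply: continuous_in_subspaceT => x /set_mem /=; rewrite in_itv/= => /andP[ax _].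
  exact/continuous_invf/(lt_le_trans a0).
have [dG G'] := continuous_FTC1_closed ub ci au (continuous_invf u0).
have FG : \forall x \near u, Ftail a - G x = Ftail x.
  near=> x.
  have ax : a < x by near: x; exact: lt_nbhsr.
  have /(congr1 fine) := Ftail_sub a0 ax; rewrite /= => h.
  by rewrite /G /Rintegral h; ring.
have dFG : is_derive u 1 (fun x => Ftail a - G x) (- (f u)^-1).
  have dG' : is_derive u 1 G (f u)^-1.
    by apply: DeriveDef; [exact: dG|rewrite -derive1E; exact: G'].
  have := is_deriveD (is_derive_cst (Ftail a) u 1) (is_deriveN dG').
  by rewrite add0r.
exact: near_eq_is_derive FG dFG.
Unshelve. all: by end_near. Qed.

Lemma Ftail_ge0 (u : R) : 0 < u -> 0 <= Ftail u.
Proof. by move=> u0; rewrite -lee_fin -tailF_fin// tailF_ge0// ltW. Qed.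

Lemma continuous_Ftail (u : R) : 0 < u -> {for u, continuous Ftail}.
Proof.
move=> u0; apply: differentiable_continuous; apply/derivable1_diffP.
by have dF := is_derive_Ftail u0; exact: ex_derive.
Qed.

Lemma Ftail_lt (a b : R) : 0 < a -> a < b -> Ftail b < Ftail a.
Proof.
move=> a0 ab.
have [c /[!in_itv]/= /andP[ac cb] h] : exists2 c, c \in `]a, b[%R &
    Ftail b - Ftail a = (- (f c)^-1) * (b - a).
  apply: MVT => //.
    move=> x /[!in_itv]/= /andP[ax _]; exact/is_derive_Ftail/(lt_trans a0).
  apply: continuous_in_subspaceT => x /set_mem /=; rewrite in_itv/= => /andP[ax _].
  exact/continuous_Ftail/(lt_le_trans a0).
rewrite -subr_lt0 h nmulr_rlt0 ?subr_gt0//.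
by rewrite oppr_lt0 invr_gt0 class_S_gt0// (lt_trans a0).
Qed.

Lemma Ftail_gt0 (u : R) : 0 < u -> 0 < Ftail u.
Proof.
move=> u0; apply: le_lt_trans (@Ftail_lt u (u + 1) u0 _); last by rewrite ltrDl.
by apply: Ftail_ge0; rewrite addr_gt0.
Qed.

(** By monotone convergence [F b] is the limit of the integrals over [[b, b + n + 1]]. If [F >= e]
    held beyond [a], each of these would be at most [F b - e]. It follows that [Phi] is
    unbounded. *)
Lemma Ftail_small (e a : R) : 0 < e -> exists2 x, a < x & Ftail x < e.
Proof.
move=> e0; pose b := Num.max a 1.
have b0 : 0 < b by rewrite lt_max ltr01 orbT.
pose S (n : nat) := `[b, b + n.+1%:R]%classic : set R.
have cv : (\int[mu]_(x in S n) (f x)^-1%:E)%E @[n --> \oo] -->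
    (\int[mu]_(x in \bigcup_n S n) (f x)^-1%:E)%E.
  have ge0 x : b <= x -> (0 <= ((f x)^-1)%:E)%E.
    by move=> bx; rewrite lee_fin invr_ge0 ltW// class_S_gt0// (lt_le_trans b0).
  apply: ge0_nondecreasing_set_cvg_integral.
  - apply/nondecreasing_seqP => n; rewrite subsetEset; apply: subset_itvl.
    by rewrite bnd_simp lerD2l ler_nat.
  - by move=> n; exact: measurable_itv.
  - move=> n; apply: measurable_funS (measurable_invf (lexx 0)) => //.
    move=> x /=; rewrite !in_itv/= => /andP[bx _]; rewrite andbT.
    exact: (lt_le_trans b0 bx).
  - by move=> n x; rewrite /S/= in_itv/= => /andP[bx _]; exact: ge0.
have SE : \bigcup_n S n = `[b, +oo[%classic.
  apply/seteqP; split => x /=.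
    by move=> [n _]; rewrite /S/= !in_itv/= => /andP[-> _].
  rewrite in_itv/= andbT => bx; exists (Num.trunc (x - b)) => //.
  by rewrite /S/= in_itv/= bx/= -lerBlDl ltW// truncnS_gt.
rewrite SE -integral_itv_obnd_cbnd in cv; last by apply: measurable_invf; exact: ltW.
rewrite -/(tailF f b) tailF_fin// in cv.
apply: contrapT => H.
have He x : a < x -> e <= Ftail x by move=> ax; rewrite leNgt; apply/negP => h; apply: H; exists x.
suff : ((Ftail b)%:E <= (Ftail b - e)%:E)%E by rewrite lee_fin; lra.
rewrite -(cvg_lim _ cv)//; apply: lime_le; first exact: cvgP cv.
apply: nearW => n; rewrite Ftail_sub ?ltrDl// lee_fin lerB//; apply: He.
by rewrite (@le_lt_trans _ _ b) ?ltrDl// le_max lexx.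
Qed.

Lemma PhiE (r u : R) : Phi r u = Ftail u `^ (- r).
Proof. by rewrite Phi.unlock. Qed.

Lemma Phi_gt0 (r u : R) : 0 < u -> 0 < Phi r u.
Proof. by move=> u0; rewrite PhiE powR_gt0// Ftail_gt0. Qed.

Lemma is_derive_Ftail_powR (a u : R) : 0 < u ->
  is_derive u 1 (fun x => Ftail x `^ a) (a * Ftail u `^ (a - 1) * (- (f u)^-1)).
Proof.
move=> u0; apply: (@is_derive1_comp _ (@powR R ^~ a) Ftail).
  exact/is_derive1_powR/Ftail_gt0.
exact: is_derive_Ftail.
Qed.

Lemma is_derive_Phi (r u : R) : 0 < u ->
  is_derive u 1 (Phi r) (r * (f u * Ftail u `^ (1 + r))^-1).
Proof.
move=> u0.
have -> : r * (f u * Ftail u `^ (1 + r))^-1 = (- r) * Ftail u `^ (- r - 1) * (- (f u)^-1).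
  by rewrite invfM -powRN (_ : - (1 + r) = - r - 1); ring.
rewrite (_ : Phi r = fun x => Ftail x `^ (- r)); first exact: is_derive_Ftail_powR.
by apply/funext => x; rewrite PhiE.
Qed.

Lemma continuous_Phi (r u : R) : 0 < u -> {for u, continuous (Phi r)}.
Proof.
move=> u0; apply: differentiable_continuous; apply/derivable1_diffP.
by have dF := is_derive_Phi r u0; exact: ex_derive.
Qed.

Lemma Phi_le (r a b : R) : 0 <= r -> 0 < a -> a <= b -> Phi r a <= Phi r b.
Proof.
move=> r0 a0; rewrite le_eqVlt => /predU1P[->//|ab].
rewrite !PhiE; apply: powRN_antitone => //; first exact/Ftail_gt0/(lt_trans a0).
exact/ltW/Ftail_lt.
Qed.

Lemma Phi_surj (r xi w : R) : 0 < r -> 0 < xi -> Phi r xi <= w ->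
  exists2 A, xi <= A & Phi r A = w.
Proof.
move=> r0 xi0 xiw.
have w0 : 0 < w by apply: lt_le_trans xiw; exact: Phi_gt0.
(* [F b < w^(-1/r)] is the condition [Phi b > w], giving the upper end for the intermediate value
   theorem. *)
have [b xib Fb] := @Ftail_small (w `^ (- r^-1)) xi (powR_gt0 _ w0).
have b0 := lt_trans xi0 xib.
have wb : w <= Phi r b.
  rewrite PhiE -[leLHS](_ : (w `^ (- r^-1)) `^ (- r) = w).
    by apply: powRN_antitone; [exact: ltW|exact: Ftail_gt0|exact: ltW].
  by rewrite -powRrM mulrNN mulVf ?gt_eqF// powRr1// ltW.
have [||A] := @IVT _ (Phi r) xi b w (ltW xib).
- apply: continuous_in_subspaceT => x /set_mem /=; rewrite in_itv/= => /andP[ax _].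
  exact/continuous_Phi/(lt_le_trans xi0).
- by apply/andP; split; [rewrite ge_min xiw|rewrite le_max wb orbT].
by rewrite in_itv/= => /andP[xiA _] <-; exists A.
Qed.

(** * Growth of [f] and convexity of [Phi] above the threshold [xi] *)

Section convexity.
Variables (xi rho : R).
Hypothesis xi0 : 0 < xi.
Hypothesis fF : forall u, xi <= u -> f^`()%classic u * Ftail u <= 1 + rho.

(* The derivative of [f F^(1 + rho)] is [F^rho (f' F - (1 + rho))]. *)
Lemma fF_nincr (a b : R) : xi <= a -> a <= b ->
  f b * Ftail b `^ (1 + rho) <= f a * Ftail a `^ (1 + rho).
Proof.
move=> xia ab.
pose E x := f x * Ftail x `^ (1 + rho).
have dE (x : R) : 0 < x -> is_derive x 1 E (Ftail x `^ rho * (f^`()%classic x * Ftail x - (1 + rho))).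
  move=> x0.
  have df : is_derive x 1 f (f^`()%classic x).
    by apply: DeriveDef; [exact: class_S_derivable|rewrite derive1E].
  have dd := is_deriveM df (is_derive_Ftail_powR (1 + rho) x0).
  have F0 := Ftail_gt0 x0.
  have -> : Ftail x `^ rho * (f^`()%classic x * Ftail x - (1 + rho)) =
      f x *: ((1 + rho) * Ftail x `^ (1 + rho - 1) * (- (f x)^-1)) +
      Ftail x `^ (1 + rho) *: f^`()%classic x; last exact: dd.
    rewrite /GRing.scale/= (_ : 1 + rho - 1 = rho); last by ring.
    rewrite [X in X * f^`()%classic x]powRD ?(gt_eqF F0) ?implybT// (powRr1 (ltW F0)).
    by field; rewrite gt_eqF// class_S_gt0.
have pos x : xi <= x -> 0 < x := lt_le_trans xi0.
apply: (@ler0_derive1_nincry _ E xi) => //.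
- move=> x; rewrite in_itv/= andbT => /ltW xx.
  by have d := dE _ (pos _ xx); exact: ex_derive.
- move=> x; rewrite in_itv/= andbT => /ltW xx.
  have d := dE _ (pos _ xx); rewrite derive1E derive_val.
  by rewrite mulr_ge0_le0 ?powR_ge0// subr_le0 fF.
- apply: continuous_in_subspaceT => x /set_mem /=; rewrite in_itv/= andbT => xx.
  apply: differentiable_continuous; apply/derivable1_diffP.
  by have d := dE _ (pos _ xx); exact: ex_derive.
Qed.

(** For [a < b], [fF_nincr] gives [f b <= f a (F a / F b)^(1 + rho)], and [F = Phi^(-1/r)] turns the
    ratio into one of values of [Phi]. The summand [1] covers [b <= a], where [f b <= f a]. *)
Lemma f_growth (r a b : R) : 0 < r -> xi <= a -> xi <= b ->
  f b <= f a * (1 + (Phi r b / Phi r a) `^ ((1 + rho) / r)).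
Proof.
move=> r0 xia xib.
have a0 := lt_le_trans xi0 xia; have b0 := lt_le_trans xi0 xib.
have fa0 := class_S_gt0 a0.
have Fa := Ftail_gt0 a0; have Fb := Ftail_gt0 b0.
have [ab|/ltW ba] := leP a b; last first.
  rewrite mulrDr mulr1 ler_wpDr ?mulr_ge0 ?powR_ge0 ?(ltW fa0)//.
  by apply: class_S_ndecr => //; exact: ltW.
rewrite mulrDr mulr1 ler_wpDl ?(ltW fa0)//.
have -> : (Phi r b / Phi r a) `^ ((1 + rho) / r) =
    Ftail a `^ (1 + rho) / Ftail b `^ (1 + rho).
  have rn : r != 0 by rewrite gt_eqF.
  rewrite powRM; [|exact/ltW/Phi_gt0|by rewrite invr_ge0; exact/ltW/Phi_gt0].
  rewrite !PhiE -(powRN _ (- r)) -(powRN _ (1 + rho)) -!powRrM mulrC.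
  by congr (_ `^ _ * _ `^ _); field.
rewrite mulrA ler_pdivlMr ?powR_gt0//.
exact: fF_nincr.
Qed.

(** The derivative of [Phi] is [r / (f F^(1 + r))], and [f F^(1 + r)] is the product of the
    nonincreasing functions [f F^(1 + rho)] and [F^(r - rho)]. So the derivative is nondecreasing,
    and the mean value theorem on either side of [a] gives the tangent inequality. *)
Lemma Phi_tangent (r a u : R) : 0 < r -> rho <= r -> xi <= a -> xi <= u ->
  Phi r a + r * (f a * Ftail a `^ (1 + r))^-1 * (u - a) <= Phi r u.
Proof.
move=> r0 rr xia xiu.
have mono x y : xi <= x -> x <= y ->
    r * (f x * Ftail x `^ (1 + r))^-1 <= r * (f y * Ftail y `^ (1 + r))^-1.
  move=> xix xy.
  have x0 := lt_le_trans xi0 xix; have y0 := lt_le_trans x0 xy.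
  have Fx := Ftail_gt0 x0; have Fy := Ftail_gt0 y0.
  have P z : 0 < z -> 0 < f z * Ftail z `^ (1 + r).
    by move=> z0; apply: mulr_gt0; [exact: class_S_gt0|exact/powR_gt0/Ftail_gt0].
  apply: ler_wpM2l; first exact: ltW.
  rewrite lef_pV2; [|exact: P|exact: P].
  have E z : 0 < Ftail z -> Ftail z `^ (1 + r) = Ftail z `^ (1 + rho) * Ftail z `^ (r - rho).
    move=> z0; rewrite -[in LHS](_ : 1 + rho + (r - rho) = 1 + r); last by ring.
    by apply: powRD; rewrite (gt_eqF z0) implybT.
  rewrite (E x Fx) (E y Fy) !mulrA; apply: ler_pM.
  - by apply: mulr_ge0; [exact/ltW/class_S_gt0|exact: powR_ge0].
  - exact: powR_ge0.
  - exact: fF_nincr.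
  move: xy; rewrite le_eqVlt => /predU1P[->//|xy].
  by apply: ge0_ler_powR; [rewrite subr_ge0|exact: ltW|exact: ltW|exact/ltW/Ftail_lt].
have dPhi x : xi <= x -> is_derive x 1 (Phi r) (r * (f x * Ftail x `^ (1 + r))^-1).
  by move=> xix; apply: is_derive_Phi; exact: lt_le_trans xix.
have cPhi x y : xi <= x -> {within `[x, y], continuous (Phi r)}.
  move=> xix; apply: continuous_in_subspaceT => z /set_mem /=; rewrite in_itv/= => /andP[xz _].
  by apply: continuous_Phi; exact: lt_le_trans (le_trans xix xz).
have [au|ua] := leP a u.
  have dP x : x \in `]a, u[%R -> is_derive x 1 (Phi r) (r * (f x * Ftail x `^ (1 + r))^-1).
    by move=> /[!in_itv]/= /andP[ax _]; apply: dPhi; exact/ltW/(le_lt_trans xia).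
  have [c /[!in_itv]/= /andP[ac cu] h] := MVT_segment au dP (cPhi a u xia).
  rewrite -lerBrDl h ler_wpM2r ?subr_ge0//; exact: mono.
have dP x : x \in `]u, a[%R -> is_derive x 1 (Phi r) (r * (f x * Ftail x `^ (1 + r))^-1).
  by move=> /[!in_itv]/= /andP[ax _]; apply: dPhi; exact/ltW/(le_lt_trans xiu).
have [c /[!in_itv]/= /andP[uc ca] h] := MVT_segment (ltW ua) dP (cPhi u a xiu).
have -> : Phi r u = Phi r a - (Phi r a - Phi r u) by ring.
rewrite h lerD2l -mulrN opprB -[leLHS]opprK -[leRHS]opprK lerN2 -!mulrN !opprB.
rewrite ler_wpM2r ?subr_ge0 ?(ltW ua)//.
by apply: mono => //; exact: le_trans uc.
Qed.

End convexity.

Lemma tailF_pow_ge0 (r u : R) : 0 <= tailF_pow f r u.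
Proof. by rewrite /tailF_pow; case: ifP => // _; exact: powR_ge0. Qed.

Lemma tailF_powE (r u : R) : 0 < u -> tailF_pow f r u = Phi r u.
Proof. by move=> u0; rewrite PhiE /tailF_pow tailF_fin. Qed.

Lemma tailF_pow_le (r u v : R) : 0 <= r -> 0 <= u -> u <= v ->
  tailF_pow f r u <= tailF_pow f r v.
Proof.
move=> r0 u0; rewrite le_eqVlt => /predU1P[->//|uv].
have v0 := le_lt_trans u0 uv.
rewrite (tailF_powE r v0) PhiE /tailF_pow; case: ifPn => [_|uy]; first exact: powR_ge0.
apply: powRN_antitone => //; first exact: Ftail_gt0.
have := le_tailF u0 (ltW uv); rewrite tailF_fin//.
have := tailF_ge0 u0; move: uy.
by case: (tailF f u) => [s| |]//= _ _; rewrite lee_fin.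
Qed.

(** Truncation at [0] yields a function that is monotone on the whole line, hence Borel, although
    nothing is known about [f] at negative arguments. *)
Lemma measurable_tailF_pow (r : R) : 0 <= r ->
  measurable_fun setT (fun u : R => tailF_pow f r (Num.max 0 u)).
Proof.
move=> r0; apply: nondecreasing_measurable; first exact: measurableT.
move=> x y xy; apply: tailF_pow_le; [exact: r0|by rewrite le_max lexx|].
by rewrite ge_max !le_max lexx xy orbT.
Qed.

Lemma measurable_f_max : measurable_fun setT (fun u : R => f (Num.max 0 u)).
Proof.
apply: nondecreasing_measurable; first exact: measurableT.
move=> x y xy; apply: class_S_ndecr; first by rewrite le_max lexx.
by rewrite ge_max !le_max lexx xy orbT.
Qed.

Lemma class_S_left_cvg (u : nat -> R) (l : R) : (forall n, 0 <= u n) ->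
  (forall n, u n <= l) -> u @ \oo --> l -> f \o u @ \oo --> f l.
Proof.
move=> u0 ul cv.
have l0 : 0 <= l := le_trans (u0 0) (ul 0).
move: l0; rewrite le_eqVlt => /predU1P[l0|l0].
  have uE : u = cst l.
    by apply/funext => n; apply/eqP; rewrite eq_le ul -l0 u0.
  have -> : f \o u = cst (f l) by rewrite uE.
  exact: cvg_cst.
exact: (cvg_comp _ _ cv (class_S_continuous l0)).
Qed.

End nonlinearity.

(** * Estimates of the source term *)

Section time_integral.
Context {R : realType}.
Notation mu := (@lebesgue_measure R).

(** On each half of []0, t[] only one factor can be singular; the other is bounded by its value at
    [t / 2]. *)
Lemma powR_mul_split (a b s t : R) : 0 <= a -> 0 <= b -> 0 < s -> s < t ->
  (t - s) `^ (- a) * s `^ (- b) <=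
  (t / 2) `^ (- a) * s `^ (- b) + (t / 2) `^ (- b) * (t - s) `^ (- a).
Proof.
move=> a0 b0 s0 st; have t0 := lt_trans s0 st; have t20 : 0 < t / 2 by rewrite divr_gt0.
have [h|h] := leP s (t / 2).
  rewrite ler_wpDr ?mulr_ge0 ?powR_ge0// ler_wpM2r ?powR_ge0//.
  by apply: powRN_antitone => //; lra.
rewrite ler_wpDl ?mulr_ge0 ?powR_ge0// mulrC ler_wpM2r ?powR_ge0//.
by apply: powRN_antitone => //; exact: ltW.
Qed.

Lemma integral_powRN_reflect (a t : R) : a < 1 -> 0 < t ->
  (\int[mu]_(s in `]0%R, t[) ((t - s) `^ (- a))%:E <= (t `^ (1 - a) / (1 - a))%:E)%E.
Proof.
move=> a1 t0; apply: le_trans (integral_powRN a1 t0).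
pose g (s : R) : \bar R := ((s `^ (- a)) * \1_`]0, t[ s)%:E.
have gE : (\int[mu]_(s in `]0%R, t[) (s `^ (- a))%:E = \int[mu]_s g s)%E.
  rewrite integral_mkcond; apply: eq_integral => s _.
  by rewrite /g patchE indicE; case: ifPn => _; rewrite ?mulr1 ?mulr0.
rewrite gE -(ge0_integral_lebesgue_reflect t).
- rewrite integral_mkcond le_eqVlt; apply/orP; left; apply/eqP.
  apply: eq_integral => s _; rewrite /g patchE indicE.
  have -> : (s \in `]0, t[%classic) = (t - s \in `]0, t[%classic).
    by rewrite !mem_setE !in_itv/= subr_gt0 ltrBlDr ltrDl andbC.
  by case: ifPn => _; rewrite ?mulr1 ?mulr0.
- apply/measurable_EFinP; apply: measurable_funM; last exact: measurable_indic.
  exact: measurable_powR.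
- by move=> s; rewrite lee_fin mulr_ge0 ?powR_ge0.
Qed.

(** An explicit upper bound standing in for the Beta integral, with the same power of [t]. *)
Lemma integral_beta_le (a b t : R) : 0 <= a -> a < 1 -> 0 <= b -> b < 1 -> 0 < t ->
  (\int[mu]_(s in `]0%R, t[) ((t - s) `^ (- a) * s `^ (- b))%:E <=
   ((2 `^ a / (1 - b) + 2 `^ b / (1 - a)) * t `^ (1 - a - b))%:E)%E.
Proof.
move=> a0 a1 b0 b1 t0; have t20 : 0 < t / 2 by rewrite divr_gt0.
have ma : measurable_fun setT (fun s : R => (t - s) `^ (- a)).
  apply: (@measurableT_comp _ _ _ _ R R (@powR R ^~ (- a)) setT (fun s : R => t - s)).
    exact: measurable_powR.
  exact: measurable_funB.
have mb : measurable_fun setT (fun s : R => s `^ (- b)) := measurable_powR (- b).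
apply: (@le_trans _ _ (\int[mu]_(s in `]0%R, t[)
  (((t / 2) `^ (- a))%:E * (s `^ (- b))%:E + ((t / 2) `^ (- b))%:E * ((t - s) `^ (- a))%:E))%E).
  apply: ge0_le_integral => //.
  - by move=> s _; rewrite lee_fin mulr_ge0 ?powR_ge0.
  - by apply: measurable_funTS; apply/measurable_EFinP; exact: measurable_funM.
  - apply: measurable_funTS; apply: emeasurable_funD; apply: emeasurable_funM => //; exact/measurable_EFinP.
  - move=> s; rewrite /= in_itv/= => /andP[s0 st].
    by rewrite -!EFinM -EFinD lee_fin powR_mul_split.
rewrite ge0_integralD//; last 4 first.
- by move=> s _; rewrite -EFinM lee_fin mulr_ge0 ?powR_ge0.
- by apply: measurable_funTS; apply: emeasurable_funM => //; exact/measurable_EFinP.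
- by move=> s _; rewrite -EFinM lee_fin mulr_ge0 ?powR_ge0.
- by apply: measurable_funTS; apply: emeasurable_funM => //; exact/measurable_EFinP.
rewrite ge0_integralZl_EFin ?powR_ge0//; last 2 first.
- by move=> s _; rewrite lee_fin powR_ge0.
- by apply: measurable_funTS; exact/measurable_EFinP.
rewrite ge0_integralZl_EFin ?powR_ge0//; last 2 first.
- by move=> s _; rewrite lee_fin powR_ge0.
- by apply: measurable_funTS; exact/measurable_EFinP.
apply: (@le_trans _ _ (((t / 2) `^ (- a))%:E * (t `^ (1 - b) / (1 - b))%:E +
   ((t / 2) `^ (- b))%:E * (t `^ (1 - a) / (1 - a))%:E)%E).
  apply: leeD; apply: lee_wpmul2l; rewrite ?lee_fin ?powR_ge0//.
    exact: integral_powRN.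
  exact: integral_powRN_reflect.
rewrite -!EFinM -EFinD lee_fin le_eqVlt; apply/orP; left; apply/eqP.
have tn : t != 0 by rewrite gt_eqF.
have H c : (t / 2) `^ (- c) = t `^ (- c) * 2 `^ c.
  rewrite powRM ?(ltW t0)// ?invr_ge0//; congr (_ * _).
  by rewrite -powR_inv1// -powRrM mulN1r opprK.
have P c d : t `^ (c + d) = t `^ c * t `^ d by rewrite powRD// tn implybT.
rewrite !H !P.
by field; rewrite !subr_eq0 gt_eqF//= gt_eqF.
Qed.

End time_integral.

Section power_split.
Context {R : realType}.

(** Below [l] the first term suffices; above it, [x^th = x^(th - 1) x] and
    [x^(th - 1) <= l^(th - 1)]. The right side is affine in [x], which matters because
    [heat_weight_le] controls only the first power of the heat flow. *)
Lemma powR_le_split (x l th : R) : 0 <= x -> 0 < l -> 0 <= th -> th <= 1 ->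
  x `^ th <= l `^ th + l `^ (th - 1) * x.
Proof.
move=> x0 l0 th0 th1.
have [xl|/ltW lx] := leP x l.
  rewrite ler_wpDr ?mulr_ge0 ?powR_ge0//.
  by apply: ge0_ler_powR; rewrite ?nnegrE// ltW.
rewrite ler_wpDl ?powR_ge0//.
have x_gt0 := lt_le_trans l0 lx.
have -> : x `^ th = x `^ (th - 1) * x.
  rewrite -[X in _ * X](powRr1 x0) -powRD; first by rewrite subrK.
  by rewrite (gt_eqF x_gt0) implybT.
rewrite ler_wpM2r// -opprB; apply: powRN_antitone => //.
by rewrite subr_ge0.
Qed.

End power_split.

Section source_estimate.
Context {R : realType} (n : nat) (phi : 'rV[R]_n -> R) (g th r : R).
Hypothesis n0 : (0 < n)%N.
Hypothesis mphi : completed_measurable_fun (borel_lebesgue n) setT phi.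
Hypothesis phi0 : forall x, 0 <= phi x.
Hypothesis g0 : 0 <= g.
Hypothesis gn : g < n%:R.
Hypothesis th0 : 0 <= th.
Hypothesis th1 : th <= 1.
Hypothesis r0 : 0 < r.

Let C := (2 / (1 - g / n%:R) + 1) ^+ n.

Lemma weight_const_ge0 : 0 <= C.
Proof.
rewrite exprn_ge0// addr_ge0// divr_ge0// subr_ge0.
by rewrite ler_pdivrMr ?ltr0n// mul1r ltW.
Qed.

(* [powR_le_split] is applied with the threshold [(s / t)^(- g / 2)], the size of
   the factor lost in [heat_weight_le]. *)
Lemma heat_source_le (s t A : R) (w : 'rV[R]_n -> R) (a : R) (x : 'rV[R]_n) :
  0 < s -> s < t -> 0 < A -> 0 < a -> heat t phi x = a%:E ->
  (forall y, 0 < w y) -> (forall y, heat s phi y = (w y)%:E) ->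
  (forall y, w y <= A) -> measurable_fun setT w ->
  (\int[borel_lebesgue n]_y (heat_kernel (x - y) (t - s) * enorm y `^ (- g) *
     (1 + (w y / a) `^ (th + r^-1)))%:E
   <= (C * (t - s) `^ (- (g / 2)) *
       (1 + 2 * (A / a) `^ r^-1 * (s / t) `^ (- (g / 2 * th))))%:E)%E.
Proof.
move=> s0 st A0 a0 hta w0 hsw wA mw.
have t0 := lt_trans s0 st; have ts0 : 0 < t - s by rewrite subr_gt0.
pose k y := heat_kernel (x - y) (t - s) * enorm y `^ (- g).
have k0 y : 0 <= k y by rewrite mulr_ge0 ?heat_kernel_ge0 ?powR_ge0.
have mk : measurable_fun setT k.
  by apply: measurable_funM; [exact: measurable_kernel_sub|exact: measurable_fun_enorm_powR].
have st0 : 0 < s / t by rewrite divr_gt0.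
pose l := (s / t) `^ (- (g / 2)).
have l0 : 0 < l by rewrite powR_gt0.
pose c := (A / a) `^ r^-1.
have c0 : 0 <= c by rewrite powR_ge0.
have rV0 : 0 <= r^-1 by rewrite invr_ge0 ltW.
(* The power [r^-1] is spent on the uniform bound [w <= A], and the power [th] is made affine. *)
have pw y : (w y / a) `^ (th + r^-1) <= c * (l `^ th + l `^ (th - 1) * (w y / a)).
  have wa0 : 0 < w y / a by rewrite divr_gt0.
  rewrite powRD; last by rewrite (gt_eqF wa0) implybT.
  rewrite mulrC ler_pM ?powR_ge0//.
    apply: ge0_ler_powR; rewrite ?nnegrE ?divr_ge0 ?(ltW a0) ?(ltW A0) ?(ltW (w0 _))//.
    by rewrite ler_wpM2r// invr_ge0 ltW.
  by apply: powR_le_split => //; exact: ltW.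
pose c1 := 1 + c * l `^ th; pose c2 := c * l `^ (th - 1) / a.
have c10 : 0 <= c1 by rewrite addr_ge0// mulr_ge0// powR_ge0.
have c20 : 0 <= c2 by rewrite !mulr_ge0 ?powR_ge0// invr_ge0 ltW.
apply: (@le_trans _ _ (\int[borel_lebesgue n]_y
   (c1%:E * (k y)%:E + c2%:E * ((k y)%:E * (w y)%:E)))%E).
  apply: ge0_le_integral => //.
  - move=> y _; rewrite lee_fin; apply: mulr_ge0; first exact: k0.
    by rewrite addr_ge0// powR_ge0.
  - apply/measurable_EFinP; apply: measurable_funM => //; apply: measurable_funD => //.
    apply: (@measurableT_comp _ _ _ _ R R (@powR R ^~ (th + r^-1)) setT).
      exact: measurable_powR.
    exact: measurable_funM.
  - apply: emeasurable_funD.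
      by apply: emeasurable_funM => //; exact/measurable_EFinP.
    apply: emeasurable_funM => //; apply: emeasurable_funM; exact/measurable_EFinP.
  - move=> y _; rewrite -!EFinM -EFinD lee_fin.
    have := ler_wpM2l (k0 y) (pw y); rewrite /c1 /c2 -/(k y) => h.
    rewrite mulrDr mulr1; apply: le_trans (lerD (lexx _) h) _.
    by rewrite le_eqVlt; apply/orP; left; apply/eqP; ring.
rewrite ge0_integralD//; last 4 first.
- move=> y _; rewrite -EFinM lee_fin; apply: mulr_ge0; [exact: c10|exact: k0].
- by apply: emeasurable_funM => //; exact/measurable_EFinP.
- move=> y _; rewrite -!EFinM lee_fin; apply: mulr_ge0; first exact: c20.
  by apply: mulr_ge0; [exact: k0|exact: ltW].
- by apply: emeasurable_funM => //; apply: emeasurable_funM; exact/measurable_EFinP.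
rewrite ge0_integralZl_EFin//; last 2 first.
- by move=> y _; rewrite lee_fin.
- exact/measurable_EFinP.
rewrite ge0_integralZl_EFin//; last 2 first.
- move=> y _; rewrite -EFinM lee_fin.
  by apply: mulr_ge0; [exact: k0|exact: ltW].
- by apply: emeasurable_funM; exact/measurable_EFinP.
have I1 : (\int[borel_lebesgue n]_y (k y)%:E <= (C * (t - s) `^ (- (g / 2)))%:E)%E.
  apply: le_trans (integral_heat_kernel_weight x n0 g0 gn ts0).
  by rewrite le_eqVlt; apply/orP; left; apply/eqP; apply: eq_integral => y _; rewrite /k heat_kernel_sym.
have I2 : (\int[borel_lebesgue n]_y ((k y)%:E * (w y)%:E) <=
    (C * (s * (t - s) / t) `^ (- (g / 2)) * a)%:E)%E.
  rewrite EFinM -hta; apply: le_trans (heat_weight_le mphi phi0 x n0 g0 gn s0 st).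
  by rewrite le_eqVlt; apply/orP; left; apply/eqP; apply: eq_integral => y _; rewrite hsw.
apply: (@le_trans _ _ (c1%:E * (C * (t - s) `^ (- (g / 2)))%:E +
   c2%:E * (C * (s * (t - s) / t) `^ (- (g / 2)) * a)%:E)%E).
  by apply: leeD; apply: lee_wpmul2l; rewrite ?lee_fin.
rewrite -!EFinM -EFinD lee_fin le_eqVlt; apply/orP; left; apply/eqP.
have -> : (s * (t - s) / t) `^ (- (g / 2)) = l * (t - s) `^ (- (g / 2)).
  by rewrite mulrAC powRM ?(ltW st0) ?(ltW ts0).
have -> : (s / t) `^ (- (g / 2 * th)) = l `^ th by rewrite /l -powRrM mulNr.
rewrite /c1 /c2 -/c.
have -> : l `^ (th - 1) = l `^ th / l.
  by rewrite powRB ?powRr1 ?(ltW l0)// (gt_eqF l0) implybT.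
by field; rewrite !gt_eqF.
Qed.

End source_estimate.

(** * The supersolution *)

Section leb_kernel.
Context {R : realType} (n : nat).
Notation Y := (caratheodory_type ((borel_lebesgue n : set 'rV[R]_n -> \bar R)^*)%mu).

Lemma integral_leb_heat_kernel (t : R) (x : 'rV[R]_n) : 0 < t ->
  (\int[leb n]_y (heat_kernel (x - y) t)%:E = 1)%E.
Proof.
move=> t0; rewrite /leb ge0_integral_completed//.
- rewrite -(integral_heat_kernel x t0).
  by apply: eq_integral => y _; rewrite heat_kernel_sym.
- by apply/measurable_EFinP; exact: measurable_kernel_sub.
- by move=> y _; rewrite lee_fin heat_kernel_ge0.
Qed.

Lemma heat_cst (t c : R) (x : 'rV[R]_n) : 0 < t -> 0 <= c ->
  heat t (fun=> c) x = c%:E.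
Proof.
move=> t0 c0; rewrite /heat.
under eq_integral do rewrite mulrC EFinM.
rewrite ge0_leb_integralZl ?integral_leb_heat_kernel ?mule1//.
- apply/measurable_EFinP; apply: measurable_fun_completedT; exact: measurable_kernel_sub.
- by move=> y; rewrite lee_fin heat_kernel_ge0.
Qed.

Lemma le_heat (t : R) (p1 p2 : 'rV[R]_n -> R) (x : 'rV[R]_n) :
  completed_measurable_fun (borel_lebesgue n) setT p1 ->
  completed_measurable_fun (borel_lebesgue n) setT p2 ->
  (forall y, 0 <= p1 y) -> (forall y, p1 y <= p2 y) ->
  (heat t p1 x <= heat t p2 x)%E.
Proof.
move=> m1 m2 p0 p12; apply: le_integral_leb.
- exact: measurable_heat_integrand1.
- exact: measurable_heat_integrand1.
- by move=> y; rewrite lee_fin mulr_ge0 ?heat_kernel_ge0.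
- by move=> y; rewrite lee_fin ler_wpM2l ?heat_kernel_ge0.
Qed.

Lemma heatD (t : R) (p1 p2 : 'rV[R]_n -> R) (x : 'rV[R]_n) :
  completed_measurable_fun (borel_lebesgue n) setT p1 ->
  completed_measurable_fun (borel_lebesgue n) setT p2 ->
  (forall y, 0 <= p1 y) -> (forall y, 0 <= p2 y) ->
  heat t (fun y => p1 y + p2 y) x = (heat t p1 x + heat t p2 x)%E.
Proof.
move=> m1 m2 p10 p20; rewrite /heat.
under eq_integral do rewrite mulrDr EFinD.
rewrite ge0_integralD.
- by [].
- exact: measurableT.
- by move=> y _; rewrite lee_fin mulr_ge0 ?heat_kernel_ge0.
- exact: measurable_heat_integrand1.
- by move=> y _; rewrite lee_fin mulr_ge0 ?heat_kernel_ge0.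
- exact: measurable_heat_integrand1.
Qed.

Lemma heatZ (t c : R) (p : 'rV[R]_n -> R) (x : 'rV[R]_n) :
  completed_measurable_fun (borel_lebesgue n) setT p ->
  (forall y, 0 <= p y) -> 0 <= c ->
  heat t (fun y => c * p y) x = (c%:E * heat t p x)%E.
Proof.
move=> mp p0 c0; rewrite /heat.
under eq_integral do rewrite mulrCA EFinM.
apply: ge0_leb_integralZl.
- exact: measurable_heat_integrand1.
- by move=> y; rewrite lee_fin mulr_ge0 ?heat_kernel_ge0.
- by rewrite lee_fin.
Qed.

End leb_kernel.

Section supersolution.
Context {R : realType} (n : nat) (f : R -> R) (q r xi th g : R).
Variable u0 : 'rV[R]_n -> R.
Notation mu := (@lebesgue_measure R).
Hypothesis hf : class_S f q.
Hypothesis n0 : (0 < n)%N.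
Hypothesis r0 : 0 < r.
Hypothesis xi0 : 0 < xi.
Hypothesis th0 : 0 <= th.
Hypothesis th1 : th <= 1.
Hypothesis fF : forall u, xi <= u -> f^`()%classic u * Ftail f u <= 1 + th * r.
Hypothesis g0 : 0 <= g.
Hypothesis gn : g < n%:R.
Hypothesis g2 : g < 2.
(** The exponent of [1 / s] in the time integral: [n / (2 r)] is [s^(-n/2)] raised to [1 / r], and
    [g / 2 * th] comes from the threshold in [heat_source_le]. The companion [d] below is the power
    of time that remains after integration; it vanishes in the critical case. *)
Let b := n%:R / (2 * r) + g / 2 * th.
Hypothesis b1 : b < 1.
Let d := 1 - g / 2 - n%:R / (2 * r).
Hypothesis d0 : 0 <= d.
Hypothesis mu0 : completed_measurable_fun (borel_lebesgue n) setT u0.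
Hypothesis u00 : forall x, 0 <= u0 x.

(** Raising [u0] to at least [xi] places all values where [Phi] is convex. It also bounds the datum,
    and hence its heat flow, below by [Phi xi], so that [Phi_surj] applies. *)
Definition lifted_datum (x : 'rV[R]_n) : R := Phi f r (Num.max xi (u0 x)).
Let phi := lifted_datum.

Lemma Phi_lifted_ge (u : R) : Phi f r xi <= Phi f r (Num.max xi u).
Proof. by apply: (Phi_le hf) => //; [exact: ltW|rewrite le_max lexx]. Qed.

Lemma lifted_datum_ge x : Phi f r xi <= phi x.
Proof. exact: Phi_lifted_ge. Qed.

Lemma lifted_datum_ge0 x : 0 <= phi x.
Proof. by apply: le_trans (lifted_datum_ge x); exact/ltW/(Phi_gt0 hf). Qed.

Lemma measurable_lifted_datum : completed_measurable_fun (borel_lebesgue n) setT phi.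
Proof.
have mP : measurable_fun setT (fun u : R => Phi f r (Num.max xi u)).
  apply: nondecreasing_measurable; first exact: measurableT.
  move=> x y xy; apply: (Phi_le hf); first exact: ltW.
    by rewrite lt_max xi0.
  by rewrite ge_max !le_max lexx xy orbT.
exact: (measurableT_comp mP mu0).
Qed.

(** The indicator of []0, t[] turns the Duhamel term into a single integral over space-time against
    a fixed measure, as the abstract iteration expects. *)
Definition src_kernel (x : 'rV[R]_n) (t : R) (z : measurableTypeR R * 'rV[R]_n) : R :=
  heat_kernel (x - z.2) (t - z.1) * enorm z.2 `^ (- g) * \1_`]0, t[ (z.1 : R).

Lemma src_kernel_ge0 x t z : 0 <= src_kernel x t z.
Proof. by rewrite /src_kernel mulr_ge0// mulr_ge0 ?heat_kernel_ge0 ?powR_ge0. Qed.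

(** The constant of [integral_heat_kernel_weight], times the time integral of the bound in
    [heat_source_le]: [(1 - g / 2)^-1] from its summand [1], and twice the constant of
    [integral_beta_le] from the other one. *)
Definition src_const : R :=
  (2 / (1 - g / n%:R) + 1) ^+ n *
  ((1 - g / 2)^-1 + 2 * (2 `^ (g / 2) / (1 - b) + 2 `^ b / (1 - g / 2))).

Lemma src_const_ge0 : 0 <= src_const.
Proof.
have h1 : 0 < 1 - g / 2 by rewrite subr_gt0 ltr_pdivrMr// mul1r.
have h2 : 0 < 1 - b by rewrite subr_gt0.
rewrite mulr_ge0//; first exact: weight_const_ge0.
by rewrite addr_ge0 ?invr_ge0 ?(ltW h1)// mulr_ge0// addr_ge0// divr_ge0 ?powR_ge0// ltW.
Qed.

Variables (A0 T : R).
Hypothesis A00 : 0 < A0.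
Hypothesis T0 : 0 < T.
Hypothesis heat_le : forall t x, 0 < t < T ->
  (heat t phi x <= (A0 * t `^ (- (n%:R / 2)))%:E)%E.
Hypothesis small : src_const * A0 `^ r^-1 * T `^ d <= 2 `^ (- r^-1) / (2 * r).

Definition heatR (x : 'rV[R]_n) (t : R) : R := fine (heat t phi x).

Lemma heatRE x t : 0 < t < T -> heat t phi x = (heatR x t)%:E.
Proof.
move=> tT; rewrite /heatR fineK// ge0_fin_numE.
  by apply: le_lt_trans (heat_le x tT) _; rewrite ltry.
apply: heat_ge0; exact: lifted_datum_ge0.
Qed.

Lemma heatR_ge x t : 0 < t < T -> Phi f r xi <= heatR x t.
Proof.
move=> tT; have /andP[t0 _] := tT.
rewrite -lee_fin -heatRE// -(heat_cst x t0 (ltW (Phi_gt0 hf r xi0))).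
apply: le_heat.
- exact: measurable_cst.
- exact: measurable_lifted_datum.
- by move=> y; exact/ltW/(Phi_gt0 hf).
- exact: lifted_datum_ge.
Qed.

Lemma heatR_gt0 x t : 0 < t < T -> 0 < heatR x t.
Proof. by move=> tT; apply: lt_le_trans (heatR_ge x tT); exact: (Phi_gt0 hf). Qed.

Lemma supersolution_ex x t : 0 < t < T -> exists2 A, xi <= A & Phi f r A = 2 * heatR x t.
Proof.
move=> tT; apply: (Phi_surj hf) => //.
have := heatR_ge x tT; have := heatR_gt0 x tT; lra.
Qed.

(* The convexity of [Phi], used through its tangent at [A], plays the role of
   Jensen's inequality. *)
Lemma heat_datum_le (x : 'rV[R]_n) (t A : R) : 0 < t < T -> xi <= A ->
  Phi f r A = 2 * heatR x t ->
  (heat t u0 x <= (A - f A * Ftail f A `^ (1 + r) / r * heatR x t)%:E)%E.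
Proof.
move=> tT xiA PA; have /andP[t0 _] := tT.
have A_gt0 := lt_le_trans xi0 xiA.
pose c := f A * Ftail f A `^ (1 + r) / r.
have fA0 : 0 < f A := class_S_gt0 hf A_gt0.
have FA0 : 0 < Ftail f A `^ (1 + r) by exact/powR_gt0/(Ftail_gt0 hf).
have c0 : 0 < c by rewrite divr_gt0// mulr_gt0.
have rho : th * r <= r by rewrite ler_piMl// ltW.
have tang y : u0 y + c * (2 * heatR x t) <= A + c * phi y.
  apply: (@le_trans _ _ (Num.max xi (u0 y) + c * (2 * heatR x t))).
    by rewrite lerD2r le_max lexx orbT.
  have xiu : xi <= Num.max xi (u0 y) by rewrite le_max lexx.
  have := Phi_tangent hf xi0 fF r0 rho xiA xiu.
  rewrite -/(lifted_datum y) -/phi -PA.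
  have -> : r * (f A * Ftail f A `^ (1 + r))^-1 = c^-1.
    by rewrite /c invf_div.
  move: (Num.max xi (u0 y)) (phi y) (Phi f r A) => u p P h.
  have := ler_wpM2l (ltW c0) h.
  by rewrite mulrDr mulVKf ?gt_eqF//; lra.
have w0 := heatR_gt0 x tT.
have cw0 : 0 <= c * (2 * heatR x t).
  by apply: mulr_ge0; [exact: ltW|apply: mulr_ge0 => //; exact: ltW].
have h1 : (heat t u0 x + (c * (2 * heatR x t))%:E <= A%:E + (c * heatR x t)%:E)%E.
  rewrite -(heat_cst x t0 cw0).
  rewrite -(heat_cst x t0 (ltW A_gt0)) EFinM -heatRE//.
  rewrite -(heatZ t x measurable_lifted_datum lifted_datum_ge0 (ltW c0)).
  rewrite -heatD; last 4 first.
  - exact: mu0.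
  - exact: measurable_cst.
  - exact: u00.
  - by [].
  rewrite -heatD; last 4 first.
  - exact: measurable_cst.
  - by apply: measurable_funM; [exact: measurable_cst|exact: measurable_lifted_datum].
  - by move=> y; exact: ltW.
  - by move=> y; apply: mulr_ge0; [exact: ltW|exact: lifted_datum_ge0].
  apply: le_heat.
  - by apply: measurable_funD; [exact: mu0|exact: measurable_cst].
  - apply: measurable_funD; first exact: measurable_cst.
    by apply: measurable_funM; [exact: measurable_cst|exact: measurable_lifted_datum].
  - by move=> y; rewrite addr_ge0.
  - exact: tang.
move: h1; have : (0 <= heat t u0 x)%E by exact: heat_ge0.
case: (heat t u0 x) => [s| |]//= _.
rewrite -!EFinD !lee_fin -/c; lra.
Qed.

Lemma measurable_heatR : measurable_fun setT (fun z : measurableTypeR R * 'rV[R]_n => heatR z.2 z.1).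
Proof.
apply: (measurableT_comp (@fine_measurable R setT measurableT)).
apply: measurable_fun_heat.
- exact: measurable_lifted_datum.
- exact: lifted_datum_ge0.
- exact: measurable_snd.
- exact: measurable_fst.
Qed.

Lemma measurable_src_kernel (x : 'rV[R]_n) (t : R) : measurable_fun setT (src_kernel x t).
Proof.
apply: measurable_funM.
  apply: measurable_funM.
    apply: measurable_fun_heat_kernel; first by apply: measurable_fun_rVB => //; exact: measurable_snd.
    by apply: measurable_funB => //; exact: measurable_fst.
  by apply: measurable_fun_enorm_powR; exact: measurable_snd.
apply: (@measurableT_comp _ _ _ _ R R (\1_`]0, t[) setT); first exact: measurable_indic.
exact: measurable_fst.
Qed.

Lemma ge0_integral_src (x : 'rV[R]_n) (t : R) (h : 'rV[R]_n -> R -> R) :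
  measurable_fun setT (fun z : measurableTypeR R * 'rV[R]_n => h z.2 z.1) ->
  (forall y s, 0 <= h y s) ->
  (\int[mu \x borel_lebesgue n]_z (src_kernel x t z * h z.2 z.1)%:E =
   \int[mu]_(s in `]0%R, t[) \int[borel_lebesgue n]_y
     (heat_kernel (x - y) (t - s) * enorm y `^ (- g) * h y s)%:E)%E.
Proof.
move=> mh h0.
rewrite fubini_tonelli1; last 2 first.
- by apply/measurable_EFinP; apply: measurable_funM; [exact: measurable_src_kernel|].
- by move=> z; rewrite lee_fin mulr_ge0 ?src_kernel_ge0.
rewrite [RHS]integral_mkcond; apply: eq_integral => s _.
rewrite /fubini_F patchE /src_kernel/=; case: ifPn => sI.
  by apply: eq_integral => y _; rewrite indicE sI mulr1.
by under eq_integral do rewrite indicE (negbTE sI) mulr0 mul0r; rewrite integral0.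
Qed.

(** The right side is the allowed amount [W / Phi'(A)] divided by [f A]: once [f_growth] has taken
    out [f A], the remaining estimate concerns the heat flow alone. *)
Lemma src_bound (x : 'rV[R]_n) (t A : R) : 0 < t < T -> xi <= A ->
  Phi f r A = 2 * heatR x t ->
  (\int[mu]_(s in `]0%R, t[) \int[borel_lebesgue n]_y
     (heat_kernel (x - y) (t - s) * enorm y `^ (- g) *
      (1 + (heatR y s / heatR x t) `^ (th + r^-1)))%:E
   <= (Ftail f A `^ (1 + r) / r * heatR x t)%:E)%E.
Proof.
move=> tT xiA PA; have /andP[t0 tT'] := tT.
have A_gt0 := lt_le_trans xi0 xiA.
set a := heatR x t; have a0 : 0 < a := heatR_gt0 x tT.
have sT s : s \in `]0, t[ -> 0 < s < T.
  by rewrite in_itv/= => /andP[-> /lt_trans]; exact.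
have rn : r != 0 by rewrite gt_eqF.
have h1 : 0 < 1 - g / 2 by rewrite subr_gt0 ltr_pdivrMr// mul1r.
have h2 : 0 < 1 - b by rewrite subr_gt0.
have b0 : 0 <= b.
  apply: addr_ge0; last by rewrite mulr_ge0// divr_ge0.
  by apply: divr_ge0; rewrite ?ler0n// mulr_ge0// ltW.
have rV0 : 0 <= r^-1 by rewrite invr_ge0 ltW.
set C := (2 / (1 - g / n%:R) + 1) ^+ n.
have C0 : 0 <= C by exact: weight_const_ge0.
pose e := (A0 / a) `^ r^-1.
have e0 : 0 <= e by rewrite powR_ge0.
have mh : measurable_fun setT (fun z : measurableTypeR R * 'rV[R]_n =>
    1 + (heatR z.2 z.1 / a) `^ (th + r^-1)).
  apply: measurable_funD => //.
  apply: (@measurableT_comp _ _ _ _ R R (@powR R ^~ (th + r^-1)) setT).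
    exact: measurable_powR.
  by apply: measurable_funM; [exact: measurable_heatR|exact: measurable_cst].
have mF (s : R) : measurable_fun setT (fun y => heatR y s).
  exact: (measurableT_comp measurable_heatR (pair1_measurable (s : measurableTypeR R))).
apply: (@le_trans _ _ (\int[mu]_(s in `]0%R, t[)
   ((C)%:E * (((t - s) `^ (- (g / 2)))%:E +
     (2 * e * t `^ (g / 2 * th))%:E * ((t - s) `^ (- (g / 2)) * s `^ (- b))%:E)))%E).
  have mp c : measurable_fun setT (fun s : R => (t - s) `^ c).
    apply: (@measurableT_comp _ _ _ _ R R (@powR R ^~ c) setT (fun s : R => t - s)).
      exact: measurable_powR.
    exact: measurable_funB.
  apply: ge0_le_integral => //.
  - move=> s _; apply: integral_ge0 => y _; rewrite lee_fin.
    by rewrite mulr_ge0 ?addr_ge0 ?powR_ge0// mulr_ge0 ?powR_ge0 ?heat_kernel_ge0.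
  - apply: measurable_funTS.
    apply: (measurable_fun_integral_param (borel_lebesgue n) (h := fun (s : measurableTypeR R) y =>
      (heat_kernel (x - y) (t - s) * enorm y `^ (- g) * (1 + (heatR y s / a) `^ (th + r^-1)))%:E)).
      apply/measurable_EFinP; apply: measurable_funM; last exact: mh.
      apply: measurable_funM.
        apply: measurable_fun_heat_kernel; first by apply: measurable_fun_rVB => //; exact: measurable_snd.
        by apply: measurable_funB => //; exact: measurable_fst.
      by apply: measurable_fun_enorm_powR; exact: measurable_snd.
    move=> s y; rewrite lee_fin.
    by rewrite mulr_ge0 ?addr_ge0 ?powR_ge0// mulr_ge0 ?powR_ge0 ?heat_kernel_ge0.
  - apply: measurable_funTS; apply: emeasurable_funM => //; apply: emeasurable_funD.
      by apply/measurable_EFinP; exact: mp.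
    apply: emeasurable_funM => //; apply/measurable_EFinP.
    by apply: measurable_funM; [exact: mp|exact: measurable_powR].
  move=> s sI; have sT' := sT s sI; move: (sI); rewrite /= in_itv/= => /andP[s0 st].
  apply: le_trans (heat_source_le (A := A0 * s `^ (- (n%:R / 2))) (w := fun y => heatR y s)
    n0 measurable_lifted_datum lifted_datum_ge0 g0 gn th0 th1 r0 s0 st _ a0 (heatRE x tT) _ _ _ _) _.
  - by rewrite mulr_gt0// powR_gt0.
  - by move=> y; exact: heatR_gt0.
  - by move=> y; exact: heatRE.
  - by move=> y; rewrite -lee_fin -heatRE// heat_le.
  - exact: mF.
  rewrite -[X in (_ <= _ * (_ + X))%E]EFinM -[X in (_ <= _ * X)%E]EFinD -[X in (_ <= X)%E]EFinM.
  rewrite lee_fin le_eqVlt; apply/orP; left; apply/eqP.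
  have -> : (A0 * s `^ (- (n%:R / 2)) / a) `^ r^-1 = e * s `^ (- (n%:R / (2 * r))).
    rewrite mulrAC powRM ?powR_ge0 ?divr_ge0 ?(ltW A00) ?(ltW a0)//; congr (_ * _).
    by rewrite -powRrM; congr (_ `^ _); field.
  have -> : (s / t) `^ (- (g / 2 * th)) = s `^ (- (g / 2 * th)) * t `^ (g / 2 * th).
    rewrite powRM ?(ltW s0) ?invr_ge0 ?(ltW t0)//; congr (_ * _).
    by rewrite -powR_inv1 ?(ltW t0)// -powRrM mulN1r opprK.
  have -> : s `^ (- b) = s `^ (- (n%:R / (2 * r))) * s `^ (- (g / 2 * th)).
    by rewrite -powRD ?(gt_eqF s0) ?implybT// /b opprD.
  by rewrite -/C; ring.
have m1 : measurable_fun `]0, t[ (fun s : R => ((t - s) `^ (- (g / 2)))%:E).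
  apply: measurable_funTS; apply/measurable_EFinP.
  apply: (@measurableT_comp _ _ _ _ R R (@powR R ^~ (- (g / 2))) setT (fun s : R => t - s)).
    exact: measurable_powR.
  exact: measurable_funB.
have m2 : measurable_fun `]0, t[ (fun s : R => ((t - s) `^ (- (g / 2)) * s `^ (- b))%:E).
  apply/measurable_EFinP; apply: measurable_funM; first exact/measurable_EFinP.
  by apply: measurable_funTS; exact: measurable_powR.
have c20 : 0 <= 2 * e * t `^ (g / 2 * th) by rewrite !mulr_ge0 ?powR_ge0.
rewrite ge0_integralZl_EFin//; last 2 first.
- move=> s _; rewrite -EFinM -EFinD lee_fin addr_ge0 ?powR_ge0//.
  by rewrite !mulr_ge0 ?powR_ge0.
- by apply: emeasurable_funD => //; exact: emeasurable_funM.
rewrite ge0_integralD//; last 3 first.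
- by move=> s _; rewrite lee_fin powR_ge0.
- by move=> s _; rewrite -EFinM lee_fin; apply: mulr_ge0 => //; rewrite mulr_ge0 ?powR_ge0.
- exact: emeasurable_funM.
rewrite ge0_integralZl_EFin//; last first.
  by move=> s _; rewrite lee_fin mulr_ge0 ?powR_ge0.
have g20 : 0 <= g / 2 by rewrite divr_ge0.
have g21 : g / 2 < 1 by rewrite -subr_gt0.
pose B := 2 `^ (g / 2) / (1 - b) + 2 `^ b / (1 - g / 2).
apply: (@le_trans _ _ (C%:E * ((t `^ (1 - g / 2) / (1 - g / 2))%:E +
   (2 * e * t `^ (g / 2 * th))%:E * (B * t `^ (1 - g / 2 - b))%:E))%E).
  apply: lee_wpmul2l; first by rewrite lee_fin.
  apply: leeD; first exact: integral_powRN_reflect.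
  by apply: lee_wpmul2l; [rewrite lee_fin|exact: integral_beta_le].
rewrite -[X in (_ * (_ + X) <= _)%E]EFinM -[X in (_ * X <= _)%E]EFinD -[X in (X <= _)%E]EFinM lee_fin.
have tn : (t == 0) = false by rewrite gt_eqF.
have -> : 2 * e * t `^ (g / 2 * th) * (B * t `^ (1 - g / 2 - b)) = 2 * B * (e * t `^ d).
  have -> : t `^ d = t `^ (g / 2 * th) * t `^ (1 - g / 2 - b).
    by rewrite -powRD ?tn ?implybT//; congr (_ `^ _); rewrite /d /b; ring.
  by ring.
(* Since [a <= A0 t^(-n/2)], the contribution of the summand [1] is absorbed by that of the
   power. *)
have te : t `^ (1 - g / 2) <= e * t `^ d.
  have at0 : 0 < A0 * t `^ (- (n%:R / 2)) by rewrite mulr_gt0// powR_gt0.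
  have h : a <= A0 * t `^ (- (n%:R / 2)) by rewrite -lee_fin /a -heatRE// heat_le.
  have : 1 <= (A0 * t `^ (- (n%:R / 2)) / a) `^ r^-1.
    apply: (@le_trans _ _ (1 `^ r^-1)); first by rewrite powR1.
    apply: ge0_ler_powR; rewrite ?nnegrE//.
      by rewrite divr_ge0// ltW.
    by rewrite ler_pdivlMr// mul1r.
  rewrite mulrAC powRM ?powR_ge0 ?divr_ge0 ?(ltW A00) ?(ltW a0)// -/e -powRrM => h3.
  have -> : t `^ d = t `^ (1 - g / 2) * t `^ (- (n%:R / 2) * r^-1).
    by rewrite -powRD ?tn ?implybT//; congr (_ `^ _); rewrite /d; field.
  by rewrite mulrCA ler_peMr ?powR_ge0.
have etd : e * t `^ d <= e * T `^ d.
  rewrite ler_wpM2l//; apply: ge0_ler_powR => //; rewrite ?nnegrE ?(ltW t0) ?(ltW T0) ?(ltW tT')//.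
apply: (@le_trans _ _ (src_const * (e * T `^ d))).
  apply: (@le_trans _ _ (src_const * (e * t `^ d))); last first.
    by rewrite ler_wpM2l// src_const_ge0.
  rewrite (_ : src_const * _ = C * (e * t `^ d / (1 - g / 2) + 2 * B * (e * t `^ d))).
    by rewrite ler_wpM2l// lerD2r ler_wpM2r// invr_ge0 ltW.
  have -> : src_const = C * ((1 - g / 2)^-1 + 2 * B) by [].
  by ring.
have -> : e = A0 `^ r^-1 * a `^ (- r^-1).
  rewrite /e powRM ?invr_ge0 ?(ltW A00) ?(ltW a0)//; congr (_ * _).
  by rewrite -powR_inv1 ?(ltW a0)// -powRrM mulN1r.
have -> : src_const * (A0 `^ r^-1 * a `^ (- r^-1) * T `^ d) =
    (src_const * A0 `^ r^-1 * T `^ d) * a `^ (- r^-1) by ring.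
apply: (@le_trans _ _ (2 `^ (- r^-1) / (2 * r) * a `^ (- r^-1))).
  by rewrite ler_wpM2r ?powR_ge0.
(* Expressed through [a], the target becomes exactly [2^(-1/r) / (2 r) * a^(-1/r)]; the threshold in
   [small] originates here. *)
have FA : Ftail f A = (2 * a) `^ (- r^-1).
  rewrite /a -PA PhiE -powRrM mulrNN mulfV// powRr1// ltW//.
  exact: (Ftail_gt0 hf).
have FA0 : 0 < Ftail f A by exact: (Ftail_gt0 hf).
have -> : Ftail f A `^ (1 + r) = (2 * a) `^ (- r^-1) * (2 * a)^-1.
  rewrite powRD; last by rewrite (gt_eqF FA0) implybT.
  rewrite powRr1 ?(ltW FA0)// {2}FA -powRrM mulNr mulVf// powR_inv1//.
    by rewrite FA.
  by rewrite mulr_ge0// ltW.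
rewrite powRM ?(ltW a0)// le_eqVlt; apply/orP; left; apply/eqP.
by field; rewrite rn gt_eqF.
Qed.

(** Stated for every measurable [v] below the supersolution, since the values of the latter are
    picked pointwise and are not known to depend measurably on the point. The source bound is
    exactly the amount that [heat_datum_le] leaves below [A]. *)
Lemma supersolution_le (x : 'rV[R]_n) (t A : R) (v : 'rV[R]_n -> R -> R) :
  0 < t < T -> xi <= A -> Phi f r A = 2 * heatR x t ->
  measurable_fun setT (fun z : measurableTypeR R * 'rV[R]_n => v z.2 z.1) ->
  (forall y s, 0 < s < t -> exists2 B, xi <= B & Phi f r B = 2 * heatR y s /\ v y s <= B) ->
  (heat t u0 x + \int[mu \x borel_lebesgue n]_z
     (src_kernel x t z * f (Num.max 0 (v z.2 z.1)))%:E <= A%:E)%E.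
Proof.
move=> tT xiA PA mv vB; have /andP[t0 tT'] := tT.
have A_gt0 := lt_le_trans xi0 xiA.
have fA0 : 0 < f A := class_S_gt0 hf A_gt0.
have mf : measurable_fun setT (fun z : measurableTypeR R * 'rV[R]_n => f (Num.max 0 (v z.2 z.1))).
  exact: (measurableT_comp (measurable_f_max hf) mv).
have f0 y s : 0 <= f (Num.max 0 (v y s)).
  by apply: (class_S_ge0 hf); rewrite le_max lexx.
pose h y s := 1 + (heatR y s / heatR x t) `^ (th + r^-1).
have h0 y s : 0 <= h y s by rewrite addr_ge0// powR_ge0.
have mh : measurable_fun setT (fun z : measurableTypeR R * 'rV[R]_n => h z.2 z.1).
  apply: measurable_funD => //.
  apply: (@measurableT_comp _ _ _ _ R R (@powR R ^~ (th + r^-1)) setT).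
    exact: measurable_powR.
  by apply: measurable_funM; [exact: measurable_heatR|exact: measurable_cst].
have : (\int[mu \x borel_lebesgue n]_z (src_kernel x t z * f (Num.max 0 (v z.2 z.1)))%:E
    <= (f A * (Ftail f A `^ (1 + r) / r * heatR x t))%:E)%E.
  apply: (@le_trans _ _ (\int[mu \x borel_lebesgue n]_z
      ((f A)%:E * (src_kernel x t z * h z.2 z.1)%:E))%E).
    apply: ge0_le_integral => //.
    - by move=> z _; rewrite lee_fin mulr_ge0 ?src_kernel_ge0.
    - by apply/measurable_EFinP; apply: measurable_funM; [exact: measurable_src_kernel|].
    - apply: emeasurable_funM => //.
      by apply/measurable_EFinP; apply: measurable_funM; [exact: measurable_src_kernel|].
    move=> [s y] _; rewrite -EFinM lee_fin/= mulrCA.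
    rewrite /src_kernel/= indicE; case: (boolP (s \in _)) => sI; last by rewrite !mulr0 !mul0r.
    rewrite ler_wpM2l//.
      by rewrite mulr1 mulr_ge0 ?powR_ge0 ?heat_kernel_ge0.
    move: sI; rewrite mem_setE in_itv/= => sI.
    have [B xiB [PB vB']] := vB y s sI.
    have B0 := lt_le_trans xi0 xiB.
    apply: (@le_trans _ _ (f B)).
      apply: (class_S_ndecr hf); first by rewrite le_max lexx.
      by rewrite ge_max vB' (ltW B0).
    apply: le_trans (f_growth hf xi0 fF r0 xiA xiB) _.
    rewrite ler_wpM2l ?(ltW fA0)// /h lerD2l PA PB.
    rewrite -mulf_div divff// mul1r.
    have -> : (1 + th * r) / r = th + r^-1 by field; rewrite gt_eqF.
    exact: lexx.
  rewrite ge0_integralZl_EFin ?(ltW fA0)//; last 2 first.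
  - by move=> z _; rewrite lee_fin mulr_ge0 ?src_kernel_ge0.
  - by apply/measurable_EFinP; apply: measurable_funM; [exact: measurable_src_kernel|].
  rewrite EFinM; apply: lee_wpmul2l; first by rewrite lee_fin ltW.
  rewrite ge0_integral_src//; exact: src_bound.
move=> h2; apply: le_trans (leeD (heat_datum_le tT xiA PA) h2) _.
by rewrite -EFinD lee_fin le_eqVlt; apply/orP; left; apply/eqP; ring.
Qed.

Lemma measurable_src_kernel2 : measurable_fun setT
  (fun p : (measurableTypeR R * 'rV[R]_n) * (measurableTypeR R * 'rV[R]_n) =>
    src_kernel p.1.2 p.1.1 p.2).
Proof.
have m11 : measurable_fun setT (fun p : (measurableTypeR R * 'rV[R]_n) * (measurableTypeR R * 'rV[R]_n) => p.1.1).
  exact: (measurableT_comp measurable_fst measurable_fst).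
have m12 : measurable_fun setT (fun p : (measurableTypeR R * 'rV[R]_n) * (measurableTypeR R * 'rV[R]_n) => p.1.2).
  exact: (measurableT_comp measurable_snd measurable_fst).
have m21 : measurable_fun setT (fun p : (measurableTypeR R * 'rV[R]_n) * (measurableTypeR R * 'rV[R]_n) => p.2.1).
  exact: (measurableT_comp measurable_fst measurable_snd).
have m22 : measurable_fun setT (fun p : (measurableTypeR R * 'rV[R]_n) * (measurableTypeR R * 'rV[R]_n) => p.2.2).
  exact: (measurableT_comp measurable_snd measurable_snd).
apply: measurable_funM.
  apply: measurable_funM; last exact: measurable_fun_enorm_powR.
  apply: measurable_fun_heat_kernel; first exact: measurable_fun_rVB.
  exact: measurable_funB.
(* The interval moves with [t], so its indicator is factored into indicators of a fixed half-line at
   [s] and at [t - s]. *)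
rewrite (_ : (fun _ => _) = (fun p : (measurableTypeR R * 'rV[R]_n) * (measurableTypeR R * 'rV[R]_n) =>
    \1_`](0 : R), +oo[ (p.2.1 : R) * \1_`](0 : R), +oo[ ((p.1.1 : R) - (p.2.1 : R)))); last first.
  apply/funext => p; rewrite !indicE -natrM mulnb; congr (nat_of_bool _)%:R.
  by rewrite !mem_setE !in_itv/= !andbT subr_gt0.
have mi : measurable_fun setT (\1_`](0 : R), +oo[ : R -> R) by exact: measurable_indic.
apply: measurable_funM.
  exact: (@measurableT_comp _ _ _ _ R R _ setT _ mi m21).
apply: (@measurableT_comp _ _ _ _ R R _ setT _ mi).
exact: measurable_funB.
Qed.

End supersolution.

(** * Monotone iteration *)

Section picard.
Context d (Z : measurableType d) {R : realType}.
Variables (m : {sigma_finite_measure set Z -> \bar R}) (H : Z -> \bar R).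
Variables (K : Z -> Z -> R) (G : R -> R) (D : set Z) (ub : Z -> R).
Hypothesis mH : measurable_fun setT H.
Hypothesis H0 : forall z, (0 <= H z)%E.
Hypothesis mK : measurable_fun setT (fun p : Z * Z => K p.1 p.2).
Hypothesis K0 : forall z w, 0 <= K z w.
Hypothesis mG : measurable_fun setT G.
Hypothesis G0 : forall x, 0 <= G x.
Hypothesis G_nd : forall x y, x <= y -> G x <= G y.
Hypothesis G_cvg : forall (u : nat -> R) (l : R), (forall k, 0 <= u k) ->
  (forall k, u k <= l) -> u k @[k --> \oo] --> l -> G (u k) @[k --> \oo] --> G l.
Hypothesis KD : forall z w, D z -> K z w != 0 -> D w.
Hypothesis ub0 : forall z, D z -> 0 <= ub z.
Hypothesis ub_super : forall v : Z -> R, measurable_fun setT v ->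
  (forall w, D w -> v w <= ub w) ->
  forall z, D z -> (H z + \int[m]_w (K z w * G (v w))%:E <= (ub z)%:E)%E.

Definition duhamel (v : Z -> R) (z : Z) : \bar R :=
  (H z + \int[m]_w (K z w * G (v w))%:E)%E.

Lemma measurable_duhamel_integrand v z : measurable_fun setT v ->
  measurable_fun setT (fun w => (K z w * G (v w))%:E).
Proof.
move=> mv; apply/measurable_EFinP; apply: measurable_funM.
  exact: (measurableT_comp mK (pair1_measurable z)).
exact: (measurableT_comp mG mv).
Qed.

Lemma duhamel_ge0 v z : (0 <= duhamel v z)%E.
Proof.
apply: adde_ge0; first exact: H0.
by apply: integral_ge0 => w _; rewrite lee_fin mulr_ge0.
Qed.

Lemma measurable_duhamel v : measurable_fun setT v -> measurable_fun setT (duhamel v).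
Proof.
move=> mv; apply: emeasurable_funD; first exact: mH.
apply: (@measurable_fun_integral_param _ _ _ _ _ m (fun z w => (K z w * G (v w))%:E)).
  apply/measurable_EFinP; apply: measurable_funM; first exact: mK.
  by apply: (measurableT_comp mG); exact: (measurableT_comp mv measurable_snd).
by move=> z w; rewrite lee_fin mulr_ge0.
Qed.

Lemma duhamel_le (v1 v2 : Z -> R) z : measurable_fun setT v1 -> measurable_fun setT v2 -> D z ->
  (forall w, D w -> v1 w <= v2 w) -> (duhamel v1 z <= duhamel v2 z)%E.
Proof.
move=> m1 m2 Dz v12; apply: leeD2l; apply: ge0_le_integral.
- exact: measurableT.
- by move=> w _; rewrite lee_fin mulr_ge0.
- exact: measurable_duhamel_integrand.
- exact: measurable_duhamel_integrand.
move=> w _; rewrite lee_fin; have [->|Kzw] := eqVneq (K z w) 0; first by rewrite !mul0r.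
by rewrite ler_wpM2l// G_nd// v12//; exact: KD Kzw.
Qed.

(** Values are extended reals because nothing bounds the integrals off [D]. On [D] they stay below
    [ub], and by [KD] an integral based at a point of [D] sees only points of [D]. *)
Fixpoint picard (k : nat) : Z -> \bar R :=
  if k is k'.+1 then duhamel (fine \o picard k') else cst 0%E.

Lemma picard_ge0 k z : (0 <= picard k z)%E.
Proof. by case: k => [|k]; [exact: lexx|exact: duhamel_ge0]. Qed.

Lemma measurable_picard k : measurable_fun setT (picard k).
Proof.
elim: k => [|k IH]; first exact: measurable_cst.
apply: measurable_duhamel.
exact: (measurableT_comp (@fine_measurable R setT measurableT)).
Qed.

Let fpicard k : Z -> R := fine \o picard k.

Let mfpicard k : measurable_fun setT (fpicard k).
Proof. exact: (measurableT_comp (@fine_measurable R setT measurableT) (measurable_picard k)). Qed.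

Lemma picard_le k z : D z -> (picard k z <= (ub z)%:E)%E.
Proof.
elim: k z => [|k IH] z Dz; first by rewrite lee_fin ub0.
apply: ub_super => //; first exact: (mfpicard k).
move=> w Dw.
have := IH w Dw; have := picard_ge0 k w.
rewrite -[X in _ -> _ -> X <= _]/(fine (picard k w)).
by case: (picard k w).
Qed.

Lemma picardE k z : D z -> picard k z = (fpicard k z)%:E.
Proof.
move=> Dz; rewrite /fpicard/= fineK// ge0_fin_numE ?picard_ge0//.
by apply: le_lt_trans (picard_le k Dz) _; rewrite ltry.
Qed.

Lemma picard_ndecr k z : D z -> (picard k z <= picard k.+1 z)%E.
Proof.
elim: k z => [|k IH] z Dz; first exact: duhamel_ge0.
apply: duhamel_le => //; [exact: (mfpicard k)|exact: (mfpicard k.+1)|move=> w Dw].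
by have := IH w Dw; rewrite (picardE k Dw) (picardE k.+1 Dw) lee_fin.
Qed.

Definition picard_lim (z : Z) : R := fine (ereal_sup (range (fun k => picard k z))).

Lemma picard_cvg z : D z -> fpicard k z @[k --> \oo] --> picard_lim z.
Proof.
move=> Dz.
have nd : nondecreasing_seq (fun k => picard k z).
  by apply/nondecreasing_seqP => k; exact: picard_ndecr.
have le k : (picard k z <= ereal_sup (range (fun k => picard k z)))%E.
  by apply: ereal_sup_ubound; exists k.
apply: fine_cvg; rewrite /picard_lim fineK; last first.
  rewrite ge0_fin_numE; last exact: le_trans (picard_ge0 0 z) (le 0%N).
  apply: (@le_lt_trans _ _ (ub z)%:E); last by rewrite ltry.
  by apply: ge_ereal_sup => _ [k _ <-]; exact: picard_le.
exact: ereal_nondecreasing_cvgn.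
Qed.

Lemma measurable_picard_lim : measurable_fun setT picard_lim.
Proof.
apply: (measurableT_comp (@fine_measurable R setT measurableT)).
rewrite (_ : (fun _ => _) = (fun z => esups (fun k => picard k z) 0)).
  by apply: measurable_fun_esups => k; exact: measurable_picard.
apply/funext => z; rewrite /esups; congr ereal_sup.
by apply/seteqP; split => y /= [k _ <-]; exists k.
Qed.

Lemma fpicard_ge0 k z : D z -> 0 <= fpicard k z.
Proof. by move=> Dz; rewrite -lee_fin -picardE// picard_ge0. Qed.

Lemma fpicard_nd z : D z -> nondecreasing_seq (fpicard^~ z).
Proof.
move=> Dz; apply/nondecreasing_seqP => k.
by rewrite -lee_fin -!picardE// picard_ndecr.
Qed.

Lemma fpicard_le_lim k z : D z -> fpicard k z <= picard_lim z.
Proof.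
move=> Dz; rewrite -(cvg_lim _ (picard_cvg Dz))//.
by apply: nondecreasing_cvgn_le; [exact: fpicard_nd|exact: cvgP (picard_cvg Dz)].
Qed.

Lemma picard_lim_le z : D z -> 0 <= picard_lim z <= ub z.
Proof.
move=> Dz; rewrite (le_trans (fpicard_ge0 0 Dz) (fpicard_le_lim 0 Dz))/=.
rewrite -(cvg_lim _ (picard_cvg Dz))//; apply: limr_le; first exact: cvgP (picard_cvg Dz).
by apply: nearW => k; rewrite -lee_fin -picardE// picard_le.
Qed.

(** Monotone convergence in the integral. [G_cvg] suffices for the integrand, since the iterates
    approach their limit from below. *)
Lemma picard_lim_fixpoint z : D z -> (picard_lim z)%:E = duhamel picard_lim z.
Proof.
move=> Dz.
have cv1 : picard k.+1 z @[k --> \oo] --> (picard_lim z)%:E.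
  rewrite (_ : (fun k => picard k.+1 z) = (fun k => (fpicard k.+1 z)%:E)).
    apply/cvg_EFin; first exact: nearW.
    rewrite (cvg_shiftS (fun k => fpicard k z)); exact: picard_cvg.
  by apply/funext => k; exact: picardE.
apply: (cvg_unique _ cv1) => //.
have cvI : (\int[m]_w (K z w * G (fpicard k w))%:E)%E @[k --> \oo] -->
    (\int[m]_w (K z w * G (picard_lim w))%:E)%E.
  pose gk k w := (K z w * G (fpicard k w))%:E.
  rewrite (_ : (\int[m]_w (K z w * G (picard_lim w))%:E)%E =
      (\int[m]_w limn (gk ^~ w))%E).
    apply: cvg_monotone_convergence.
    - exact: measurableT.
    - by move=> k; exact: measurable_duhamel_integrand.
    - by move=> k w _; rewrite lee_fin mulr_ge0.
    - move=> w _ k k' kk'; rewrite lee_fin.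
      have [->|Kzw] := eqVneq (K z w) 0; first by rewrite !mul0r.
      by rewrite ler_wpM2l// G_nd// fpicard_nd//; exact: KD Kzw.
  apply: eq_integral => w _; apply/esym/cvg_lim => //.
  apply/cvg_EFin; first exact: nearW.
  have [K00|Kzw] := eqVneq (K z w) 0.
    rewrite (_ : _ \o _ = cst 0); first by rewrite K00 mul0r; exact: cvg_cst.
    by apply/funext => k; rewrite /gk/= K00 mul0r.
  have Dw := KD Dz Kzw.
  apply: cvgMr; apply: G_cvg.
  - by move=> k; exact: fpicard_ge0.
  - by move=> k; exact: fpicard_le_lim.
  - exact: picard_cvg.
apply: cvgeD => //; last exact: cvg_cst.
apply: ge0_adde_def; rewrite inE ?H0//.
by apply: integral_ge0 => w _; rewrite lee_fin mulr_ge0.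
Qed.

Lemma monotone_iteration : exists2 u : Z -> R, measurable_fun setT u &
  forall z, D z -> 0 <= u z <= ub z /\
    (u z)%:E = (H z + \int[m]_w (K z w * G (u w))%:E)%E.
Proof.
exists picard_lim; first exact: measurable_picard_lim.
by move=> z Dz; split; [exact: picard_lim_le|exact: picard_lim_fixpoint].
Qed.

End picard.

(** * Uniformly local norms *)

(** The integral of a nonnegative function is a supremum over the simple functions below it, hence
    monotone without measurability. This serves [L1ul_norm], defined for arbitrary functions, and
    integrals over compact sets. *)
Lemma ge0_le_integral_nonmeasurable d (T : measurableType d) (R : realType)
    (m : {measure set T -> \bar R}) (D : set T) (a b : T -> \bar R) :
  (forall x, D x -> (0 <= a x)%E) -> (forall x, D x -> (a x <= b x)%E) ->
  (\int[m]_(x in D) a x <= \int[m]_(x in D) b x)%E.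
Proof.
move=> a0 ab.
have b0 x : D x -> (0 <= b x)%E by move=> Dx; exact: le_trans (a0 _ Dx) (ab _ Dx).
rewrite !(integral_mkcond D) !ge0_integralTE; last 2 first.
- by apply: erestrict_ge0 => x; exact: b0.
- by apply: erestrict_ge0 => x; exact: a0.
apply: le_ereal_sup => _ [h /= ha <-]; exists h => //= x.
apply: le_trans (ha x) _; rewrite !patchE; case: ifPn => //.
by move=> /set_mem; exact: ab.
Qed.

(** The argument of [ge0_integral_completed] for the completion on the time axis, which is built
    from the outer measure of interval lengths. *)
Lemma ge0_integral_completed_lebesgue (R : realType) (D : set (measurableTypeR R))
    (g : measurableTypeR R -> \bar R) :
  measurable D -> measurable_fun D g -> (forall x, D x -> (0 <= g x)%E) ->
  (\int[@completed_lebesgue_measure R]_(x in D) g x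
   = \int[@lebesgue_measure R]_(x in D) g x)%E.
Proof.
move=> mD mg g0.
pose cT := caratheodory_type ((wlength idfun : set (ocitv_type R) -> \bar R)^*)%mu.
have mid : measurable_fun (setT : set cT) (id : cT -> measurableTypeR R).
  by move=> _ Y mY; rewrite setTI; exact: sub_caratheodory.
transitivity (\int[pushforward (@completed_lebesgue_measure R) (id : cT -> measurableTypeR R)]_(x in D) g x)%E.
  rewrite ge0_integral_pushforward//.
  by move=> y /set_mem; exact: g0.
exact: eq_measure_integral.
Qed.

Lemma L1ul_norm_ge0 {R : realType} n (p : 'rV[R]_n -> R) : (0 <= L1ul_norm p)%E.
Proof.
apply: le_trans (ereal_sup_ubound _); last by exists 0.
by apply: integral_ge0 => x _; rewrite lee_fin.
Qed.

Section L1ul_theory.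
Context {R : realType} (n : nat).
Implicit Types p : 'rV[R]_n -> R.
Notation Y := (caratheodory_type ((borel_lebesgue n : set 'rV[R]_n -> \bar R)^*)%mu).

Lemma le_L1ul_norm (a b : 'rV[R]_n -> R) :
  (forall x, `|a x| <= `|b x|) -> (L1ul_norm a <= L1ul_norm b)%E.
Proof.
move=> ab; apply: ge_ereal_sup => _ [y _ <-].
apply: le_trans (ereal_sup_ubound _); last by exists y.
by apply: ge0_le_integral_nonmeasurable => x _; rewrite lee_fin.
Qed.

Lemma integral_eball_borel (p : 'rV[R]_n -> R) (y : 'rV[R]_n) :
  measurable_fun setT p -> (forall x, 0 <= p x) ->
  (\int[leb n]_(x in eball y 1) `|p x|%:E =
   \int[borel_lebesgue n]_x (chi (x - y) * p x)%:E)%E.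
Proof.
move=> mp p0; rewrite /leb ge0_integral_completed.
- rewrite integral_mkcond; apply: eq_integral => x _.
  rewrite patchE chi_eball indicE; case: ifPn => _; last by rewrite mul0r.
  by rewrite mul1r ger0_norm.
- exact: measurable_eball.
- apply: measurable_funTS; apply/measurable_EFinP.
  by apply: (@measurableT_comp _ _ _ _ R R (fun x : R => `|x|) setT p).
- by move=> x _; rewrite lee_fin.
Qed.

Lemma integral_chi_le (y : 'rV[R]_n) :
  (\int[borel_lebesgue n]_x (chi (x - y))%:E <= ((2 ^+ n) : R)%:E)%E.
Proof.
rewrite integral_chi_shift.
have := @integral_box R n 1 ltr01; rewrite mulr1 => <-.
apply: ge0_le_integral => //.
- by move=> x _; rewrite lee_fin chi_ge0.
- by apply/measurable_EFinP; exact: measurable_fun_chi.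
- apply: emeasurable_prod => i; apply/measurable_EFinP.
  apply: (@measurableT_comp _ _ _ _ R R (\1_`[(- 1)%R, 1%R] : R -> R) setT).
    exact: measurable_indic.
  exact: (@measurable_coor R n i).
move=> x _; rewrite prod_EFin lee_fin chiE.
have [x1|_] := boolP (enorm x < 1); last by rewrite prodr_ge0.
rewrite big1// => i _; rewrite indicE mem_set//= in_itv/= -ler_norml.
exact: le_trans (coor_le_enorm x i) (ltW x1).
Qed.

Lemma L1ul_norm_cst (c : R) : 0 <= c -> (L1ul_norm (fun _ : 'rV[R]_n => c) <= (c * 2 ^+ n)%:E)%E.
Proof.
move=> c0; apply: ge_ereal_sup => _ [y _ <-].
rewrite integral_eball_borel//.
under eq_integral do rewrite mulrC EFinM.
rewrite ge0_integralZl_EFin//; last 2 first.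
- by move=> x _; rewrite lee_fin chi_ge0.
- by apply/measurable_EFinP; exact: measurable_chi_sub.
by rewrite EFinM; apply: lee_wpmul2l; [rewrite lee_fin|exact: integral_chi_le].
Qed.

Lemma L1ul_normD (a b : 'rV[R]_n -> R) :
  completed_measurable_fun (borel_lebesgue n) setT a ->
  completed_measurable_fun (borel_lebesgue n) setT b ->
  (L1ul_norm (fun x => a x + b x)%R <= L1ul_norm a + L1ul_norm b)%E.
Proof.
move=> ma mb; apply: ge_ereal_sup => _ [y _ <-].
have my : measurable (eball y 1 : set Y) by apply: measurable_completed; exact: measurable_eball.
have mn p : completed_measurable_fun (borel_lebesgue n) setT p ->
    measurable_fun (eball y 1 : set Y) (fun x => `|p x|%:E).
  move=> mp; apply: measurable_funTS; apply/measurable_EFinP.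
  have nm : measurable_fun [set: R] (fun x : R => `|x|) by [].
  exact: (@measurableT_comp _ _ _ Y R R (fun x : R => `|x|) setT p nm mp).
apply: (@le_trans _ _ (\int[leb n]_(x in eball y 1) (`|a x|%:E + `|b x|%:E))%E).
  by apply: ge0_le_integral_nonmeasurable => x _; rewrite -?EFinD lee_fin ?ler_normD.
rewrite ge0_integralD.
- by apply: leeD; apply: ereal_sup_ubound; exists y.
- exact: my.
- by move=> x _; rewrite lee_fin.
- exact: mn.
- by move=> x _; rewrite lee_fin.
- exact: mn.
Qed.

Lemma compact_coor_bounded (K : set 'rV[R]_n) : compact K ->
  exists2 M : R, 0 < M & forall x, K x -> forall i, `|x ord0 i| <= M.
Proof.
move=> cK.
have bi i : exists2 M : R, 0 < M & forall x, K x -> `|x ord0 i| <= M.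
  have cKi : compact ((fun x : 'rV[R]_n => x ord0 i) @` K).
    apply: continuous_compact => //; apply: continuous_subspaceT.
    exact: coord_continuous.
  have [M [_ hM]] := compact_bounded cKi.
  exists (Num.max M 0 + 1); first by rewrite ltr_wpDl// le_max lexx orbT.
  move=> x Kx; apply: (hM (Num.max M 0 + 1)); last by exists x.
  by rewrite (@le_lt_trans _ _ (Num.max M 0)) ?le_max ?lexx// ltrDl.
have /choice[M hM] : forall i, exists M : R, 0 < M /\ forall x, K x -> `|x ord0 i| <= M.
  by move=> i; have [M M0 hM] := bi i; exists M.
exists (1 + \sum_i M i).
  by rewrite ltr_wpDr// sumr_ge0// => i _; exact/ltW/(hM i).1.
move=> x Kx i; apply: le_trans ((hM i).2 x Kx) _.
rewrite (bigD1 i)//= addrCA ler_wpDr// addr_ge0// sumr_ge0// => j _.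
exact/ltW/(hM j).1.
Qed.

(** A compact set lies in a box centred at [0], and the integral is compared with that of [B] over
    the box. *)
Lemma L1loc_bounded p (B : R) : measurable_fun setT p -> (forall x, 0 <= p x <= B) -> L1loc p.
Proof.
move=> mp pB; split; first exact: measurable_fun_completedT.
move=> K /compact_coor_bounded[M M0 KM].
have B0 : 0 <= B by have /andP[h1 h2] := pB 0; exact: le_trans h1 h2.
pose g (x : 'rV[R]_n) := (B%:E * \big[*%E/1%E]_(i < n) (\1_`[(- M)%R, M] (x ord0 i : R))%:E)%E.
have mg : measurable_fun setT (fun x : 'rV[R]_n =>
    (\big[*%E/1%E]_(i < n) (\1_`[(- M)%R, M] (x ord0 i : R))%:E : \bar R)%E).
  apply: emeasurable_prod => i; apply/measurable_EFinP.
  apply: (@measurableT_comp _ _ _ _ R R (\1_`[(- M)%R, M] : R -> R) setT).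
    exact: measurable_indic.
  exact: (@measurable_coor R n i).
have g0 (x : 'rV[R]_n) : (0 <= (\big[*%E/1%E]_(i < n) (\1_`[(- M)%R, M] (x ord0 i : R))%:E : \bar R))%E.
  by apply: prode_ge0 => i; rewrite lee_fin.
apply: (@le_lt_trans _ _ (\int[leb n]_x g x)%E).
  rewrite integral_mkcond; apply: ge0_le_integral_nonmeasurable => x _.
    by apply: erestrict_ge0 => z _; rewrite lee_fin.
  rewrite patchE; case: ifPn => [/set_mem Kx|_]; last by rewrite mule_ge0.
  rewrite /g prod_EFin big1 ?mule1; last first.
    by move=> i _; rewrite indicE mem_set//= in_itv/= -ler_norml; exact: KM.
  by have /andP[h1 h2] := pB x; rewrite lee_fin ger0_norm.
rewrite /leb ge0_integral_completed//.
- rewrite ge0_integralZl_EFin//.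
  by rewrite integral_box// -EFinM ltry.
- exact: emeasurable_funM.
- by move=> x _; rewrite mule_ge0.
Qed.

Lemma L1ul_bounded p (B M : R) : measurable_fun setT p -> (forall x, 0 <= p x <= B) ->
  (forall y, (\int[borel_lebesgue n]_x (chi (x - y) * p x)%:E <= M%:E)%E) ->
  L1ul p /\ (L1ul_norm p <= M%:E)%E.
Proof.
move=> mp pB pM.
have h : (L1ul_norm p <= M%:E)%E.
  apply: ge_ereal_sup => _ [y _ <-]; rewrite integral_eball_borel//.
  by move=> x; have /andP[] := pB x.
split=> //; split; first exact: (L1loc_bounded mp pB).
by apply: le_lt_trans h _; rewrite ltry.
Qed.

Lemma Lnorm_bounded p (B : R) : (forall x, 0 <= p x <= B) ->
  (Lnorm (leb n) +oo (fun x => (p x)%:E) <= B%:E)%E.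
Proof.
move=> pB; have B0 : 0 <= B by have /andP[h1 h2] := pB 0; exact: le_trans h1 h2.
rewrite Lnorm.unlock; case: ifPn => _; last by rewrite lee_fin.
apply/ess_supP; apply: aeW => x /=; have /andP[h1 h2] := pB x.
by rewrite lee_fin ger0_norm.
Qed.

End L1ul_theory.

(** * Existence below the supersolution *)

(* The library's canonical sigma-finite structure on [m1 \x m2] is masked by the
   one for products of subprobabilities. *)
Section spacetime_measure.
Context {R : realType} (n : nat).

Definition spacetime_measure : set (measurableTypeR R * 'rV[R]_n) -> \bar R :=
  (@lebesgue_measure R \x borel_lebesgue n)%E.

HB.instance Definition _ := Measure.on spacetime_measure.

Let spacetime_sigma_finite : sigma_finite setT spacetime_measure.
Proof.
have [F TF Foo] := sigma_finiteT (@borel_lebesgue R n.+1).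
exists (fun k => @cons_rV R n @^-1` F k).
  by rewrite -preimage_bigcup -TF preimage_setT.
move=> k; have [mF Fk] := Foo k; split; last exact: Fk.
by rewrite -[X in measurable X]setTI; apply: measurable_cons_rV.
Qed.

HB.instance Definition _ := Measure_isSigmaFinite.Build _ _ _
  spacetime_measure spacetime_sigma_finite.

End spacetime_measure.

Section existence.
Context {R : realType} (n : nat) (f : R -> R) (q r xi th g : R).
Variable u0 : 'rV[R]_n -> R.
Notation mu := (@lebesgue_measure R).
Hypothesis hf : class_S f q.
Hypothesis n0 : (0 < n)%N.
Hypothesis r0 : 0 < r.
Hypothesis xi0 : 0 < xi.
Hypothesis th0 : 0 <= th.
Hypothesis th1 : th <= 1.
Hypothesis fF : forall u, xi <= u -> f^`()%classic u * Ftail f u <= 1 + th * r.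
Hypothesis g0 : 0 <= g.
Hypothesis gn : g < n%:R.
Hypothesis g2 : g < 2.
Hypothesis b1 : n%:R / (2 * r) + g / 2 * th < 1.
Hypothesis d0 : 0 <= 1 - g / 2 - n%:R / (2 * r).
Hypothesis mu0 : completed_measurable_fun (borel_lebesgue n) setT u0.
Hypothesis u00 : forall x, 0 <= u0 x.
Variables (A0 T : R).
Hypothesis A00 : 0 < A0.
Hypothesis T0 : 0 < T.
Hypothesis heat_le : forall (t : R) x, 0 < t < T ->
  (heat t (lifted_datum f r xi u0) x <= (A0 * t `^ (- (n%:R / 2)))%:E)%E.
Hypothesis small : src_const n r th g * A0 `^ r^-1 * T `^ (1 - g / 2 - n%:R / (2 * r))
  <= 2 `^ (- r^-1) / (2 * r).
Hypothesis phi_fin : (L1ul_norm (lifted_datum f r xi u0) < +oo)%E.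
Let W := heatR f r xi u0.

Lemma dominated_mild_solution : exists2 u : 'rV[R]_n -> R -> R,
  measurable_fun setT (fun z : measurableTypeR R * 'rV[R]_n => u z.2 z.1) &
  forall x (t : R), 0 < t < T ->
    (exists2 A, xi <= A & Phi f r A = 2 * W x t /\ 0 <= u x t <= A) /\
    (u x t)%:E = (heat t u0 x + \int[mu \x borel_lebesgue n]_z
      (src_kernel g x t z * f (Num.max 0 (u z.2 z.1)))%:E)%E.
Proof.
have /choice[ub hub] : forall z : measurableTypeR R * 'rV[R]_n, exists A,
    0 < z.1 < T -> xi <= A /\ Phi f r A = 2 * W z.2 z.1.
  move=> z; have [zT|zT] := boolP (0 < z.1 < T); last by exists 0.
  by have [A xiA PA] := supersolution_ex hf r0 xi0 mu0 heat_le z.2 zT; exists A.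
pose D := [set z : measurableTypeR R * 'rV[R]_n | 0 < z.1 < T].
have [| | | | | | | | | | |u mu_ hu] := @monotone_iteration _
  _ R (@spacetime_measure R n)
  (fun z => heat z.1 u0 z.2) (fun z w => src_kernel g z.2 z.1 w)
  (fun v => f (Num.max 0 v)) D ub.
- exact: (measurable_fun_heat mu0 u00 measurable_snd measurable_fst).
- by move=> z; exact: heat_ge0.
- exact: measurable_src_kernel2.
- by move=> z w; exact: src_kernel_ge0.
- exact: measurable_f_max hf.
- by move=> x; apply: (class_S_ge0 hf); rewrite le_max lexx.
- move=> x y xy; apply: (class_S_ndecr hf); first by rewrite le_max lexx.
  by rewrite ge_max !le_max lexx xy orbT.
- move=> v l v0 vl vcvg.
  have l0 : 0 <= l := le_trans (v0 0%N) (vl 0%N).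
  rewrite (max_r l0) (_ : (fun k => _) = f \o v).
    exact: class_S_left_cvg hf _ _ v0 vl vcvg.
  by apply/funext => k /=; rewrite max_r.
- move=> z w /andP[z1 zT]; rewrite /D/= /src_kernel indicE mem_setE in_itv/=.
  case: (boolP (0 < w.1 < z.1)) => [/andP[w1 wz] _|_]; last by rewrite mulr0 eqxx.
  by rewrite w1 (lt_trans wz zT).
- by move=> z Dz; apply: le_trans (hub z Dz).1; exact: ltW.
- move=> v mv vub z Dz; have [xiA PA] := hub z Dz.
  have -> : (\int[@spacetime_measure R n]_w (src_kernel g z.2 z.1 w * f (Num.max 0 (v w)))%:E)%E =
      (\int[mu \x borel_lebesgue n]_w
        (src_kernel g z.2 z.1 w * f (Num.max 0 (v (w.1, w.2))))%:E)%E.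
    by apply: eq_integral => -[].
  apply: (@supersolution_le R n f q r xi th g u0 hf n0 r0 xi0 th0 th1 fF g0 gn g2 b1 d0
    mu0 u00 A0 T A00 T0 heat_le small z.2 z.1 (ub z) (fun y s => v (s, y)) Dz xiA PA).
    by rewrite (_ : (fun _ => _) = v)//; apply/funext => -[].
  move=> y s /andP[s0 sz].
  have Ds : D (s, y) by rewrite /D/= s0 (lt_trans sz)//; case/andP: Dz.
  by have [h1 h2] := hub (s, y) Ds; exists (ub (s, y)) => //; split=> //; exact: vub.
exists (fun x t => u (t, x)).
  by rewrite (_ : (fun _ => _) = u)//; apply/funext => -[].
move=> x t tT; have [h1 h2] := hub (t, x) tT; have [h3 ->] := hu (t, x) tT; split.
  by exists (ub (t, x)).
by congr (_ + _)%E; apply: eq_integral => -[].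
Qed.

(** Serves twice: for the solution itself, with [a = xi], and for [F(u)^(-r)], with [a = 0] and
    [c = 2]. *)
Lemma integral_chi_heatR_le (t : R) (y : 'rV[R]_n) (p : 'rV[R]_n -> R) (a c : R) :
  0 < t < T -> 0 <= a -> 0 <= c -> measurable_fun setT p ->
  (forall x, 0 <= p x <= a + c * W x t) ->
  (\int[borel_lebesgue n]_x (chi (x - y) * p x)%:E
   <= (a * 2 ^+ n + c * fine (L1ul_norm (lifted_datum f r xi u0)))%:E)%E.
Proof.
move=> tT a0 c0 mp pW; have /andP[t0 _] := tT.
have phi0 (x : 'rV[R]_n) : 0 <= lifted_datum f r xi u0 x by exact: (lifted_datum_ge0 u0 hf).
have mphi := measurable_lifted_datum hf r0 xi0 mu0.
have mW : measurable_fun setT (W^~ t).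
  exact: (measurableT_comp (measurable_heatR hf r0 xi0 mu0) (pair1_measurable (t : measurableTypeR R))).
have W0 x : 0 <= W x t by rewrite fine_ge0// heat_ge0.
have mc : measurable_fun setT (fun x : 'rV[R]_n => chi (x - y)) by exact: measurable_chi_sub.
apply: (@le_trans _ _ (\int[borel_lebesgue n]_x
   (a%:E * (chi (x - y))%:E + c%:E * ((chi (x - y))%:E * heat t (lifted_datum f r xi u0) x)))%E).
  apply: ge0_le_integral => //.
  - by move=> x _; rewrite lee_fin mulr_ge0 ?chi_ge0//; have /andP[] := pW x.
  - by apply/measurable_EFinP; exact: measurable_funM.
  - apply: emeasurable_funD; first by apply: emeasurable_funM => //; exact/measurable_EFinP.
    apply: emeasurable_funM => //; apply: emeasurable_funM; first exact/measurable_EFinP.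
    by apply: measurable_fun_heat => //; exact: measurable_cst.
  move=> x _; rewrite (heatRE hf r0 xi0 heat_le)// -!EFinM -EFinD lee_fin -/(W x t).
  have /andP[_ h] := pW x; have := ler_wpM2l (chi_ge0 (x - y)) h.
  by move=> /le_trans; apply; rewrite le_eqVlt; apply/orP; left; apply/eqP; ring.
rewrite ge0_integralD//; last 4 first.
- by move=> x _; rewrite mule_ge0// lee_fin chi_ge0.
- by apply: emeasurable_funM => //; exact/measurable_EFinP.
- by move=> x _; rewrite mule_ge0// mule_ge0 ?lee_fin ?chi_ge0// heat_ge0.
- apply: emeasurable_funM => //; apply: emeasurable_funM; first exact/measurable_EFinP.
  by apply: measurable_fun_heat => //; exact: measurable_cst.
rewrite ge0_integralZl_EFin//; last 2 first.
- by move=> x _; rewrite lee_fin chi_ge0.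
- exact/measurable_EFinP.
rewrite ge0_integralZl_EFin//; last 2 first.
- by move=> x _; rewrite mule_ge0 ?lee_fin ?chi_ge0// heat_ge0.
- apply: emeasurable_funM; first exact/measurable_EFinP.
  by apply: measurable_fun_heat => //; exact: measurable_cst.
rewrite EFinD !EFinM; apply: leeD; apply: lee_wpmul2l; rewrite ?lee_fin//.
  exact: integral_chi_le.
rewrite fineK; last first.
  rewrite ge0_fin_numE//; apply: le_trans (heat_ball_le mphi phi0 0 t0).
  by apply: integral_ge0 => x _; rewrite mule_ge0 ?lee_fin ?chi_ge0// heat_ge0.
exact: heat_ball_le.
Qed.

(** The tangent of [Phi] at [xi] makes the supersolution at most affine in [W]. Both the uniformly
    local bound and the bound away from [t = 0] on the solution follow from this. *)
Lemma supersolution_le_heatR x (t A : R) : xi <= A -> Phi f r A = 2 * W x t ->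
  A <= xi + 2 * (f xi * Ftail f xi `^ (1 + r) / r) * W x t.
Proof.
move=> xiA PA.
have fA0 : 0 < f xi := class_S_gt0 hf xi0.
have FA0 : 0 < Ftail f xi `^ (1 + r) by exact/powR_gt0/(Ftail_gt0 hf).
set c := f xi * _ / r; have c0 : 0 < c by rewrite divr_gt0// mulr_gt0.
have rho : th * r <= r by rewrite ler_piMl// ltW.
have := Phi_tangent hf xi0 fF r0 rho (lexx xi) xiA.
have -> : r / (f xi * Ftail f xi `^ (1 + r)) = c^-1 by rewrite /c invf_div.
rewrite PA => h; have P0 := Phi_gt0 hf r xi0.
have {}h : c^-1 * (A - xi) <= 2 * W x t by lra.
have := ler_wpM2l (ltW c0) h; rewrite mulVKf ?gt_eqF//; lra.
Qed.

Lemma local_solution_ex : exists2 u : 'rV[R]_n -> R -> R, local_solution g f u0 T u &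
  forall t, 0 < t < T ->
    L1ul (fun x => tailF_pow f r (u x t)) /\
    (L1ul_norm (fun x => tailF_pow f r (u x t)) <=
      (2 * fine (L1ul_norm (lifted_datum f r xi u0)))%:E)%E.
Proof.
have [u mu_ hu] := dominated_mild_solution.
have u_ge0 x t : 0 < t < T -> 0 <= u x t.
  by move=> tT; have [[A _ [_ /andP[h _]]] _] := hu x t tT.
pose c := 2 * (f xi * Ftail f xi `^ (1 + r) / r).
have c0 : 0 <= c.
  rewrite mulr_ge0// divr_ge0 ?(ltW r0)// mulr_ge0 ?powR_ge0//.
  exact/ltW/(class_S_gt0 hf).
have u_le x t : 0 < t < T -> u x t <= xi + c * W x t.
  move=> tT; have [[A xiA [PA /andP[_ uA]]] _] := hu x t tT.
  exact: le_trans uA (supersolution_le_heatR xiA PA).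
have mut t : measurable_fun setT (u^~ t).
  exact: (measurableT_comp mu_ (pair1_measurable (t : measurableTypeR R))).
have W_le x t : 0 < t < T -> W x t <= A0 * t `^ (- (n%:R / 2)).
  move=> tT; rewrite -lee_fin -(heatRE hf r0 xi0 heat_le x tT); exact: heat_le.
have W0 x t : 0 <= W x t.
  by rewrite fine_ge0// heat_ge0// => y; exact: (lifted_datum_ge0 u0 hf).
exists u.
  split.
  - apply: measurable_funTS; apply: measurable_fun_completedT.
    exact: (@measurable_fun_swap_args _ _ _ (measurableTypeR R) 'rV[R]_n R (fun t x => u x t) mu_).
  - exact: u_ge0.
  - exists (xi * 2 ^+ n + c * fine (L1ul_norm (lifted_datum f r xi u0))).
    apply: aeW => t tT.
    apply: (@L1ul_bounded _ _ _ (xi + c * (A0 * t `^ (- (n%:R / 2))))) => //.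
      move=> x; rewrite u_ge0//= (le_trans (u_le x t tT))// lerD2l ler_wpM2l//.
      exact: W_le.
    move=> y; apply: (integral_chi_heatR_le y tT (ltW xi0) c0 (mut t)) => x.
    by rewrite u_ge0//= u_le.
  - move=> a e a0 ae eT; exists (xi + c * (A0 * a `^ (- (n%:R / 2)))).
    apply: aeW => t /andP[at_ te]; apply: Lnorm_bounded => x.
    have tT : 0 < t < T by rewrite (lt_le_trans a0 at_) (le_lt_trans te eT).
    rewrite u_ge0//= (le_trans (u_le x t tT))// lerD2l ler_wpM2l//.
    apply: le_trans (W_le x t tT) _; rewrite ler_wpM2l ?(ltW A00)//.
    by apply: powRN_antitone => //; rewrite divr_ge0.
  - move=> t tT; apply: aeW => x; have [_ ->] := hu x t tT; congr (_ + _)%E.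
    pose h y s := f (Num.max 0 (u y s)).
    have mh : measurable_fun setT (fun z : measurableTypeR R * 'rV[R]_n => h z.2 z.1).
      exact: (measurableT_comp (measurable_f_max hf) mu_).
    have h0 y s : 0 <= h y s by apply: (class_S_ge0 hf); rewrite le_max lexx.
    rewrite (ge0_integral_src g x t mh h0).
    have mk : measurable_fun setT (fun z : measurableTypeR R * 'rV[R]_n =>
        (heat_kernel (x - z.2) (t - z.1) * enorm z.2 `^ (- g) * h z.2 z.1)%:E).
      apply/measurable_EFinP; apply: measurable_funM => //; apply: measurable_funM.
        apply: measurable_fun_heat_kernel.
          by apply: measurable_fun_rVB => //; exact: measurable_snd.
        by apply: measurable_funB => //; exact: measurable_fst.
      by apply: measurable_fun_enorm_powR; exact: measurable_snd.
    have k0 y s : 0 <= heat_kernel (x - y) (t - s) * enorm y `^ (- g) * h y s.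
      by rewrite mulr_ge0// mulr_ge0 ?heat_kernel_ge0 ?powR_ge0.
    rewrite -ge0_integral_completed_lebesgue; last 3 first.
    - exact: measurable_itv.
    - apply: measurable_funTS.
      apply: (measurable_fun_integral_param (borel_lebesgue n) mk) => s y.
      by rewrite lee_fin k0.
    - by move=> s _; apply: integral_ge0 => y _; rewrite lee_fin k0.
    apply: eq_integral => s; rewrite mem_setE in_itv/= => /andP[s0 st].
    have sT : 0 < s < T by rewrite s0 (lt_trans st)//; case/andP: tT.
    rewrite /heat /leb ge0_integral_completed.
    - apply: eq_integral => y _; rewrite /source /h max_r ?u_ge0//.
      by rewrite mulrA.
    - exact: measurableT.
    - rewrite (_ : (fun _ => _) = (fun y => (heat_kernel (x - y) (t - s) * enorm y `^ (- g) * h y s)%:E)).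
        exact: (measurableT_comp mk (pair1_measurable (s : measurableTypeR R))).
      by apply/funext => y; rewrite /source /h max_r ?u_ge0// mulrA.
    - move=> y _; rewrite lee_fin; have := k0 y s.
      by rewrite /source /h max_r ?u_ge0// mulrA.
(* Brings the bound to the shape of [integral_chi_heatR_le] with [a = 0]. *)
move=> t tT; rewrite -[X in (_ <= X%:E)%E]add0r -(mul0r (2 ^+ n)).
have pE : (fun x => tailF_pow f r (u x t)) = (fun x => tailF_pow f r (Num.max 0 (u x t))).
  by apply/funext => x; rewrite max_r ?u_ge0.
have mp : measurable_fun setT (fun x => tailF_pow f r (u x t)).
  by rewrite pE; exact: (measurableT_comp (measurable_tailF_pow hf (ltW r0)) (mut t)).
have pW x : 0 <= tailF_pow f r (u x t) <= 0 + 2 * W x t.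
  rewrite tailF_pow_ge0/= add0r.
  have [[A xiA [<- /andP[u1 uA]]] _] := hu x t tT.
  rewrite -(tailF_powE hf r (lt_le_trans xi0 xiA)).
  exact: (tailF_pow_le hf (ltW r0) u1 uA).
apply: (@L1ul_bounded R n (fun x => tailF_pow f r (u x t))
  (2 * (A0 * t `^ (- (n%:R / 2)))) _ mp).
  move=> x; have /andP[h0 h] := pW x; apply/andP; split; first exact: h0.
  apply: le_trans h _; rewrite add0r; apply: ler_wpM2l; first exact: ler0n.
  exact: W_le.
by move=> y; exact: (integral_chi_heatR_le y tT (lexx 0) (ler0n _ 2) mp pW).
Qed.

End existence.

(** * The three cases *)

Lemma small_powR {R : realType} (d e : R) : 0 < d -> 0 < e ->
  exists2 T, 0 < T <= 1 & forall t, 0 < t < T -> t `^ d <= e.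
Proof.
move=> d0 e0; exists (Num.min 1 (e `^ d^-1)).
  by rewrite lt_min ltr01 powR_gt0//= ge_min lexx.
move=> t /andP[t0]; rewrite lt_min => /andP[_ te].
rewrite -[leRHS]powRr1 ?(ltW e0)// -(mulVf (lt0r_neq0 d0)).
rewrite powRrM; apply: ge0_ler_powR; rewrite ?nnegrE ?powR_ge0 ?ltW//.
Qed.

(** If [q < 1 + r], some [th < 1] has [q < 1 + th r], and the limit gives the inequality for large
    arguments. If [q = 1 + r], then [1 + th r <= q] for [th <= 1], and the eventual bound by [q] is
    used with [th = 1]. *)
Lemma growth_threshold {R : realType} (f : R -> R) (q r : R) :
  class_S f q -> 1 <= q -> 0 < r ->
  (q < 1 + r \/ q = 1 + r /\
    \forall xi \near +oo, f^`()%classic xi * fine (tailF f xi) <= q) ->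
  exists th xi, [/\ 0 <= th, th <= 1, q < 1 + r -> th < 1, 0 < xi &
    forall u, xi <= u -> f^`()%classic u * Ftail f u <= 1 + th * r].
Proof.
move=> hf q1 r0 h.
suff [th [th0 th1 th2 nth]] : exists th, [/\ 0 <= th, th <= 1, q < 1 + r -> th < 1 &
    \forall xi \near +oo, f^`()%classic xi * fine (tailF f xi) <= 1 + th * r].
  have [M [_ hM]] := nth.
  exists th, (Num.max M 0 + 1); split=> //.
    by rewrite ltr_wpDl// le_max lexx orbT.
  move=> u Mu; rewrite Ftail.unlock; apply: hM.
  apply: lt_le_trans Mu; apply: (@le_lt_trans _ _ (Num.max M 0)).
    by rewrite le_max lexx.
  by rewrite ltrDl.
case: h => [qr|[qr nq]]; last first.
  by exists 1; split=> //; rewrite ?ler01// ?mul1r -?qr// ltxx.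
(* The midpoint between [1] and the value for which [1 + th r = q]. *)
pose th := ((q - 1) / r + 1) / 2.
have e1 : (q - 1) / r < 1 by rewrite ltr_pdivrMr// mul1r; lra.
have e2 : 0 <= (q - 1) / r by rewrite divr_ge0 ?subr_ge0// ltW.
exists th; split; rewrite ?/th; try lra.
have qth : q < 1 + th * r.
  have -> : th * r = (q - 1 + r) / 2 by rewrite /th; field; rewrite gt_eqF.
  lra.
have [_ _ _ lq] := hf.
near=> xi; apply: ltW; near: xi.
exact: (cvgr_lt q).
Unshelve. all: end_near. Qed.

(** * Heat flow of the lifted datum: general bound, and smallness in the critical case *)

Section datum.
Context {R : realType} (n : nat) (f : R -> R) (q r xi : R).
Variable u0 : 'rV[R]_n -> R.
Hypothesis hf : class_S f q.
Hypothesis n0 : (0 < n)%N.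
Hypothesis r0 : 0 < r.
Hypothesis xi0 : 0 < xi.
Hypothesis mu0 : completed_measurable_fun (borel_lebesgue n) setT u0.
Hypothesis u00 : forall x, 0 <= u0 x.
Let w x := tailF_pow f r (u0 x).
Hypothesis hw : L1ul w.
Let phi := lifted_datum f r xi u0.
Let mw : completed_measurable_fun (borel_lebesgue n) setT w.
Proof. by case: hw => -[]. Qed.

Lemma lifted_datum_le x : phi x <= w x + Phi f r xi.
Proof.
have P0 := Phi_gt0 hf r xi0; rewrite /phi /lifted_datum /w.
have [ux|xu] := leP (u0 x) xi.
  by rewrite lerDr tailF_pow_ge0.
rewrite (tailF_powE hf) ?(lt_trans xi0)//.
by rewrite lerDl ltW.
Qed.

Lemma L1ul_norm_lifted_datum_fin : (L1ul_norm phi < +oo)%E.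
Proof.
have P0 := Phi_gt0 hf r xi0.
apply: (@le_lt_trans _ _ (L1ul_norm (fun x => w x + Phi f r xi))).
  apply: le_L1ul_norm => x; rewrite !ger0_norm ?lifted_datum_le//.
    by rewrite addr_ge0 ?tailF_pow_ge0// ltW.
  exact: (lifted_datum_ge0 u0 hf r0 xi0).
apply: le_lt_trans (L1ul_normD mw (measurable_cst _)) _.
apply: lte_add_pinfty; first by case: hw.
by apply: le_lt_trans (L1ul_norm_cst n (ltW P0)) _; rewrite ltry.
Qed.

Let Kn : R := expR 4^-1 * n%:R ^+ n * 2 `^ (n%:R / 2).

Let Kn0 : 0 < Kn.
Proof. by rewrite /Kn mulr_gt0 ?powR_gt0// mulr_gt0 ?expR_gt0// exprn_gt0// ltr0n. Qed.

Lemma heat_lifted_datum_le : exists2 A0, 0 < A0 & forall t x, 0 < t < 1 ->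
  (heat t phi x <= (A0 * t `^ (- (n%:R / 2)))%:E)%E.
Proof.
have phi0 x : 0 <= phi x by exact: (lifted_datum_ge0 u0 hf r0 xi0).
have N0 := L1ul_norm_ge0 phi.
have Nf : L1ul_norm phi = (fine (L1ul_norm phi))%:E.
  by rewrite fineK// ge0_fin_numE// L1ul_norm_lifted_datum_fin.
exists (Kn * (fine (L1ul_norm phi) + 1)).
  by rewrite mulr_gt0// ltr_wpDl// fine_ge0.
move=> t x /andP[t0 t1].
have t01 : 0 < t <= 1 by rewrite t0 ltW.
apply: le_trans (heat_sup_le (measurable_lifted_datum hf r0 xi0 mu0) phi0 x n0 t01) _.
rewrite -/phi Nf -/Kn -EFinM lee_fin mulrAC.
by rewrite ler_wpM2r ?powR_ge0// ler_wpM2l ?(ltW Kn0)// lerDl.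
Qed.

(** The datum is at most [w1 + M'], where [w1] has uniformly local norm at most [A0 / (2 Kn)] and
    [M'] is constant. By [heat_sup_le] the first part uses half of [A0 t^(-n/2)]. The second keeps
    the value [M'], which is below the other half for small [t], as [t^(-n/2)] blows up. *)
Lemma heat_lifted_datum_small (A0 : R) : calL1ul w -> 0 < A0 ->
  exists2 T, 0 < T & forall t x, 0 < t < T ->
  (heat t phi x <= (A0 * t `^ (- (n%:R / 2)))%:E)%E.
Proof.
move=> [_ happ] A00.
have e0 : 0 < A0 / (2 * Kn) by rewrite divr_gt0// mulr_gt0.
have [h [[M hM] _] hh] := happ _ e0.
have P0 := Phi_gt0 hf r xi0.
have M0 : 0 <= M by apply: le_trans (hM 0).
pose M' := M + Phi f r xi.
have M'0 : 0 < M' by rewrite ltr_wpDl.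
pose w1 x := Num.max 0 (w x - M).
have w10 x : 0 <= w1 x by rewrite le_max lexx.
have mw1 : completed_measurable_fun (borel_lebesgue n) setT w1.
  apply: measurable_maxr; first exact: measurable_cst.
  by apply: measurable_funB; [exact: mw|exact: measurable_cst].
(* [(w - M)^+ <= |w - h|] because [h <= M]. *)
have Nw1 : (L1ul_norm w1 <= (A0 / (2 * Kn))%:E)%E.
  apply: le_trans (ltW hh); apply: le_L1ul_norm => x.
  rewrite ger0_norm// /w1 ge_max normr_ge0/=.
  apply: le_trans (ler_norm _); rewrite lerD2l lerN2.
  exact: le_trans (ler_norm _) (hM x).
have n2 : 0 < n%:R / 2 :> R by rewrite divr_gt0// ltr0n.
have AM : 0 < A0 / (2 * M') by rewrite divr_gt0// mulr_gt0.
have [T /andP[T0 T1] hT] := small_powR n2 AM.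
exists T => // t x tT; have /andP[t0 tT'] := tT.
have t01 : 0 < t <= 1 by rewrite t0 (le_trans (ltW tT')).
have mphi := measurable_lifted_datum hf r0 xi0 mu0.
apply: (@le_trans _ _ (heat t (fun x => w1 x + M') x)).
  apply: le_heat.
  - exact: mphi.
  - by apply: measurable_funD; [exact: mw1|exact: measurable_cst].
  - by move=> y; exact: (lifted_datum_ge0 u0 hf r0 xi0).
  move=> y; apply: le_trans (lifted_datum_le y) _.
  rewrite /M' addrA lerD2r -lerBlDr /w1 le_max lexx orbT//.
rewrite heatD; last 4 first.
- exact: mw1.
- exact: measurable_cst.
- exact: w10.
- by move=> y; exact: ltW.
rewrite (heat_cst x t0 (ltW M'0)).
apply: (@le_trans _ _ ((Kn * t `^ (- (n%:R / 2)))%:E * (A0 / (2 * Kn))%:E + M'%:E)%E).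
  apply: leeD; last exact: lexx.
  apply: le_trans (heat_sup_le mw1 w10 x n0 t01) _.
  apply: lee_wpmul2l; last exact: Nw1.
  by rewrite lee_fin mulr_ge0 ?powR_ge0// ltW.
rewrite -EFinM -EFinD lee_fin.
have tp : 0 < t `^ (n%:R / 2) by exact: powR_gt0.
rewrite powRN; set s := t `^ _ in tp *.
have hs : s <= A0 / (2 * M') := hT t tT.
have : M' <= A0 / 2 * s^-1.
  rewrite ler_pdivlMr//; apply: (@le_trans _ _ (M' * (A0 / (2 * M')))).
    by rewrite ler_wpM2l// ltW.
  by rewrite le_eqVlt; apply/orP; left; apply/eqP; field; rewrite gt_eqF.
have -> : Kn * s^-1 * (A0 / (2 * Kn)) = A0 / 2 * s^-1.
  by field; rewrite !gt_eqF.
lra.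
Qed.

End datum.

Theorem theorem1p3 (R : realType) (N : nat) (q r : R) (f : R -> R)
    (u0 : 'rV[R]_N -> R)
    (hN : (1 <= N)%N)
    (u0_meas : completed_measurable_fun (borel_lebesgue N) setT u0)
    (u0_ge0 : forall x, 0 <= u0 x)
    (hq : 1 <= q)
    (hf : class_S f q) :
  exists2 C : R, 0 < C &
  forall gamma : R, 0 < gamma -> gamma < Num.min 2 N%:R ->
    [\/ [/\ N%:R / (2 - gamma) < r, q < 1 + r &
           L1ul (fun x => tailF_pow f r (u0 x))],
        [/\ N%:R / (2 - gamma) < r, q = 1 + r,
           L1ul (fun x => tailF_pow f r (u0 x)) &
           \forall xi \near +oo, f^`()%classic xi * fine (tailF f xi) <= q] |
        [/\ r = N%:R / (2 - gamma), q < 1 + r &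
           calL1ul (fun x => tailF_pow f r (u0 x))]] ->
    exists2 T : R, 0 < T &
    exists2 u : 'rV[R]_N -> R -> R, local_solution gamma f u0 T u &
    forall t, 0 < t < T ->
      L1ul (fun x => tailF_pow f r (u x t)) /\
      (L1ul_norm (fun x => tailF_pow f r (u x t)) <= C%:E)%E.
Proof.
have N0 : 0 < N%:R :> R by rewrite ltr0n.
pose nearq := \forall xi \near +oo, f^`()%classic xi * fine (tailF f xi) <= q.
(* [C] is fixed before [gamma], so the consequences of the three cases that do not involve [gamma]
   are decided first. If they fail, no admissible [gamma] satisfies any case and every [C] will
   do. *)
have [[r0 [hqr hw]]|nP] := pselect (0 < r /\
    (q < 1 + r \/ q = 1 + r /\ nearq) /\ L1ul (fun x => tailF_pow f r (u0 x))); last first.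
  exists 1 => // gamma g0; rewrite lt_min => /andP[g2 gN] h; exfalso; apply: nP.
  have rN : 0 < N%:R / (2 - gamma) by rewrite divr_gt0// subr_gt0.
  case: h => -[h1 h2 h3].
  - by split; [exact: lt_trans rN h1|split=> //; left].
  - by move=> h4; split; [exact: lt_trans rN h1|split=> //; right].
  - by split; [rewrite h1|split; [left|case: h3]].
have [th [xi [th0 th1 th2 xi0 fF]]] := growth_threshold hf hq r0 hqr.
pose phi := lifted_datum f r xi u0.
have phi_fin : (L1ul_norm phi < +oo)%E by exact: (L1ul_norm_lifted_datum_fin hf r0 xi0 hw).
have fphi0 : 0 <= fine (L1ul_norm phi).
  by apply: fine_ge0; exact: L1ul_norm_ge0.
(* [th] and [xi] were found without [gamma], so this bound is uniform in it; the [+ 1] ensures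
   positivity. *)
exists (2 * fine (L1ul_norm phi) + 1); first by rewrite ltr_wpDl// mulr_ge0.
move=> g g0; rewrite lt_min => /andP[g2 gN] h.
pose b := N%:R / (2 * r) + g / 2 * th.
pose d := 1 - g / 2 - N%:R / (2 * r).
have g20 : 0 < 2 - g by rewrite subr_gt0.
(* Compares [N / (2 r)] with [1 - g / 2] through the ratio of the critical exponent to [r]: below 1
   in cases (i) and (ii), equal to 1 in case (iii). *)
have NrE : N%:R / (2 * r) = N%:R / (2 - g) / r * ((2 - g) / 2).
  by field; rewrite !gt_eqF.
suff [b1 d0 [A0 [T [A00 T0 heat_le small]]]] : [/\ b < 1, 0 <= d & exists A0 T,
    [/\ 0 < A0, 0 < T, forall (t : R) x, 0 < t < T ->
       (heat t phi x <= (A0 * t `^ (- (N%:R / 2)))%:E)%E &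
      src_const N r th g * A0 `^ r^-1 * T `^ d <= 2 `^ (- r^-1) / (2 * r)]].
  exists T; first exact: T0.
  have [u hu1 hu2] := local_solution_ex hf hN r0 xi0 th0 th1 fF (ltW g0) gN g2 b1 d0
    u0_meas u0_ge0 A00 T0 heat_le small phi_fin.
  exists u; first exact: hu1.
  move=> t tT; have [h1 h2] := hu2 t tT; split; first exact: h1.
  by apply: le_trans h2 _; rewrite lee_fin lerDl.
have dl0 : 0 < 2 `^ (- r^-1) / (2 * r) by rewrite divr_gt0 ?powR_gt0// mulr_gt0.
set dl := 2 `^ _ / _ in dl0 *.
have sc0 : b < 1 -> 0 <= src_const N r th g.
  by move=> b1; exact: src_const_ge0.
have gth : g / 2 * th <= g / 2 by rewrite ler_piMr// divr_ge0// ltW.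
have sup : N%:R / (2 - g) < r -> [/\ b < 1, 0 <= d & exists A0 T,
    [/\ 0 < A0, 0 < T, forall (t : R) x, 0 < t < T ->
       (heat t phi x <= (A0 * t `^ (- (N%:R / 2)))%:E)%E &
      src_const N r th g * A0 `^ r^-1 * T `^ d <= dl]].
  move=> hr.
  have nr : N%:R / (2 * r) < 1 - g / 2.
    have -> : 1 - g / 2 = (2 - g) / 2 by field.
    by rewrite NrE gtr_pMl ?divr_gt0// ltr_pdivrMr// mul1r.
  have d0 : 0 < d by rewrite /d; lra.
  have b1 : b < 1 by rewrite /b; lra.
  have [A0 A00 hA0] := heat_lifted_datum_le hf hN r0 xi0 u0_meas hw.
  set S := src_const N r th g * A0 `^ r^-1.
  have S0 : 0 <= S by rewrite mulr_ge0 ?sc0 ?powR_ge0.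
  have S1 : 0 < S + 1 by rewrite ltr_wpDl.
  have [T /andP[T0 T1] hT] := small_powR d0 (divr_gt0 dl0 S1).
  split=> //; first exact: ltW.
  (* [small_powR] bounds [t^d] only for [t < T], so half of [T] is taken; this also keeps times
     below [1]. *)
  exists A0, (T / 2); split=> //; first by rewrite divr_gt0.
    move=> t x /andP[t0 tT]; apply: hA0; rewrite t0/=; lra.
  apply: (@le_trans _ _ (S * (dl / (S + 1)))).
    by rewrite ler_wpM2l// hT// divr_gt0//=; lra.
  rewrite mulrCA ler_piMr ?(ltW dl0)// ler_pdivrMr// mul1r.
  by rewrite lerDl.
case: h => -[h1 h2 h3].
- exact: sup.
- by move=> _; exact: sup.
have nr : N%:R / (2 * r) = 1 - g / 2.
  by rewrite NrE -h1 divff ?gt_eqF// mul1r; field.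
have d0 : d = 0 by rewrite /d nr subrr.
have b1 : b < 1.
  have : g / 2 * th < g / 2 by rewrite gtr_pMr ?divr_gt0// th2.
  rewrite /b nr; lra.
split=> //; first by rewrite d0.
have S1 : 0 < src_const N r th g + 1 by rewrite ltr_wpDl// sc0.
(* With [d = 0], shrinking [T] does not help in [small], so [A0] is prescribed first and [T] adapted
   to it. The [+ 1] avoids dividing by zero. *)
pose A0 := (dl / (src_const N r th g + 1)) `^ r.
have A00 : 0 < A0 by rewrite powR_gt0// divr_gt0.
have [T T0 hT] := heat_lifted_datum_small hf hN r0 xi0 u0_meas hw h3 A00.
exists A0, T; split=> //.
rewrite d0 powRr0 mulr1 /A0 -powRrM divff ?gt_eqF// powRr1 ?(ltW (divr_gt0 dl0 S1))//.
by rewrite mulrCA ler_piMr ?(ltW dl0)// ler_pdivrMr// mul1r lerDl.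
Qed.
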